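(* Let $1 \le p < t < r < \infty$ or $1 \le p \le t < r = \infty$. Let $W:\mathbb{R}^n \to M_d(\mathbb{C})$ be a matrix weight. A subset $\mathcal{F} \subset M_p^{t,r}(W)$ is totally bounded if the following conditions are valid: (i) $\mathcal{F}$ uniformly vanishes at infinity, that is, $$\lim_{R\to\infty}\ \sup_{\vec f\in\mathcal{F}} \| \vec f \chi_{B^c(0,R)} \|_{M_p^{t,r}(W)} = 0;$$ (ii) $\mathcal{F}$ is equicontinuous, that is, $$\lim_{b\to 0}\ \sup_{\vec f\in\mathcal{F}}\ \sup_{y\in B(0,b)} \| \vec f - \tau_y \vec f \|_{M_p^{t,r}(W)} = 0,$$ where $\tau_y \vec f(x) := \vec f(x-y)$.
   Context: $n,d\in\mathbb{N}$; $M_d(\mathbb{C})$ is the set of $d\times d$ complex matrices, $\|A\|=\sup_{|\vec z|=1}|A\vec z|$ is the operator norm with respect to the Euclidean norm $|\cdot|$ on $\mathbb{C}^d$. A matrix weight is a function $W:\mathbb{R}^n\to M_d(\mathbb{C})$ such that $W(x)$ is nonnegative definite for every $x$, $W(x)$ is invertible for almost every $x$, and the entries of $W$ are locally integrable. Powers $W^\alpha(x)$ are defined (for a.e. $x$) by diagonalization: if $W(x)=U\,\mathrm{diag}(\lambda_i)U^*$ with $U$ unitary, then $W^\alpha(x)=U\,\mathrm{diag}(\lambda_i^\alpha)U^*$. $L^p_{\mathrm{loc}}(W)$ is the set of measurable $\vec f:\mathbb{R}^n\to\mathbb{C}^d$ with $\int_K |W^{1/p}(x)\vec f(x)|^p\,dx<\infty$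 for every compact $K$. For $j\in\mathbb{Z}$, $k\in\mathbb{Z}^n$, $Q_{j,k}=\prod_{i=1}^n[2^{-j}k_i,2^{-j}(k_i+1))$ are the dyadic cubes. For a cube $Q$, $W(Q):=\int_Q\|W(y)\|\,dy$. For $0<p<t<r<\infty$ or $0<p\le t<r=\infty$, the matrix weighted Bourgain-Morrey space $M_p^{t,r}(W)$ is the set of all $\vec f\in L^p_{\mathrm{loc}}(W)$ such that $$\|\vec f\|_{M_p^{t,r}(W)}:=\left\|\left\{W(Q_{j,k})^{1/t-1/p}\left(\int_{Q_{j,k}}|W^{1/p}(y)\vec f(y)|^p\,dy\right)^{1/p}\right\}_{j\in\mathbb{Z},k\in\mathbb{Z}^n}\right\|_{\ell^r}<\infty$$ (the quantity being interpreted as $+\infty$ when not finite). Functions equal a.e. are identified. $B(0,R)$ is the open ball of center $0$ and radius $R$, $B^c(0,R)$ its complement, and $\chi_E$ the characteristic function of $E$. A set in a metric space is totally bounded if for each $\epsilon>0$ it has a finite $\epsilon$-net. *)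

(* Defs.v *)
From HB Require Import structures.
From mathcomp Require Import all_boot all_order all_algebra.
From mathcomp Require Import complex.
From mathcomp Require Import all_classical all_reals all_analysis.

Set Implicit Arguments.
Unset Strict Implicit.
Unset Printing Implicit Defensive.

Import Order.TTheory GRing.Theory Num.Theory.
Import numFieldNormedType.Exports.

Local Open Scope classical_set_scope.
Local Open Scope ring_scope.

(** * Lebesgue measure on 'rV[R]_n

   The sigma-algebra generated by the coordinates (the Borel sets of R^n)
   carries the n-fold product of [lebesgue_measure], built by recursion on n.
   Its Caratheodory completion is the usual Lebesgue measure. *)

Definition measure_rV_display : measure_display -> measure_display.
Proof. exact. Qed.

Section measurable_rV.
Context {d : measure_display} {T : measurableType d} (n : nat).

Let coors : 'I_n -> 'rV[T]_n -> T := fun i x => x 0 i.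

Let rV_set0 : g_sigma_preimage coors set0.
Proof. exact: sigma_algebra0. Qed.

Let rV_setC A : g_sigma_preimage coors A -> g_sigma_preimage coors (~` A).
Proof. exact: sigma_algebraC. Qed.

Let rV_bigcup (F : (set 'rV[T]_n)^nat) :
  (forall i, g_sigma_preimage coors (F i)) ->
  g_sigma_preimage coors (\bigcup_i (F i)).
Proof. exact: sigma_algebra_bigcup. Qed.

HB.instance Definition _ := @isMeasurable.Build (measure_rV_display d)
  'rV[T]_n (g_sigma_preimage coors) rV_set0 rV_setC rV_bigcup.

End measurable_rV.

Lemma measurable_coord_rV d (T : measurableType d) n (i : 'I_n) :
  measurable_fun [set: 'rV[T]_n] (fun x : 'rV[T]_n => x 0 i).
Proof.
move=> _ Y mY; rewrite setTI; apply: sub_sigma_algebra => /=.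
rewrite -bigcup_seq/=; exists i => /=; first by rewrite mem_index_enum.
by exists Y => //; rewrite setTI.
Qed.

Lemma measurable_fun_rVP d1 d2 (T1 : measurableType d1) (T2 : measurableType d2)
    n (f : T1 -> 'rV[T2]_n) :
  (forall i, measurable_fun [set: T1] (fun x => f x 0 i)) ->
  measurable_fun [set: T1] f.
Proof.
move=> mf; suff : g_sigma_preimage (fun i x => f x 0 i) `<=` measurable.
  rewrite (g_sigma_preimage_comp (fun i (x : 'rV[T2]_n) => x 0 i) f).
  by move=> prefS _ A mA; apply: prefS; exists A.
apply: smallest_sub; first exact: sigma_algebra_measurable.
case: n => [|n] in f mf *; first by rewrite big_ord0.
rewrite -bigcup_mkord_ord; apply: bigcup_sub => i Ii.
by move=> A [B mB <-]; exact: mf.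
Qed.

Section product_rV.
Context {R : realType} (n : nat).
Variable mu : {sigma_finite_measure set 'rV[R]_n -> \bar R}.

Definition consrV (p : measurableTypeR R * 'rV[R]_n) : 'rV[R]_n.+1 :=
  \row_i if unlift ord0 i is Some j then p.2 0 j else p.1.

Definition unconsrV (x : 'rV[R]_n.+1) : measurableTypeR R * 'rV[R]_n :=
  (x 0 ord0, \row_j x 0 (lift ord0 j)).

Lemma consrVK : cancel consrV unconsrV.
Proof.
move=> [a v]; rewrite /unconsrV !mxE unlift_none; congr pair.
by apply/rowP => j; rewrite !mxE liftK.
Qed.

Lemma measurable_consrV : measurable_fun [set: _] consrV.
Proof.
apply: measurable_fun_rVP => i.
under eq_fun do rewrite mxE.
case: (unliftP ord0 i) => [j|] _; last exact: measurable_fst.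
exact: (measurableT_comp (measurable_coord_rV j)).
Qed.

Lemma measurable_unconsrV : measurable_fun [set: _] unconsrV.
Proof.
apply/measurable_fun_pairP; split => /=; first exact: measurable_coord_rV.
apply: measurable_fun_rVP => i /=.
by under eq_fun do rewrite mxE; exact: measurable_coord_rV.
Qed.

Definition prod_rV : set 'rV[R]_n.+1 -> \bar R :=
  pushforward (lebesgue_measure \x mu)%E consrV.

Let prod_rV0 : prod_rV set0 = 0%E.
Proof. by rewrite /prod_rV /pushforward preimage_set0 measure0. Qed.

Let prod_rV_ge0 A : (0 <= prod_rV A)%E.
Proof. exact: (measure_ge0 (lebesgue_measure \x mu)%E). Qed.

Let prod_rV_sigma_additive : semi_sigma_additive prod_rV.
Proof.
apply: (@measure_semi_sigma_additive _ _ _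
  (measure_function_pushforward__canonical__measure_function_Measure
     _ measurable_consrV)).
Qed.

HB.instance Definition _ := isMeasure.Build _ _ _ prod_rV
  prod_rV0 prod_rV_ge0 prod_rV_sigma_additive.

Let prod_rV_sigma_finite : sigma_finite setT prod_rV.
Proof.
have /sigma_finiteP[F [TF ndF Foo]] := sigma_finiteT (@lebesgue_measure R).
have /sigma_finiteP[G [TG ndG Goo]] := sigma_finiteT mu.
exists (fun k => unconsrV @^-1` (F k `*` G k)).
  rewrite -preimage_bigcup (_ : \bigcup_k _ = setT) ?preimage_setT//.
  rewrite -subTset => -[x y] _.
  have [k _ Fkx] : (\bigcup_k F k) x by rewrite -TF.
  have [l _ Gly] : (\bigcup_k G k) y by rewrite -TG.
  exists (maxn k l) => //; split => /=.
    by move: Fkx; exact/subsetPset/ndF/leq_maxl.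
  by move: Gly; exact/subsetPset/ndG/leq_maxr.
move=> k; have [mF Fkoo] := Foo k; have [mG Gkoo] := Goo k; split.
  by rewrite -[X in measurable X]setTI; apply: measurable_unconsrV => //;
    exact: measurableX.
rewrite /prod_rV /pushforward -comp_preimage (_ : _ \o _ = id).
  by rewrite preimage_id product_measure1E// lte_mul_pinfty// ge0_fin_numE.
by apply/funext => p; exact: consrVK.
Qed.

HB.instance Definition _ := Measure_isSigmaFinite.Build _ _ _ prod_rV
  prod_rV_sigma_finite.

End product_rV.

Fixpoint borel_lebesgue {R : realType} (n : nat) :
    {sigma_finite_measure set 'rV[R]_n -> \bar R} :=
  if n is m.+1 then prod_rV (borel_lebesgue m) else \d_(0 : 'rV[R]_0).

(* The measure of a box is the product of its side lengths. *)
Lemma borel_lebesgue_box (R : realType) n (a b : 'rV[R]_n) :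
  (forall i, a 0 i <= b 0 i) ->
  borel_lebesgue n [set x : 'rV[R]_n | forall i, a 0 i <= x 0 i < b 0 i] =
  (\prod_(i < n) (b 0 i - a 0 i))%:E.
Proof.
elim: n => [|n IH] in a b *; move=> ab.
  rewrite big_ord0 /= diracE mem_set//= => i; by case: i.
pose a' : 'rV[R]_n := \row_j a 0 (lift ord0 j).
pose b' : 'rV[R]_n := \row_j b 0 (lift ord0 j).
rewrite /= /prod_rV /pushforward.
pose J : set R := `[a 0 ord0, b 0 ord0[%classic.
have JE x : J x = (a 0 ord0 <= x < b 0 ord0) by rewrite /J set_itvco.
rewrite (_ : _ @^-1` _ = J `*`
   [set x : 'rV[R]_n | forall i, a' 0 i <= x 0 i < b' 0 i]); last first.
  apply/seteqP; split => [[x v]/= H|[x v]/= [H0 H] i].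
    split => /=; first by rewrite JE; have := H ord0; rewrite mxE unlift_none.
    by move=> i; have := H (lift ord0 i); rewrite !mxE liftK.
  rewrite mxE; case: (unliftP ord0 i) => [j ->|->].
    by have := H j; rewrite !mxE.
  by move: H0; rewrite JE.
rewrite product_measure1E//; last 2 first.
- exact: measurable_itv.
- rewrite (_ : [set _ | _] = \bigcap_(i in [set: 'I_n])
     ((fun x : 'rV[R]_n => x 0 i) @^-1` [set` `[a' 0 i, b' 0 i[])).
    apply: fin_bigcap_measurable => // i _; rewrite -[X in measurable X]setTI.
    by apply: measurable_coord_rV => //; exact: measurable_itv.
  apply/seteqP; split => x /= H i; first by move=> _; rewrite /= in_itv/=.
  by have /= := H i I; rewrite in_itv.
rewrite IH => [|i]; last by rewrite !mxE.
rewrite [X in (X * _)%E](lebesgue_measure_itv `[a 0 ord0, b 0 ord0[)/= lte_fin.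
rewrite big_ord_recl EFinM; congr (_ * _)%E; last first.
  by congr EFin; apply: eq_bigr => i _; rewrite !mxE.
case: ltP => // ba; rewrite (_ : b _ _ = a 0 ord0) ?subrr//.
by apply/eqP; rewrite eq_le ba ab.
Qed.

Section lebesgue_rV.
Context {R : realType} (n : nat).

Definition lebesgue_rV :=
  @completed_measure_extension _ _ _ (@borel_lebesgue R n).

HB.instance Definition _ := Measure.on lebesgue_rV.

(* R^n with the sigma-algebra of Lebesgue measurable sets. *)
Definition lebesgue_space := caratheodory_type (@borel_lebesgue R n)^*%mu.

End lebesgue_rV.
Arguments lebesgue_rV {R} n.
Arguments lebesgue_space R n : clear implicits.

(** * Euclidean norms, operator norm and powers of matrices *)

Section matrices.
Context {R : realType}.

Definition cabs (z : R[i]) : R := complex.Re `|z|.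

(* The library norm on matrices is the sup norm. *)
Definition enormR n (x : 'rV[R]_n) : R := Num.sqrt (\sum_(i < n) x 0 i ^+ 2).

Definition enormC d (z : 'cV[R[i]]_d) : R :=
  Num.sqrt (\sum_(i < d) cabs (z i 0) ^+ 2).

Definition opnorm d (A : 'M[R[i]]_d) : R :=
  sup [set enormC (A *m z) | z in [set z : 'cV[R[i]]_d | enormC z = 1]].

Definition eballR n (rho : R) : set 'rV[R]_n := [set x | enormR x < rho].

Definition nonneg_definite d (A : 'M[R[i]]_d) : Prop :=
  A \is hermsymmx /\
  forall z : 'cV[R[i]]_d, 0 <= ((map_mx Num.conj z)^T *m A *m z) 0 0.

(* [A = P^-1 *m diag_mx (spectral_diag A) *m P] with [P = spectralmx A] unitary
   whenever [A] is normal; for nonnegative definite [A] the eigenvalues are real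
   and the power does not depend on the chosen diagonalization. *)
Definition mxpowR d (A : 'M[R[i]]_d) (alpha : R) : 'M[R[i]]_d :=
  invmx (spectralmx A)
  *m diag_mx (map_mx (fun l : R[i] => ((complex.Re l) `^ alpha)%:C%C)
                (spectral_diag A))
  *m spectralmx A.

End matrices.

(** * Matrix weights and matrix weighted Bourgain-Morrey spaces *)

Section bourgain_morrey.
Local Open Scope ereal_scope.
Context {R : realType} (n d : nat).
Implicit Types (W : 'rV[R]_n -> 'M[R[i]]_d) (f : 'rV[R]_n -> 'cV[R[i]]_d).

Definition measurableC (g : 'rV[R]_n -> R[i]) : Prop :=
  measurable_fun [set: lebesgue_space R n] (fun x => complex.Re (g x)) /\
  measurable_fun [set: lebesgue_space R n] (fun x => complex.Im (g x)).

Definition locally_integrableC (g : 'rV[R]_n -> R[i]) : Prop :=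
  measurableC g /\
  forall K : set 'rV[R]_n, compact K ->
    \int[lebesgue_rV n]_(x in K) (cabs (g x))%:E < +oo.

Definition matrix_weight W : Prop :=
  [/\ forall x, nonneg_definite (W x),
      {ae lebesgue_rV n, forall x, W x \in unitmx} &
      forall i j, locally_integrableC (fun x => W x i j)].

Definition weighted_integral W (p : R) f (E : set 'rV[R]_n) : \bar R :=
  \int[lebesgue_rV n]_(x in E) (enormC (mxpowR (W x) p^-1 *m f x) `^ p)%:E.

Definition Lp_loc W (p : R) f : Prop :=
  (forall i, measurableC (fun x => f x i 0%R)) /\
  forall K : set 'rV[R]_n, compact K -> weighted_integral W p f K < +oo.

Definition dyadic_cube (j : int) (k : 'rV[int]_n) : set 'rV[R]_n :=
  [set x | forall i, (2 ^ (- j) * (k 0 i)%:~R <= x 0 i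
                      < 2 ^ (- j) * ((k 0 i)%:~R + 1))%R].

Definition weight_of W (Q : set 'rV[R]_n) : \bar R :=
  \int[lebesgue_rV n]_(y in Q) (opnorm (W y))%:E.

(* The norm of l^r(I) for a family in [0, +oo]; [r] is meant to be in
   ]0, +oo]. *)
Definition lnorm (I : choiceType) (r : \bar R) (a : I -> \bar R) : \bar R :=
  if r is s%:E then (\esum_(i in [set: I]) a i `^ s) `^ s^-1
  else ereal_sup (range a).

Definition BM_norm W (p t : R) (r : \bar R) f : \bar R :=
  lnorm r (fun jk : int * 'rV[int]_n =>
    let Q := dyadic_cube jk.1 jk.2 in
    weight_of W Q `^ (t^-1 - p^-1) * weighted_integral W p f Q `^ p^-1).

Definition BM_space W (p t : R) (r : \bar R) : set ('rV[R]_n -> 'cV[R[i]]_d) :=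
  [set f | Lp_loc W p f /\ BM_norm W p t r f < +oo].

Definition cutoff (E : set 'rV[R]_n) f : 'rV[R]_n -> 'cV[R[i]]_d :=
  fun x => (\1_E x *: f x)%R.

Definition translate (y : 'rV[R]_n) f : 'rV[R]_n -> 'cV[R[i]]_d :=
  fun x => f (x - y)%R.

(* Supremum in [0, +oo], so that the supremum of the empty set is 0. *)
Definition nnsup (A : set (\bar R)) : \bar R := ereal_sup (0 |` A).

(* The elements are functions rather than classes of functions equal almost
   everywhere: [BM_norm] does not distinguish between representatives. *)
Definition BM_totally_bounded W (p t : R) (r : \bar R)
    (F : set ('rV[R]_n -> 'cV[R[i]]_d)) : Prop :=
  forall e : R, (0 < e)%R -> exists N : set ('rV[R]_n -> 'cV[R[i]]_d),
    [/\ finite_set N, N `<=` BM_space W p t r &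
        forall f, F f ->
          exists2 g, N g & BM_norm W p t r (fun x => f x - g x)%R < e%:E].

Definition vanishes_at_infinity W (p t : R) (r : \bar R)
    (F : set ('rV[R]_n -> 'cV[R[i]]_d)) : Prop :=
  nnsup [set BM_norm W p t r (cutoff (~` eballR rho) f) | f in F]
    @[rho --> +oo%R] --> 0.

Definition BM_equicontinuous W (p t : R) (r : \bar R)
    (F : set ('rV[R]_n -> 'cV[R[i]]_d)) : Prop :=
  nnsup [set nnsup [set BM_norm W p t r (fun x => f x - translate y f x)%R
                   | y in eballR b] | f in F]
    @[b --> 0^'+] --> 0.

End bourgain_morrey.

(* Main.v *)
Require Import Defs.
From HB Require Import structures.
From mathcomp Require Import all_boot all_order all_algebra.
From mathcomp Require Import complex.
From mathcomp Require Import all_classical all_reals all_analysis.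
From mathcomp Require Import measurable_realfun lra.
(** The functions of the family are compared with their means over the cubes of
    one small dyadic level, the cells. Equicontinuity says that [f x] is close to
    [f (x + y)] for all small [y]. Averaging over the [y] that lead from [x] to the
    points of a cell near [x], and applying Jensen's inequality twice, with exponent
    [p >= 1] at each point and with exponent [r / p >= 1] in the [l^r] sum, bounds
    the distance from [f] to its cell means by the modulus of continuity, with a
    constant that does not depend on the size of the cells ([vpw_sub_mean],
    [fnorm_average]). By the condition at infinity only the finitely many cells
    meeting a ball matter. Up to a small error, a function of the family is
    therefore determined by finitely many vectors of C^d.

    It remains to see that these vectors form a totally bounded set for the norm
    they inherit. They are bounded in the Euclidean norm ([mean_bounded]): on one
    cell, [f] is close to its means over this cell and over a neighbouring one, so
    the two means differ by a bounded amount, because the weight is invertible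
    almost everywhere and thus controls constant vectors on every set of positive
    measure ([pw_lower]). Far away the means are bounded by the condition at
    infinity, and one walks from there to any given cell. A constant vector on a cell
    may have infinite Bourgain-Morrey norm, but the means of the family do not, so they
    lie in a subspace of C^d on which this norm is bounded by the Euclidean one
    ([quasi_norm_bounded]). Functions whose means have the same coordinates up to a fine
    grid are then close ([finite_net], [family_net]), and one function for each
    occupied grid point gives the net.

    Two questions of measurability have to be settled first. The power W^(1/p) is
    measurable, although eigenvectors cannot be read off measurably: the functions [g]
    for which the entries of [g (W x)] are measurable contain the polynomials and
    are closed under pointwise limits, hence contain exponentials, step functions and all
    nonnegative Borel functions ([measM_mxpowR]). Tonelli's theorem for
    [f x - f (x + y)] requires Borel functions, as subtraction is not measurable for
    Lebesgue measurable sets; every Lebesgue measurable function is therefore replaced by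
    a Borel one that agrees with it off a Borel null set ([borel_representativeM],
    [BM_norm_borel]), which translations preserve ([borel_lebesgue_shift]).

    Quasi-triangle inequalities suffice throughout, which keeps the case of finite and
    infinite [r] uniform. *)

Import Order.TTheory GRing.Theory Num.Theory.
Import numFieldNormedType.Exports.
Local Open Scope classical_set_scope.
Local Open Scope ring_scope.
Set Implicit Arguments.
Unset Strict Implicit.
Unset Printing Implicit Defensive.

(** * Complex-valued measurable functions *)

Section complex_measurability.
Context {R : realType} {d : measure_display} {T : measurableType d}.
Implicit Types f g : T -> R[i].

Definition measC f : Prop :=
  measurable_fun [set: T] (fun x => complex.Re (f x)) /\
  measurable_fun [set: T] (fun x => complex.Im (f x)).

Lemma measC_cst (c : R[i]) : measC (fun=> c).
Proof. by split; exact: measurable_cst. Qed.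

Lemma measCD f g : measC f -> measC g -> measC (fun x => f x + g x).
Proof.
move=> [fr fi] [gr gi]; split.
  by under eq_fun do rewrite raddfD; exact: measurable_funD.
by under eq_fun do rewrite raddfD; exact: measurable_funD.
Qed.

Lemma measCM f g : measC f -> measC g -> measC (fun x => f x * g x).
Proof.
move=> [fr fi] [gr gi]; split.
  rewrite (_ : (fun x => _) = fun x => complex.Re (f x) * complex.Re (g x) -
     complex.Im (f x) * complex.Im (g x)); last first.
    by apply/funext => x; case: (f x) (g x) => [? ?] [? ?].
  by apply: measurable_funB; exact: measurable_funM.
rewrite (_ : (fun x => _) = fun x => complex.Re (f x) * complex.Im (g x) +
   complex.Im (f x) * complex.Re (g x)); last first.
  by apply/funext => x; case: (f x) (g x) => [? ?] [? ?].
by apply: measurable_funD; exact: measurable_funM.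
Qed.

Lemma measCN f : measC f -> measC (fun x => - f x).
Proof.
move=> mf; rewrite (_ : (fun x => _) = fun x => -1 * f x).
  by apply: measCM => //; exact: measC_cst.
by apply/funext => x; rewrite mulN1r.
Qed.

Lemma measCB f g : measC f -> measC g -> measC (fun x => f x - g x).
Proof. by move=> mf mg; apply: measCD => //; exact: measCN. Qed.

Lemma measC_sum (I : Type) (s : seq I) (P : pred I) (F : I -> T -> R[i]) :
  (forall i, measC (F i)) -> measC (fun x => \sum_(i <- s | P i) F i x).
Proof.
move=> mF; elim: s => [|i s IH].
  by under eq_fun do rewrite big_nil; exact: measC_cst.
under eq_fun do rewrite big_cons.
by case: (P i) => //; exact: measCD.
Qed.

Lemma measC_prod (I : Type) (s : seq I) (P : pred I) (F : I -> T -> R[i]) :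
  (forall i, measC (F i)) -> measC (fun x => \prod_(i <- s | P i) F i x).
Proof.
move=> mF; elim: s => [|i s IH].
  by under eq_fun do rewrite big_nil; exact: measC_cst.
under eq_fun do rewrite big_cons.
by case: (P i) => //; exact: measCM.
Qed.

Lemma measC_cvg (F : nat -> T -> R[i]) f :
  (forall m, measC (F m)) ->
  (forall x, complex.Re (F m x) @[m --> \oo] --> complex.Re (f x)) ->
  (forall x, complex.Im (F m x) @[m --> \oo] --> complex.Im (f x)) -> measC f.
Proof.
move=> mF cr ci; split.
  apply: (@measurable_fun_cvg _ _ _ _ (fun m x => complex.Re (F m x))) => //.
  by move=> m; exact: (mF m).1.
apply: (@measurable_fun_cvg _ _ _ _ (fun m x => complex.Im (F m x))) => //.
by move=> m; exact: (mF m).2.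
Qed.

Lemma cabsE (z : R[i]) :
  cabs z = Num.sqrt (complex.Re z ^+ 2 + complex.Im z ^+ 2).
Proof. by rewrite /cabs normc_def. Qed.

Lemma measurable_sqrt : measurable_fun [set: R] (@Num.sqrt R).
Proof. by apply: continuous_measurable_fun; exact: sqrt_continuous. Qed.

Lemma measurable_cabs f : measC f -> measurable_fun [set: T] (fun x => cabs (f x)).
Proof.
move=> [fr fi]; under eq_fun do rewrite cabsE.
apply: (measurableT_comp measurable_sqrt) => //.
by apply: measurable_funD; exact: measurable_funX.
Qed.

Definition measM m n (A : T -> 'M[R[i]]_(m, n)) : Prop :=
  forall i j, measC (fun x => A x i j).

Lemma measM_mul m n p (A : T -> 'M[R[i]]_(m, n)) (B : T -> 'M[R[i]]_(n, p)) :
  measM A -> measM B -> measM (fun x => A x *m B x).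
Proof.
move=> mA mB i j; under eq_fun do rewrite mxE.
by apply: measC_sum => k; exact: measCM.
Qed.

Lemma measM_det n (A : T -> 'M[R[i]]_n) : measM A -> measC (fun x => \det (A x)).
Proof.
move=> mA; apply: measC_sum => s; apply: measCM; first exact: measC_cst.
by apply: measC_prod => i; exact: mA.
Qed.

Lemma measM_adj n (A : T -> 'M[R[i]]_n) : measM A -> measM (fun x => \adj (A x)).
Proof.
move=> mA i j; under eq_fun do rewrite mxE.
apply: measCM; first exact: measC_cst.
apply: (@measM_det _ (fun x => row' j (col' i (A x)))) => k l.
by under eq_fun do rewrite !mxE; exact: mA.
Qed.

Lemma measurable_enormC n (v : T -> 'cV[R[i]]_n) :
  measM v -> measurable_fun [set: T] (fun x => enormC (v x)).
Proof.
move=> mv; apply: (measurableT_comp measurable_sqrt).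
apply: measurable_sum => i; apply: measurable_funX; exact: measurable_cabs.
Qed.

Lemma measC_if (A : set T) f g : measurable A -> measC f -> measC g ->
  measC (fun x => if x \in A then f x else g x).
Proof.
move=> mA [fr fi] [gr gi].
have mb : measurable_fun [set: T] (fun x => x \in A).
  apply: (measurable_fun_bool true).
  rewrite setTI (_ : _ @^-1` _ = A)//.
  by apply/seteqP; split => x /=; [exact: set_mem|exact: mem_set].
split.
  rewrite (_ : (fun x => _) = fun x => if x \in A then complex.Re (f x)
    else complex.Re (g x)); last by apply/funext => x; case: ifP.
  exact: measurable_fun_ifT.
rewrite (_ : (fun x => _) = fun x => if x \in A then complex.Im (f x)
    else complex.Im (g x)); last by apply/funext => x; case: ifP.
exact: measurable_fun_ifT.
Qed.

End complex_measurability.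

(** * Measurability of the powers of a matrix weight *)

Section diagonalized_matrices.
Context {F : fieldType} (n : nat) (P : 'M[F]_n).
Hypothesis uP : P \in unitmx.

Lemma conj_diag_mxE (u : 'rV[F]_n) i j :
  (invmx P *m diag_mx u *m P) i j = \sum_k (invmx P i k * P k j) * u 0 k.
Proof.
by rewrite mxE; apply: eq_bigr => k _; rewrite mul_mx_diag !mxE mulrAC.
Qed.

Lemma conj_diag_mxM (u v w : 'rV[F]_n) : (forall i, w 0 i = u 0 i * v 0 i) ->
  invmx P *m diag_mx w *m P =
  (invmx P *m diag_mx u *m P) *m (invmx P *m diag_mx v *m P).
Proof.
move=> wE; rewrite !mulmxA mulmxK// -[X in _ = X *m _]mulmxA mulmx_diag.
by congr (_ *m diag_mx _ *m _); apply/rowP => i; rewrite !mxE wE.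
Qed.

Lemma conj_diag_mx_const (u : 'rV[F]_n) c : (forall i, u 0 i = c) ->
  invmx P *m diag_mx u *m P = c%:M.
Proof.
move=> uE; rewrite (_ : u = const_mx c); last by apply/rowP => i; rewrite mxE.
by rewrite diag_const_mx mul_mx_scalar -scalemxAl mulVmx// scalemx1.
Qed.

Lemma conj_diag_mx_unit (u : 'rV[F]_n) :
  (invmx P *m diag_mx u *m P \in unitmx) = [forall i, u 0 i != 0].
Proof.
rewrite !unitmx_mul unitmx_inv uP/= andbT unitmxE unitfE det_diag.
by apply/prodf_neq0/forallP => + i => /(_ i) //; exact.
Qed.

End diagonalized_matrices.

(** The eigenvalues of a Hermitian matrix are real, so a diagonal that agrees with
    them whenever they are real rebuilds the matrix. *)
Lemma hermsymmx_spectral (C : numClosedFieldType) n (A : 'M[C]_n)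
    (u : 'rV[C]_n) : A \is hermsymmx ->
  (forall i, spectral_diag A 0 i \is Num.real -> u 0 i = spectral_diag A 0 i) ->
  invmx (spectralmx A) *m diag_mx u *m spectralmx A = A.
Proof.
move=> hA uE; have /hermitian_normalmx/orthomx_spectralP AE := hA.
rewrite [RHS]AE; congr (_ *m diag_mx _ *m _); apply/rowP => i.
by rewrite uE// (mxOverP (hermitian_spectral_diag_real hA)).
Qed.

Section double_exponential.
Context {R : realType}.

Lemma cvg_expRN_nat (a : R) : 0 < a -> expR (- (a * m%:R)) @[m --> \oo] --> (0 : R).
Proof.
move=> a0; under eq_fun do rewrite mulrC -mulrN expRM_natl.
apply: cvg_expr; rewrite ger0_norm ?expR_ge0// -expR0 ltr_expR.
by rewrite oppr_lt0.
Qed.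

Lemma cvg_expR2_pos (a : R) : 0 < a ->
  expR (- expR (- (a * m%:R))) @[m --> \oo] --> (1 : R).
Proof.
move=> a0; have h : {for 0, continuous (fun u : R => expR (- u))}.
  apply: continuous_comp; first exact: opp_continuous.
  exact: continuous_expR.
by have := continuous_cvg _ h (cvg_expRN_nat a0); rewrite /= oppr0 expR0; exact.
Qed.

Lemma cvg_expR2_neg (a : R) : a < 0 ->
  expR (- expR (- (a * m%:R))) @[m --> \oo] --> (0 : R).
Proof.
move=> a0; apply: (@squeeze_cvgr _ _ _ _ (fun=> 0) (fun m => expR (- ((- a) * m%:R)))).
- near=> m; rewrite expR_ge0/= ler_expR lerN2 mulNr.
  apply: le_trans (expR_ge1Dx _); by rewrite lerDr.
- exact: cvg_cst.
- by apply: cvg_expRN_nat; rewrite oppr_gt0.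
Unshelve. all: by end_near. Qed.

End double_exponential.

(** The entries of a function [g] of a matrix depend on [g] only through its
    values at the eigenvalues [lam]; the eigenvectors enter through the
    coefficients [c], about which nothing but the two hypotheses is known: no
    measurable choice of eigenvectors is made. *)
Section functional_calculus.
Import HBNNSimple.
Context {R : realType} {d : measure_display} {T : measurableType d} (n : nat).
Variables (c : 'I_n -> 'I_n -> 'I_n -> T -> R[i]) (lam : 'I_n -> T -> R).

Definition fcalc (g : R -> R) (i j : 'I_n) (x : T) : R[i] :=
  \sum_k c i j k x * (g (lam k x))%:C%C.

Definition fmeas (g : R -> R) := forall i j, measC (fcalc g i j).

Hypothesis fcalcM : forall g h i j x,
  fcalc (fun l => g l * h l) i j x = \sum_k fcalc g i k x * fcalc h k j x.
Hypothesis fmeas_cst : forall a, fmeas (fun=> a).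

Lemma fmeasM g h : fmeas g -> fmeas h -> fmeas (fun l => g l * h l).
Proof.
move=> mg mh i j; rewrite (funext (fcalcM g h i j)).
by apply: measC_sum => k; exact: measCM.
Qed.

Lemma fmeasD g h : fmeas g -> fmeas h -> fmeas (fun l => g l + h l).
Proof.
move=> mg mh i j; rewrite (_ : fcalc _ _ _ =
    fun x => fcalc g i j x + fcalc h i j x); first exact: measCD.
apply/funext => x; rewrite -big_split/=; apply: eq_bigr => k _.
by rewrite rmorphD mulrDr.
Qed.

Lemma fmeas_sum (I : Type) (s : seq I) (P : pred I) (g : I -> R -> R) :
  (forall i, fmeas (g i)) -> fmeas (fun l => \sum_(i <- s | P i) g i l).
Proof.
move=> mg; elim: s => [|i s IH].
  by under eq_fun do rewrite big_nil; exact: fmeas_cst.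
under eq_fun do rewrite big_cons.
by case: (P i) => //; exact: fmeasD.
Qed.

Lemma fmeas_prod (I : Type) (s : seq I) (P : pred I) (g : I -> R -> R) :
  (forall i, fmeas (g i)) -> fmeas (fun l => \prod_(i <- s | P i) g i l).
Proof.
move=> mg; elim: s => [|i s IH].
  by under eq_fun do rewrite big_nil; exact: fmeas_cst.
under eq_fun do rewrite big_cons.
by case: (P i) => //; exact: fmeasM.
Qed.

Lemma fmeasX g m : fmeas g -> fmeas (fun l => g l ^+ m).
Proof.
move=> mg; elim: m => [|m IH]; first exact: fmeas_cst.
by under eq_fun do rewrite exprS; exact: fmeasM.
Qed.

Lemma fmeas_cvg (G : nat -> R -> R) g : (forall m, fmeas (G m)) ->
  (forall l, G m l @[m --> \oo] --> g l) -> fmeas g.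
Proof.
move=> mG Gg i j.
have ReE h x : complex.Re (fcalc h i j x) =
  \sum_k complex.Re (c i j k x) * h (lam k x).
  rewrite raddf_sum; apply: eq_bigr => k _.
  by case: (c i j k x) => ? ? /=; rewrite mulr0 subr0.
have ImE h x : complex.Im (fcalc h i j x) =
  \sum_k complex.Im (c i j k x) * h (lam k x).
  rewrite raddf_sum; apply: eq_bigr => k _.
  by case: (c i j k x) => ? ? /=; rewrite mulr0 add0r.
apply: (@measC_cvg _ _ _ (fun m x => fcalc (G m) i j x)) => [m|x|x].
- exact: mG.
- rewrite ReE; under eq_fun do rewrite ReE.
  apply: cvg_big => [|k _]; first exact: add_continuous.
  by apply: cvgM; [exact: cvg_cst|exact: Gg].
- rewrite ImE; under eq_fun do rewrite ImE.
  apply: cvg_big => [|k _]; first exact: add_continuous.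
  by apply: cvgM; [exact: cvg_cst|exact: Gg].
Qed.

(** Closure under limits gives the exponential series, and with it all the functions
    that the next steps need: no inverse and no square root of a matrix occurs. *)
Lemma fmeas_expR g : fmeas g -> fmeas (fun l => expR (g l)).
Proof.
move=> mg; apply: (@fmeas_cvg (fun m l => series (exp_coeff (g l)) m)) => [m|l].
  apply: fmeas_sum => k; rewrite /exp_coeff/=.
  by apply: fmeasM; [exact: fmeasX|exact: fmeas_cst].
exact: is_cvg_series_exp_coeff.
Qed.

Hypothesis fmeas_id : fmeas id.

Lemma fmeas_exp2 (g : R -> R) m : fmeas g ->
  fmeas (fun l => expR (- expR (- (g l * m)))).
Proof.
move=> mg; apply: (fmeas_expR (g := fun l => - expR (- (g l * m)))).
under eq_fun do rewrite -mulN1r.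
apply: fmeasM; first exact: fmeas_cst.
apply: (fmeas_expR (g := fun l => - (g l * m))).
under eq_fun do rewrite -mulN1r.
apply: fmeasM; first exact: fmeas_cst.
by apply: fmeasM => //; exact: fmeas_cst.
Qed.

(** [exp (- exp (- m (l - a)))] tends to [1] for [l > a] and to [0] for [l < a]; the
    value at [l = a] is removed by a second limit, letting the threshold decrease
    to [a]. *)
Lemma fmeas_ray (a : R) : fmeas (\1_(`]a, +oo[)).
Proof.
pose h (b l : R) : R := if b < l then 1 else if l < b then 0 else expR (- 1).
have mh b : fmeas (h b).
  apply: (@fmeas_cvg (fun m l => expR (- expR (- ((l - b) * m%:R)))))
    => [m|l].
    apply: (fmeas_exp2 (g := fun l => l - b)); apply: fmeasD; first exact: fmeas_id.
    exact: fmeas_cst.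
  rewrite /h; case: ltgtP => bl.
  - by apply: cvg_expR2_pos; rewrite subr_gt0.
  - by apply: cvg_expR2_neg; rewrite subr_lt0.
  - rewrite bl subrr; under eq_fun do rewrite mul0r oppr0 expR0; exact: cvg_cst.
apply: (@fmeas_cvg (fun m => h (a + m.+1%:R^-1))) => // l.
rewrite indicE; case: (ltP a l) => al.
  rewrite mem_set/=; last by rewrite in_itv/= al.
  apply: cvg_near_cst; near=> m; rewrite /h (_ : _ < l)//.
  rewrite -ltrBrDl; near: m.
  by apply: near_infty_natSinv_lt (PosNum _); rewrite subr_gt0.
rewrite memNset/=; last by rewrite in_itv/= andbT => /(le_lt_trans al); rewrite ltxx.
apply: cvg_near_cst; near=> m; rewrite /h.
have lt : l < a + m.+1%:R^-1 by rewrite (le_lt_trans al)// ltrDl invr_gt0.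
by rewrite lt ltNge (ltW lt).
Unshelve. all: by end_near. Qed.

(** The sets with this property form a sigma-algebra: complements and countable
    unions are sums, products and limits of indicator functions. *)
Lemma fmeas_indic (B : set R) : measurable B -> fmeas (\1_B).
Proof.
move=> mB; have : (@RGenOInfty.G R).-sigma.-measurable B.
  by rewrite -RGenOInfty.measurableE.
move: B {mB}; apply: smallest_sub => [|B [a ->]]; last exact: fmeas_ray.
split => [|B mB|B mB].
- rewrite /= indic0; exact: fmeas_cst.
- rewrite /= (_ : \1__ = fun l => 1 + (-1) * \1_B l).
    apply: fmeasD; first exact: fmeas_cst.
    by apply: fmeasM => //; exact: fmeas_cst.
  apply/funext => l; rewrite setTD !indicE in_setC.
  by case: (l \in B); rewrite ?mulr1 ?mulr0 ?addr0 ?subrr.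
- apply: (@fmeas_cvg (fun m l => 1 + (-1) * \prod_(i < m) (1 + (-1) * \1_(B i) l))) => [m|l].
    apply: fmeasD; first exact: fmeas_cst.
    apply: fmeasM; first exact: fmeas_cst.
    apply: fmeas_prod => i; apply: fmeasD; first exact: fmeas_cst.
    by apply: fmeasM; [exact: fmeas_cst|exact: mB].
  rewrite indicE; have [[k _ Bkl]|NBl] := pselect ((\bigcup_k B k) l).
    rewrite mem_set//=; last by exists k.
    apply: cvg_near_cst; exists k.+1 => // m /= km.
    rewrite (bigD1 (Ordinal km))//= indicE mem_set//= mulr1 subrr mul0r mulr0.
    by rewrite addr0.
  rewrite memNset//=; apply: cvg_near_cst; near=> m.
  rewrite big1 ?mulr1 ?subrr// => i _.
  by rewrite indicE memNset ?mulr0 ?addr0// => Bil; apply: NBl; exists i.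
Unshelve. all: by end_near. Qed.

Lemma fmeas_borel (g : R -> R) :
  measurable_fun [set: R] g -> (forall l, 0 <= g l) -> fmeas g.
Proof.
move=> mg g0.
have [||/= G [_ Gg]] := @approximation _ _ _ setT measurableT (EFin \o g).
- exact/measurable_EFinP.
- by move=> l _; rewrite lee_fin.
apply: (@fmeas_cvg (fun m => G m)) => [m|l].
  rewrite (_ : (G m : R -> R) = fun l => \sum_(y <- finmap.enum_fset (fset_set (range (G m)))) (y * \1_(G m @^-1` [set y]) l)).
    apply: fmeas_sum => y; apply: fmeasM; first exact: fmeas_cst.
    by apply: fmeas_indic; exact: measurable_sfunP.
  by apply/funext => l; rewrite fimfunE fsbig_finite.
by have /fine_cvgP[] := Gg l I.
Qed.

End functional_calculus.

Definition spectral_fun (R : realType) n (g : R -> R) (B : 'M[R[i]]_n) : 'M[R[i]]_n :=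
  invmx (spectralmx B)
  *m diag_mx (map_mx (fun l => (g (complex.Re l))%:C%C) (spectral_diag B))
  *m spectralmx B.

Lemma spectral_funE (R : realType) n (g : R -> R) (B : 'M[R[i]]_n) i j :
  spectral_fun g B i j = \sum_k (invmx (spectralmx B) i k * spectralmx B k j)
    * (g (complex.Re (spectral_diag B 0 k)))%:C%C.
Proof.
by rewrite conj_diag_mxE; apply: eq_bigr => k _; rewrite mxE.
Qed.

Lemma spectral_funM (R : realType) n (g h : R -> R) (B : 'M[R[i]]_n) :
  spectral_fun (fun l => g l * h l) B = spectral_fun g B *m spectral_fun h B.
Proof.
apply: conj_diag_mxM => [|i]; first exact: spectral_unit.
by rewrite !mxE rmorphM.
Qed.

Lemma spectral_fun_cst (R : realType) n a (B : 'M[R[i]]_n) :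
  spectral_fun (fun=> a) B = (a%:C%C)%:M.
Proof.
by apply: conj_diag_mx_const => [|i]; [exact: spectral_unit|rewrite mxE].
Qed.

Lemma spectral_fun_id (R : realType) n (B : 'M[R[i]]_n) :
  B \is hermsymmx -> spectral_fun id B = B.
Proof.
by move=> hB; apply: hermsymmx_spectral => // i; rewrite mxE; exact: RRe_real.
Qed.

(** The eigenvectors returned by [spectralmx] need not depend measurably on [x], so
    the power is reached through polynomials in [A x] and pointwise limits of them. *)
Lemma measM_mxpowR (R : realType) d (T : measurableType d) n
    (A : T -> 'M[R[i]]_n) (a : R) :
  measM A -> (forall x, A x \is hermsymmx) -> measM (fun x => mxpowR (A x) a).
Proof.
move=> mA hA.
pose lam k x := complex.Re (spectral_diag (A x) 0 k).
pose c i j k x := invmx (spectralmx (A x)) i k * spectralmx (A x) k j.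
have fE (g : R -> R) i j : fcalc c lam g i j = fun x => spectral_fun g (A x) i j.
  by apply/funext => x; rewrite spectral_funE.
have {}fE (g : R -> R) : fmeas c lam g = measM (fun x => spectral_fun g (A x)).
  by rewrite /fmeas /measM; apply: eq_forall => i; apply: eq_forall => j; rewrite fE.
suff : fmeas c lam (fun l => l `^ a) by rewrite fE.
apply: fmeas_borel => [g h k l x|b||l|].
- have fE' (g' : R -> R) i j x' : fcalc c lam g' i j x' = spectral_fun g' (A x') i j.
    by rewrite spectral_funE.
  by rewrite fE' spectral_funM mxE; apply: eq_bigr => m _; rewrite !fE'.
- rewrite fE => k l; rewrite (_ : (fun x => _) = fun=> (b%:C%C%:M : 'M[R[i]]_n) k l).
    exact: measC_cst.
  by apply/funext => x; rewrite spectral_fun_cst.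
- rewrite fE => k l; rewrite (_ : (fun x => _) = fun x => A x k l); first exact: mA.
  by apply/funext => x; rewrite spectral_fun_id.
- exact: measurable_powR.
- by move=> l; exact: powR_ge0.
Qed.

Lemma hermsymmx_unit (C : numClosedFieldType) n (A : 'M[C]_n) :
  A \is hermsymmx -> (A \in unitmx) = [forall i, spectral_diag A 0 i != 0].
Proof.
move=> hA; rewrite -(conj_diag_mx_unit (spectral_unit A)).
by rewrite (hermsymmx_spectral hA).
Qed.

(** The eigenvalues of an invertible Hermitian matrix are nonzero reals, and a real
    power of a nonzero real is positive. *)
Lemma mxpowR_unitmx (R : realType) n (A : 'M[R[i]]_n) a :
  A \is hermsymmx -> A \in unitmx -> mxpowR A a \in unitmx.
Proof.
move=> hA; rewrite (hermsymmx_unit hA) => /forallP l0.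
rewrite conj_diag_mx_unit ?spectral_unit//; apply/forallP => i.
rewrite mxE; have /eqP := l0 i.
have /mxOverP/(_ 0 i)/RRe_real <- := hermitian_spectral_diag_real hA.
move: (complex.Re _) => l lN0.
have l1 : l != 0 by apply/eqP => l0'; apply: lN0; rewrite l0'.
by rewrite eq_complex/= eqxx andbT gt_eqF// /powR (negbTE l1) expR_gt0.
Qed.

(** * Borel representatives of Lebesgue measurable functions *)

Section completion.
Local Open Scope ereal_scope.
Context {R : realType} {d : measure_display} {T : measurableType d}.
Variable mu : {sigma_finite_measure set T -> \bar R}.
Local Notation cT := (caratheodory_type (mu^*)%mu).

Local Notation cmu := (@completed_measure_extension _ _ _ mu).

Lemma null_bigcup (F : (set T)^nat) : (forall k, measurable (F k)) ->
  (forall k, mu (F k) = 0) -> mu (\bigcup_k F k) = 0.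
Proof.
move=> mF F0; apply/eqP; rewrite eq_le measure_ge0 andbT.
rewrite (le_trans (measure_sigma_subadditive _ mF _ (@subset_refl _ _)))//.
  exact: bigcupT_measurable.
by rewrite eseries0// => i _ _; exact: F0.
Qed.

Lemma null_bigcup_count (I : countType) (F : I -> set T) :
  (forall k, measurable (F k)) -> (forall k, mu (F k) = 0) ->
  measurable (\bigcup_k F k) /\ mu (\bigcup_k F k) = 0.
Proof.
move=> mF F0; pose F_ i := oapp F set0 (unpickle i).
have mF_ i : measurable (F_ i) by rewrite /F_; case: unpickle => /=.
have -> : \bigcup_k F k = \bigcup_i F_ i.
  apply/seteqP; split => x [k _ Fkx].
    by exists (pickle k) => //; rewrite /F_ pickleK.
  by move: Fkx; rewrite /F_; case: unpickle => //= q Fqx; exists q.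
split; first exact: bigcupT_measurable.
by apply: null_bigcup => // i; rewrite /F_; case: unpickle => /=.
Qed.

(** The measure lives on a sigma-algebra, so the intersection of nearly optimal
    countable covers is itself measurable and attains the outer measure. *)
Lemma mu_ext_cover (E : set T) :
  exists F : set T, [/\ measurable F, E `<=` F & mu F <= (mu^*)%mu E].
Proof.
have [Eoo|] := eqVneq ((mu^*)%mu E) +oo.
  by exists setT; split; [exact: measurableT|by []|rewrite Eoo leey].
rewrite -ltey => Eoo.
have /choice[A mA] : forall k, exists B : set T, [/\ measurable B, E `<=` B &
    mu B <= (mu^*)%mu E + k.+1%:R^-1%:E].
  move=> k.
  have fE : (mu^*)%mu E \is a fin_num by rewrite ge0_fin_numE// mu_ext_ge0.
  have k0 : (0 < k.+1%:R^-1 :> R)%R by rewrite invr_gt0.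
  have [_/= [B [mB EB] <-] Blt] := lb_ereal_inf_adherent k0 fE.
  exists (\bigcup_i B i); split => //; first exact: bigcupT_measurable.
  apply: le_trans (ltW Blt).
  by apply: measure_sigma_subadditive => //; exact: bigcupT_measurable.
exists (\bigcap_k A k); split.
- by apply: bigcapT_measurable => k; have [] := mA k.
- by move=> x Ex k _; have [_ EA _] := mA k; exact: EA.
- apply/lee_addgt0Pr => e e0.
  have [k ke] : exists k, (k.+1%:R^-1 < e :> R)%R.
    by have [k _ ke] := near_infty_natSinv_lt (PosNum e0); exists k; exact: (ke k (leqnn k)).
  have [mAk _ Ak] := mA k; apply: (@le_trans _ _ (mu (A k))).
    apply: le_measure; rewrite ?inE//; last exact: bigcap_inf.
    by apply: bigcapT_measurable => i; have [] := mA i.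
  by apply: (le_trans Ak); rewrite leeD2l// lee_fin ltW.
Qed.

Lemma mu_ext_measurable (A : set T) : measurable A -> (mu^*)%mu A = mu A.
Proof. exact: measurable_mu_extE. Qed.

Lemma measurable_caratheodory (A : set T) :
  measurable A -> measurable (A : set cT).
Proof. exact: caratheodory_measurable_mu_ext. Qed.

(** On each piece of finite measure the excess [F `\` E] of an optimal cover has outer
    measure [0], and is in turn covered by a measurable null set. *)
Lemma caratheodory_cover (E : set cT) : measurable E ->
  exists F G : set T,
  [/\ measurable F, measurable G, mu G = 0, E `<=` F & F `\` E `<=` G].
Proof.
move=> mE; have [S ST Soo] := sigma_finiteT mu.
have /choice[F mF] : forall k, exists F : set T * set T, [/\ measurable F.1,
    measurable F.2, mu F.2 = 0, E `&` S k `<=` F.1 &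
    F.1 `\` (E `&` S k) `<=` F.2].
  move=> k.
  have [mS Sfin] := Soo k.
  have mES : measurable (E `&` S k : set cT).
    by apply: measurableI => //; exact: measurable_caratheodory.
  have [A [mA EA Ale]] := mu_ext_cover (E `&` S k).
  have [B [mB AEB Ble]] := mu_ext_cover (A `\` (E `&` S k)).
  exists (A, B); split => //=; apply/eqP; rewrite eq_le measure_ge0 andbT.
  apply: (le_trans Ble).
  have ESoo : (mu^*)%mu (E `&` S k) < +oo.
    apply: le_lt_trans Sfin.
    by have := mu_ext_measurable mS => /= <-; apply: le_mu_ext; exact: subIsetr.
  have -> : (mu^*)%mu (A `\` (E `&` S k)) =
      (mu^*)%mu A - (mu^*)%mu (A `&` (E `&` S k)).
    apply: (@measureD _ _ _ cmu) => //; first exact: measurable_caratheodory.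
    by rewrite -[ltLHS]/((mu^*)%mu A) mu_ext_measurable// (le_lt_trans Ale).
  by rewrite setIidr// mu_ext_measurable// sube_le0.
exists (\bigcup_k (F k).1), (\bigcup_k (F k).2); split.
- by apply: bigcupT_measurable => k; have [] := mF k.
- by apply: bigcupT_measurable => k; have [] := mF k.
- by apply: null_bigcup => k; have [] := mF k.
- move=> x Ex; have [k _ Skx] : (\bigcup_k S k) x by rewrite -ST.
  by exists k => //; have [_ _ _ EF _] := mF k; exact: EF.
- move=> x [[k _ Fkx] NEx]; exists k => //; have [_ _ _ _ FE] := mF k; apply: FE.
  by split => // -[].
Qed.

Lemma borel_null_cover (N : set T) :
  cmu.-negligible N ->
  exists B : set T, [/\ measurable B, mu B = 0 & N `<=` B].
Proof.
move=> [A [mA A0 NA]]; have [B [mB AB Ble]] := mu_ext_cover A.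
exists B; split => //; last exact: subset_trans AB.
by apply/eqP; rewrite eq_le measure_ge0 andbT (le_trans Ble)// -A0.
Qed.

(** One exceptional null set for each rational level: off their union the sets
    [g > q] agree with measurable ones. The statement allows any larger null set, so
    that finitely many functions can share one. *)
Lemma borel_representative (g : cT -> R) : measurable_fun [set: cT] g ->
  exists N : set T, [/\ measurable N, mu N = 0 &
    forall (N' : set T) (c : R), measurable N' -> N `<=` N' ->
    measurable_fun [set: T] (fun x => if x \in N' then c else g x)].
Proof.
move=> mg.
have /choice[F mF] : forall q : rat, exists F : set T * set T,
    [/\ measurable F.1, measurable F.2, mu F.2 = 0,
    [set x | (ratr q < g x)%R] `<=` F.1 &
    F.1 `\` [set x | (ratr q < g x)%R] `<=` F.2].
  move=> q.
  have mE : measurable ([set x | (ratr q < g x)%R] : set cT).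
    have := mg measurableT _ (measurable_itv `]ratr q, +oo[); rewrite setTI.
    by congr (measurable _); apply/seteqP; split => x /=; rewrite in_itv/= andbT.
  by have [A [B [? ? ? ? ?]]] := caratheodory_cover mE; exists (A, B).
have [mN N0] : measurable (\bigcup_q (F q).2) /\ mu (\bigcup_q (F q).2) = 0.
  by apply: null_bigcup_count => q; have [] := mF q.
exists (\bigcup_q (F q).2); split => //.
move=> N' c mN' NN'.
  apply: (measurability _ (RGenOInfty.measurableE R)) => // _ [_ [a ->] <-].
  rewrite setTI.
  rewrite [X in measurable X](_ : _ =
    (N' `&` [set x | (a < c)%R]) `|`
    (\bigcup_(q in [set q : rat | (a < ratr q)%R]) (F q).1) `\` N').
    apply: measurableU.
      apply: measurableI => //; have [ac|ac] := boolP (a < c)%R.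
        by rewrite (_ : [set _ | _] = setT)//; apply/seteqP; split.
      by rewrite (_ : [set _ | _] = set0)//; apply/seteqP; split.
    apply: measurableD => //.
    rewrite bigcup_mkcond; apply: bigcupT_measurable_rat => q.
    by case: ifP => // _; have [] := mF q.
  apply/seteqP; split => x /=; rewrite in_itv/= andbT.
    case: ifPn => [/set_mem N'x ac|/negP N'x ax]; first by left.
    right; split; last by move=> ?; apply: N'x; exact/mem_set.
    have [q /itvP qax] := rat_in_itvoo ax.
    have aq : (a < ratr q)%R by rewrite qax.
    have qg : (ratr q < g x)%R by rewrite qax.
    by exists q => //; have [_ _ _ EF _] := mF q; exact: EF.
  case=> [[N'x ac]|[[q aq Fqx] N'x]]; first by rewrite mem_set.
  rewrite memNset//; apply: (lt_trans aq).
  have [//|NE] := pselect (ratr q < g x)%R.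
  exfalso; apply: N'x; apply: NN'; exists q => //.
  by have [_ _ _ _ FE] := mF q; apply: FE; split.
Qed.

Lemma borel_representativeM m n (A : cT -> 'M[R[i]]_(m, n)) : measM A ->
  exists N : set T, [/\ measurable N, mu N = 0 &
    forall (N' : set T) C, measurable N' -> N `<=` N' ->
    measM (fun x : T => if x \in N' then C else A x)].
Proof.
move=> mA.
pose f (k : 'I_m * 'I_n * bool) (x : cT) : R :=
  if k.2 then complex.Re (A x k.1.1 k.1.2) else complex.Im (A x k.1.1 k.1.2).
have mf k : measurable_fun [set: cT] (f k).
  by rewrite /f; case: k => -[i j] [] /=; have [] := mA i j.
have [N hN] := choice (fun k => borel_representative (mf k)).
have [mN N0] : measurable (\bigcup_k N k) /\ mu (\bigcup_k N k) = 0.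
  by apply: null_bigcup_count => k; have [] := hN k.
exists (\bigcup_k N k); split => // N' C mN' NN' i j.
have sN k : N k `<=` N' by move=> x Nx; apply: NN'; exists k.
split.
  have [_ _ /(_ N' (complex.Re (C i j)) mN' (sN _))] := hN (i, j, true).
  by congr measurable_fun; apply/funext => x /=; case: ifP.
have [_ _ /(_ N' (complex.Im (C i j)) mN' (sN _))] := hN (i, j, false).
by congr measurable_fun; apply/funext => x /=; case: ifP.
Qed.

End completion.

(** * Integrals with respect to the completed measure *)

Section completion_integral.
Local Open Scope ereal_scope.
Context {R : realType} {d : measure_display} {T : measurableType d}.
Variable mu : {sigma_finite_measure set T -> \bar R}.
Local Notation cT := (caratheodory_type (mu^*)%mu).
Local Notation cmu := (@completed_measure_extension _ _ _ mu).

Lemma measurable_fun_caratheodory d' (U : measurableType d')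
  (g : T -> U) : measurable_fun [set: T] g -> measurable_fun [set: cT] (g : cT -> U).
Proof.
move=> mg _ B mB; rewrite setTI; apply: measurable_caratheodory.
by have := mg measurableT _ mB; rewrite setTI.
Qed.

(** The two measures have the same integrals of measurable functions because the
    identity map pushes the completion forward to the original measure. *)
Lemma integral_completed (D N : set T) (h : cT -> \bar R) (g : T -> \bar R) :
  measurable D -> measurable N -> mu N = 0 ->
  measurable_fun [set: T] g -> (forall x, 0 <= g x) -> (forall x, 0 <= h x) ->
  (forall x, ~ N x -> h x = g x) ->
  \int[cmu]_(x in D) h x = \int[mu]_(x in D) g x.
Proof.
move=> mD mN N0 mg g0 h0 hg.
have mid : measurable_fun [set: cT] (idfun : cT -> T).
  by apply: measurable_fun_caratheodory; exact: measurable_id.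
have mcN := measurable_caratheodory mu mN.
have mcD := measurable_caratheodory mu mD.
have mg' := measurable_fun_caratheodory mg.
have cN0 : cmu N = 0.
  by rewrite -[LHS]/((mu^*)%mu N) mu_ext_measurable.
have ae E : ae_eq cmu E g h.
  exists N; split => // x /= gh.
  by apply: contrapT => Nx; apply: gh => _; rewrite hg.
have mh : measurable_fun [set: cT] h.
  by apply: (ae_measurable_fun _ (ae setT) mg'); exact: measure_is_complete_caratheodory.
transitivity (\int[cmu]_(x in D) g x).
  apply: ge0_ae_eq_integral => //.
  - by apply: measurable_funS mh.
  - by apply: measurable_funS mg'.
  - by apply: ae_eq_sym.
have := @ge0_integral_pushforward _ _ _ _ _ _ mid cmu D g mD.
rewrite preimage_id => <-//.
- apply: eq_measure_integral => A mA _.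
  exact: (mu_ext_measurable mu mA).
- exact: measurable_funS mg.
Qed.

End completion_integral.

(** * Translation invariance *)

Section translation.
Context {R : realType}.

Lemma lebesgue_measure_shift (a : R) (A : set R) : measurable A ->
  lebesgue_measure ((fun x => x + a) @^-1` A) = lebesgue_measure A.
Proof.
move=> mA.
have ma : measurable_fun [set: measurableTypeR R] (fun x => x + a : measurableTypeR R).
  by apply: measurable_funD => //; exact: measurable_cst.
rewrite -[LHS]/(pushforward lebesgue_measure (fun x => x + a : measurableTypeR R) A).
apply/esym/lebesgue_measure_unique => //= _ [[u v]] _ <-.
rewrite /pushforward.
rewrite (_ : _ @^-1` _ = `]u - a, v - a]%classic); last first.
  by apply/seteqP; split => x /=; rewrite !in_itv/= ltrBlDr lerBrDr.
rewrite !lebesgue_measure_itv/= !lte_fin ltrD2r.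
by rewrite -!EFinB opprB addrA subrK.
Qed.

Lemma measurable_shift n (a : 'rV[R]_n) :
  measurable_fun [set: 'rV[R]_n] (fun x : 'rV[R]_n => x + a).
Proof.
apply: measurable_fun_rVP => i; under eq_fun do rewrite mxE.
by apply: measurable_funD; [exact: measurable_coord_rV|exact: measurable_cst].
Qed.

(** By induction on the dimension: a translation of [consrV] acts separately on the
    first coordinate and on the remaining ones, and a product measure is determined
    by its values on rectangles. *)
Lemma borel_lebesgue_shift n (a : 'rV[R]_n) (A : set 'rV[R]_n) : measurable A ->
  borel_lebesgue n ((fun x => x + a) @^-1` A) = borel_lebesgue n A.
Proof.
elim: n => [|n IH] in a A *.
  move=> mA; congr (borel_lebesgue 0 _); apply/seteqP.
  by split => x /=; rewrite (_ : x + a = x)//; apply/rowP; case.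
move=> mA; rewrite /= /prod_rV /pushforward.
pose a' : 'rV[R]_n := \row_j a 0 (lift ord0 j).
pose sh (p : measurableTypeR R * 'rV[R]_n) : measurableTypeR R * 'rV[R]_n :=
  (p.1 + a 0 ord0, p.2 + a').
have msh : measurable_fun [set: _] sh.
  apply/measurable_fun_pairP; split => /=.
    by apply: measurable_funD; [exact: measurable_fst|exact: measurable_cst].
  exact: (measurableT_comp (measurable_shift a') measurable_snd).
have -> : @consrV R n @^-1` ((fun x => x + a) @^-1` A) = sh @^-1` (@consrV R n @^-1` A).
  apply/seteqP; split => p /=; congr A; apply/rowP => i; rewrite !mxE;
  by case: (unliftP ord0 i) => [j ->|->] //=; rewrite !mxE.
apply/esym; apply: (product_measure_unique
  (m' := measure_function_pushforward__canonical__measure_function_Measure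
     (lebesgue_measure \x borel_lebesgue n)%E msh)).
  move=> B C mB mC; rewrite -[LHS]/((lebesgue_measure \x borel_lebesgue n)%E
    (((fun x => x + a 0 ord0) @^-1` B) `*` ((fun x => x + a') @^-1` C))).
  rewrite product_measure1E//.
  - by congr (_ * _)%E; [exact: lebesgue_measure_shift|exact: IH].
  - by rewrite -[X in measurable X]setTI; apply: measurable_funD => //; exact: measurable_cst.
  - by rewrite -[X in measurable X]setTI; apply: measurable_shift.
by rewrite -[X in measurable X]setTI; exact: measurable_consrV.
Qed.

Lemma integral_shift n (a : 'rV[R]_n) (A : set 'rV[R]_n) (g : 'rV[R]_n -> \bar R) :
  measurable A -> measurable_fun [set: 'rV[R]_n] g -> (forall x, 0 <= g x)%E ->
  (\int[borel_lebesgue n]_(x in A) g x =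
   \int[borel_lebesgue n]_(x in (fun x => (x + a)%R) @^-1` A) g (x + a)%R)%E.
Proof.
move=> mA mg g0.
have := @ge0_integral_pushforward _ _ _ _ _ _ (measurable_shift a) (borel_lebesgue n) A g mA.
move=> <-//; last exact: measurable_funS mg.
apply: eq_measure_integral => [|ms B mB _]; first exact: measurable_shift.
by apply/esym; exact: borel_lebesgue_shift.
Qed.

End translation.

(** * The norm of [l^r] *)

Section powers.
Local Open Scope ereal_scope.
Context {R : realType}.
Implicit Types (a b x : \bar R) (s : R).

Lemma le_poweR s a b : (0 <= s)%R -> 0 <= a -> a <= b -> a `^ s <= b `^ s.
Proof.
move=> s0 a0 ab; apply: gt0_ler_poweR => //; rewrite in_itv/= ?a0 ?leey//.
by rewrite (le_trans a0).
Qed.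

Lemma poweRVK s a : s != 0%R -> 0 <= a -> (a `^ s^-1) `^ s = a.
Proof. by move=> s0 a0; rewrite -poweRrM mulVf// poweRe1. Qed.

Lemma poweRKV s a : s != 0%R -> 0 <= a -> (a `^ s) `^ s^-1 = a.
Proof. by move=> s0 a0; rewrite -poweRrM mulfV// poweRe1. Qed.

(** The larger summand is at least half of the sum. *)
Lemma poweRD_le s a b : (0 <= s)%R -> 0 <= a -> 0 <= b ->
  (a + b) `^ s <= (2 `^ s)%:E * (a `^ s + b `^ s).
Proof.
move=> s0; wlog ab : a b / a <= b => [hw a0 b0|a0 b0].
  have [/hw|/ltW/hw] := leP a b; first exact.
  by rewrite addeC [X in _ <= _ * X]addeC; exact.
rewrite muleDr ?ge0_adde_def ?inE ?poweR_ge0//.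
rewrite -[leLHS]add0e leeD// ?mule_ge0 ?poweR_ge0 ?lee_fin ?powR_ge0//.
rewrite -poweR_EFin -poweRM ?lee_fin//; apply: le_poweR => //; first exact: adde_ge0.
by rewrite mule_natl mule2n leeD2r.
Qed.

(** For [u > c] write [u = u ^ s * u ^ (1 - s)] and use that [1 - s <= 0]. *)
Lemma le_young (u s c : R) : (0 <= u)%R -> (1 <= s)%R -> (0 < c)%R ->
  (u <= c + c `^ (1 - s) * u `^ s)%R.
Proof.
move=> u0 s1 c0; have [uc|cu] := leP u c.
  by rewrite (le_trans uc)// lerDl mulr_ge0 ?powR_ge0.
have u0' : (0 < u)%R by exact: lt_trans cu.
rewrite -[leLHS]add0r lerD ?(ltW c0)//.
rewrite -{1}[u]powRr1// -{1}(subrK s 1%R) powRD ?(gt_eqF u0') ?implybT//.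
rewrite ler_wpM2r ?powR_ge0// -[(1 - s)%R]opprB !powRN.
rewrite lef_pV2 ?posrE ?powR_gt0//.
by apply: ge0_ler_powR; rewrite ?subr_ge0 ?nnegrE// ltW.
Qed.

Lemma lee_young (u : \bar R) (s c : R) : 0 <= u -> (1 <= s)%R -> (0 < c)%R ->
  u <= c%:E + (c `^ (1 - s))%:E * u `^ s.
Proof.
case: u => [u| |]//.
  by rewrite lee_fin => u0 s1 c0; rewrite poweR_EFin -EFinM -EFinD lee_fin le_young.
move=> _ s1 c0; rewrite poweRyr ?gt_eqF ?(lt_le_trans ltr01)//.
by rewrite gt0_muley ?lte_fin ?powR_gt0// addey.
Qed.

End powers.

Section average.
Local Open Scope ereal_scope.
Context {R : realType} {d : measure_display} {T : measurableType d}.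
Variables (mu : {measure set T -> \bar R}) (Y : set T) (m : R).
Hypotheses (mY : measurable Y) (m0 : (0 < m)%R) (muY : mu Y = m%:E).

Definition average (A : T -> \bar R) : \bar R := (m^-1)%:E * \int[mu]_(y in Y) A y.

Lemma average_ge0 A : (forall y, Y y -> 0 <= A y) -> 0 <= average A.
Proof.
move=> A0; apply: mule_ge0; first by rewrite lee_fin invr_ge0 ltW.
exact: integral_ge0.
Qed.

Lemma average_cst (c : \bar R) : 0 <= c -> average (fun=> c) = c.
Proof.
move=> c0; rewrite /average integral_cst// muY muleCA -EFinM mulVf ?mule1//.
by rewrite gt_eqF.
Qed.

Lemma le_average A B : measurable_fun Y A -> measurable_fun Y B ->
  (forall y, Y y -> 0 <= A y) -> (forall y, Y y -> A y <= B y) ->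
  average A <= average B.
Proof.
move=> mA mB A0 AB; apply: lee_wpmul2l; first by rewrite lee_fin invr_ge0 ltW.
exact: ge0_le_integral.
Qed.

Lemma averageD A B : measurable_fun Y A -> measurable_fun Y B ->
  (forall y, Y y -> 0 <= A y) -> (forall y, Y y -> 0 <= B y) ->
  average (fun y => A y + B y) = average A + average B.
Proof.
move=> mA mB A0 B0; rewrite /average ge0_integralD// muleDr//.
by rewrite ge0_adde_def// inE integral_ge0.
Qed.

Lemma averageZ A (c : R) : measurable_fun Y A -> (0 <= c)%R ->
  (forall y, Y y -> 0 <= A y) ->
  average (fun y => c%:E * A y) = c%:E * average A.
Proof. by move=> mA c0 A0; rewrite /average ge0_integralZl// muleCA. Qed.

(** A weak form of Jensen's inequality: integrating
    [u <= c + c ^ (1 - s) * u ^ s] and then choosing [c] costs a factor [2]. *)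
Lemma average_poweR A (s : R) : measurable_fun Y A -> (1 <= s)%R ->
  (forall y, Y y -> 0 <= A y) ->
  average A <= 2%:E * (average (fun y => A y `^ s)) `^ s^-1.
Proof.
move=> mA s1 A0; have s0 : (0 < s)%R by exact: lt_le_trans s1.
have mAs : measurable_fun Y (fun y => A y `^ s).
  by apply: (measurableT_comp (measurable_poweR _)).
have J0 : 0 <= average (fun y => A y `^ s).
  by apply: average_ge0 => y _; exact: poweR_ge0.
have key c : (0 < c)%R ->
    average A <= c%:E + (c `^ (1 - s))%:E * average (fun y => A y `^ s).
  move=> c0; rewrite -[X in X + _](@average_cst c%:E) ?lee_fin ?(ltW c0)//.
  rewrite -averageZ ?powR_ge0//; last by move=> y _; exact: poweR_ge0.
  rewrite -averageD//.
  - apply: le_average => //; last by move=> y Yy; apply: lee_young => //; exact: A0.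
    by apply: emeasurable_funD => //; exact: measurable_funeM.
  - exact: measurable_funeM.
  - by move=> y _; rewrite lee_fin ltW.
  - by move=> y _; rewrite mule_ge0 ?poweR_ge0 ?lee_fin ?powR_ge0.
move: key J0; set J := average (fun y => A y `^ s).
case: J => [j key| |]; last 2 first.
  - by move=> _ _; rewrite poweRyr ?invr_eq0 ?gt_eqF// gt0_muley ?leey ?lte_fin.
  - by move=> _; rewrite leeNy_eq.
rewrite lee_fin le_eqVlt => /predU1P[j0|j0].
  rewrite -j0 poweR0r ?invr_eq0 ?gt_eqF// mule0.
  apply/lee_addgt0Pr => c c0; rewrite add0e.
  by have := key _ c0; rewrite -j0 mule0 adde0.
have c0 : (0 < j `^ s^-1)%R by exact: powR_gt0.
apply: (le_trans (key _ c0)); rewrite poweR_EFin -EFinM -EFinD -EFinM lee_fin.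
rewrite mulr_natl mulr2n lerD2l -powRrM -{2}[j]powRr1 ?(ltW j0)//.
rewrite -powRD ?(gt_eqF j0) ?implybT// mulrBr mulr1 mulVf ?gt_eqF//.
by rewrite subrK.
Qed.

End average.

Section lnorm_theory.
Local Open Scope ereal_scope.
Context {R : realType} {I : choiceType}.
Implicit Types (a b : I -> \bar R) (r : \bar R).

Lemma le_lnorm r a b : 0 < r -> (forall i, 0 <= a i) -> (forall i, a i <= b i) ->
  lnorm r a <= lnorm r b.
Proof.
case: r => [s| |]//; last first.
  move=> _ a0 ab; apply: ge_ereal_sup => _ [i _ <-].
  by apply: le_trans (ab i) _; apply: ereal_sup_ubound; exists i.
rewrite lte_fin => s0 a0 ab; apply: le_poweR; first by rewrite invr_ge0 ltW.
  by apply: esum_ge0 => i _; exact: poweR_ge0.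
by apply: le_esum => i _; apply: le_poweR => //; exact: ltW.
Qed.

Lemma lnorm_ge r a i : 0 < r -> (forall i, 0 <= a i) -> a i <= lnorm r a.
Proof.
case: r => [s| |]//; last by move=> _ a0; apply: ereal_sup_ubound; exists i.
rewrite lte_fin => s0 a0; rewrite -(@poweRKV _ s (a i)) ?gt_eqF//.
apply: le_poweR; rewrite ?invr_ge0 ?(ltW s0) ?poweR_ge0//.
apply: esum_ge; exists [set i]; first by split => //; exact: finite_set1.
by rewrite fsbig_set1.
Qed.

Lemma lnormZ r a (c : R) : 0 < r -> (0 <= c)%R -> (forall i, 0 <= a i) ->
  lnorm r (fun i => c%:E * a i) <= c%:E * lnorm r a.
Proof.
case: r => [s| |]//; last first.
  move=> _ c0 a0; apply: ge_ereal_sup => _ [i _ <-].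
  by apply: lee_wpmul2l; [rewrite lee_fin|apply: ereal_sup_ubound; exists i].
rewrite lte_fin => s0 c0 a0; have e0 : 0 <= \esum_(i in [set: I]) a i `^ s.
  by apply: esum_ge0 => i _; exact: poweR_ge0.
rewrite /lnorm -[X in X * _](@poweRKV _ s c%:E) ?gt_eqF ?lee_fin//.
rewrite -poweRM ?poweR_ge0//; apply: le_poweR; first by rewrite invr_ge0 ltW.
  by apply: esum_ge0 => i _; exact: poweR_ge0.
apply: ge_ereal_sup => _ [X [finX _] <-].
apply: (@le_trans _ _ (\sum_(i \in X) c%:E `^ s * a i `^ s)).
  by apply: lee_fsum => // i Xi; rewrite poweRM ?lee_fin.
rewrite -ge0_mule_fsumr; last by move=> i; exact: poweR_ge0.
by apply: lee_wpmul2l; [exact: poweR_ge0|apply: ereal_sup_ubound; exists X].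
Qed.

(** A quasi-triangle inequality is all that the theorem needs; it follows from
    [a + b <= 2 * maxe a b], and the same argument serves finite and infinite [r]. *)
Lemma lnormD r a b : 1 <= r -> (forall i, 0 <= a i) -> (forall i, 0 <= b i) ->
  lnorm r (fun i => a i + b i) <= 4%:E * (lnorm r a + lnorm r b).
Proof.
case: r => [s| |]//; last first.
  move=> r1 a0 b0; have n0 : 0 <= lnorm +oo a + lnorm +oo b \/ forall i : I, False.
    have [ii|NI] := pselect (inhabited I).
      by case: ii => i; left; apply: adde_ge0; [apply: le_trans (a0 i) _|apply: le_trans (b0 i) _];
        exact: lnorm_ge.
    by right => i; apply: NI; exact: inhabits.
  apply: ge_ereal_sup => _ [i _ <-]; case: n0 => [n0|/(_ i)//].
  apply: (@le_trans _ _ (lnorm +oo a + lnorm +oo b)); first by apply: leeD; exact: lnorm_ge.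
  by rewrite -[leLHS]mul1e; apply: lee_wpmul2r => //; rewrite lee_fin ler1n.
rewrite lee_fin => s1 a0 b0; have s0 : (0 < s)%R by exact: lt_le_trans s1.
have e0 (c : I -> \bar R) : 0 <= \esum_(i in [set: I]) c i `^ s.
  by apply: esum_ge0 => i _; exact: poweR_ge0.
pose c i := maxe (a i) (b i).
apply: (@le_trans _ _ (lnorm s%:E (fun i => 2%:E * c i))).
  apply: le_lnorm; [by rewrite lte_fin|by move=> i; exact: adde_ge0|move=> i].
  by rewrite mule_natl mule2n leeD// le_max lexx ?orbT.
have c0 i : 0 <= c i by rewrite le_max a0.
have s0' : 0 < s%:E by rewrite lte_fin.
apply: (le_trans (lnormZ s0' (ler0n R 2) c0)).
rewrite (_ : 4%:E = 2%:E * 2%:E :> \bar R); last by rewrite -EFinM -natrM.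
rewrite -muleA lee_wpmul2l//.
apply: (@le_trans _ _ ((2 `^ s^-1)%:E * (lnorm s%:E a + lnorm s%:E b))); last first.
  apply: lee_wpmul2r; first by apply: adde_ge0; exact: poweR_ge0.
  rewrite lee_fin -[leRHS]powRr1// ler_powR ?ler1n// invf_le1//.
apply: le_trans (poweRD_le _ (e0 a) (e0 b)); last by rewrite invr_ge0 ltW.
apply: le_poweR => //; first by rewrite invr_ge0 ltW.
rewrite -esumD => [|i _|i _]; rewrite ?poweR_ge0//.
apply: le_esum => i _; rewrite /c; have [ab|ba] := leP (a i) (b i).
  by rewrite -[leLHS]add0e leeD2r ?poweR_ge0.
by rewrite -[leLHS]adde0 leeD2l ?poweR_ge0.
Qed.

(** Jensen's inequality with exponent [r / p >= 1], followed by exchanging the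
    average with finite partial sums of the [l^r] series. *)
Lemma lnorm_average d (T : measurableType d) (mu : {measure set T -> \bar R})
    (Y : set T) (m : R) (A : I -> T -> \bar R) (p : R) r (e : \bar R) :
  measurable Y -> (0 < m)%R -> mu Y = m%:E -> (1 <= p)%R -> p%:E <= r -> 0 <= e ->
  (forall i, measurable_fun Y (A i)) -> (forall i y, Y y -> 0 <= A i y) ->
  (forall y, Y y -> lnorm r (fun i => A i y `^ p^-1) <= e) ->
  lnorm r (fun i => average mu Y m (A i) `^ p^-1) <= 2%:E * e.
Proof.
move=> mY m0 muY p1 + e0 mA A0 Ae; have p0 : (0 < p)%R by exact: lt_le_trans p1.
have av0 i : 0 <= average mu Y m (A i) by apply: average_ge0 => // y; exact: A0.
have e2 : e <= 2%:E * e.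
  by rewrite -[leLHS]mul1e lee_wpmul2r// lee_fin ler1n.
case: r Ae => [s| |]//; last first.
  move=> Ae _; apply: ge_ereal_sup => _ [i _ <-]; apply: le_trans e2.
  rewrite -[leRHS](@poweRKV _ p) ?gt_eqF//.
  apply: le_poweR; rewrite ?invr_ge0 ?(ltW p0)//.
  rewrite -[leRHS](average_cst mY m0 muY) ?poweR_ge0//.
  apply: le_average => //; first by move=> y; exact: A0.
  move=> y Yy; rewrite -[leLHS](@poweRVK _ p) ?gt_eqF ?A0//.
  apply: le_poweR; rewrite ?(ltW p0) ?poweR_ge0//.
  by apply: le_trans (Ae _ Yy); apply: ereal_sup_ubound; exists i.
move=> Ae; rewrite lee_fin => ps; have s0 : (0 < s)%R by exact: lt_le_trans ps.
pose q := (s / p)%R; have q1 : (1 <= q)%R by rewrite ler_pdivlMr// mul1r.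
have q0 : (0 < q)%R by exact: lt_le_trans q1.
have mAq i : measurable_fun Y (fun y => A i y `^ q).
  by apply: (measurableT_comp (measurable_poweR _)).
pose B i := average mu Y m (fun y => A i y `^ q).
have B0 i : 0 <= B i by apply: average_ge0 => // y _; exact: poweR_ge0.
apply: (@le_trans _ _ (lnorm s%:E (fun i => 2%:E * B i `^ s^-1))).
  apply: le_lnorm; rewrite ?lte_fin// => i; first exact: poweR_ge0.
  have ivp : (0 <= p^-1)%R by rewrite invr_ge0 ltW.
  apply: (le_trans (le_poweR ivp (av0 i) (average_poweR mY m0 muY (mA i) q1 (A0 i)))).
  rewrite poweRM ?poweR_ge0 ?lee_fin// -poweRrM.
  rewrite (_ : (q^-1 / p = s^-1)%R); last by rewrite /q invf_div mulrAC divff ?mul1r ?gt_eqF.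
  apply: lee_wpmul2r; first exact: poweR_ge0.
  by rewrite poweR_EFin lee_fin -[leRHS]powRr1// ler_powR ?ler1n// invf_le1.
have s0' : 0 < s%:E by rewrite lte_fin.
apply: (le_trans (lnormZ s0' (ler0n R 2) _)); first by move=> i; exact: poweR_ge0.
apply: lee_wpmul2l; first by rewrite lee_fin.
rewrite -[leRHS](@poweRKV _ s) ?gt_eqF//.
apply: le_poweR; rewrite ?invr_ge0 ?(ltW s0)//.
  by apply: esum_ge0 => i _; exact: poweR_ge0.
apply: ge_ereal_sup => _ [X [finX _] <-].
rewrite (_ : \sum_(i \in X) _ = \sum_(i \in X) B i); last first.
  by apply: eq_fsbigr => i _; rewrite poweRVK ?gt_eqF.
rewrite /B /average -ge0_mule_fsumr; last first.
  by move=> i; apply: integral_ge0 => y _; exact: poweR_ge0.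
rewrite -ge0_integral_fsum//; last by move=> i y _; exact: poweR_ge0.
rewrite -[leRHS](average_cst mY m0 muY) ?poweR_ge0//.
apply: le_average => //.
- exact: emeasurable_fsum.
- by move=> y _; apply: fsume_ge0 => i _; exact: poweR_ge0.
- move=> y Yy; apply: (@le_trans _ _ (\esum_(i in [set: I]) (A i y `^ p^-1) `^ s)).
    apply: esum_ge; exists X => //; apply: lee_fsum => // i _.
    by rewrite -poweRrM mulrC.
  rewrite -[leLHS](@poweRVK _ s) ?gt_eqF//; last by apply: esum_ge0 => i _; exact: poweR_ge0.
  by apply: le_poweR; rewrite ?(ltW s0) ?poweR_ge0//; exact: Ae.
Qed.

End lnorm_theory.

(** * Finite-dimensional estimates *)

Section complex_norms.
Context {R : realType}.
Implicit Types z w : R[i].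

Lemma cabsC z : (cabs z)%:C%C = `|z|.
Proof. by rewrite /cabs normc_def. Qed.

Lemma cabs_ge0 z : 0 <= cabs z.
Proof. by rewrite cabsE sqrtr_ge0. Qed.

Lemma cabs0 : cabs (0 : R[i]) = 0.
Proof. by rewrite /cabs normr0. Qed.

Lemma cabsM z w : cabs (z * w) = cabs z * cabs w.
Proof. by apply: complexI; rewrite rmorphM/= !cabsC normrM. Qed.

Lemma cabsD z w : cabs (z + w) <= cabs z + cabs w.
Proof. by rewrite -lecR rmorphD/= !cabsC ler_normD. Qed.

Lemma cabs_eq0 z : cabs z = 0 -> z = 0.
Proof. by move=> z0; apply/eqP; rewrite -normr_eq0 -cabsC z0. Qed.

Lemma cabs_sum (I : Type) (s : seq I) (P : pred I) (F : I -> R[i]) :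
  cabs (\sum_(i <- s | P i) F i) <= \sum_(i <- s | P i) cabs (F i).
Proof.
elim/big_rec2: _ => [|i x y _ xy]; first by rewrite cabs0.
by rewrite (le_trans (cabsD _ _))// lerD2l.
Qed.

Lemma Re_le_cabs z : `|complex.Re z| <= cabs z.
Proof.
by rewrite cabsE -sqrtr_sqr ler_wsqrtr// lerDl sqr_ge0.
Qed.

Lemma Im_le_cabs z : `|complex.Im z| <= cabs z.
Proof.
by rewrite cabsE -sqrtr_sqr ler_wsqrtr// lerDr sqr_ge0.
Qed.

Lemma cabs_le_ReIm z : cabs z <= `|complex.Re z| + `|complex.Im z|.
Proof.
have [a b] : 0 <= `|complex.Re z| /\ 0 <= `|complex.Im z| by [].
rewrite cabsE -(ger0_norm (addr_ge0 a b)) -sqrtr_sqr ler_wsqrtr//.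
rewrite sqrrD !real_normK ?num_real// [leRHS]addrAC lerDl.
by rewrite mulrn_wge0 ?mulr_ge0.
Qed.

(** An auxiliary norm: it is submultiplicative, and comparable with the Euclidean norm
    up to dimensional constants, which spares the use of scalar products. *)
Definition norm1 m n (A : 'M[R[i]]_(m, n)) : R := \sum_i \sum_j cabs (A i j).

Lemma norm1_ge0 m n (A : 'M[R[i]]_(m, n)) : 0 <= norm1 A.
Proof. by apply: sumr_ge0 => i _; apply: sumr_ge0 => j _; exact: cabs_ge0. Qed.

Lemma cabs_le_norm1 m n (A : 'M[R[i]]_(m, n)) i j : cabs (A i j) <= norm1 A.
Proof.
rewrite /norm1 (bigD1 i)//= (bigD1 j)//= -addrA lerDl addr_ge0//.
  by apply: sumr_ge0 => k _; exact: cabs_ge0.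
by apply: sumr_ge0 => k _; apply: sumr_ge0 => l _; exact: cabs_ge0.
Qed.

Lemma norm1M m n p (A : 'M[R[i]]_(m, n)) (B : 'M[R[i]]_(n, p)) :
  norm1 (A *m B) <= norm1 A * norm1 B.
Proof.
rewrite {1}/norm1; apply: (@le_trans _ _
  (\sum_i \sum_k cabs (A i k) * norm1 B)); last first.
  rewrite /norm1 mulr_suml; apply: ler_sum => i _.
  by rewrite mulr_suml.
apply: ler_sum => i _.
apply: (@le_trans _ _ (\sum_j \sum_k cabs (A i k) * cabs (B k j))).
  apply: ler_sum => j _; rewrite mxE; apply: le_trans (cabs_sum _ _ _) _.
  by apply: ler_sum => k _; rewrite cabsM.
rewrite exchange_big/=; apply: ler_sum => k _.
rewrite -mulr_sumr ler_wpM2l ?cabs_ge0//.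
rewrite /norm1 (bigD1 k)//= lerDl; apply: sumr_ge0 => l _.
by apply: sumr_ge0 => j _; exact: cabs_ge0.
Qed.

Lemma norm1D m n (A B : 'M[R[i]]_(m, n)) : norm1 (A + B) <= norm1 A + norm1 B.
Proof.
rewrite /norm1 -big_split/=; apply: ler_sum => i _.
by rewrite -big_split/=; apply: ler_sum => j _; rewrite mxE cabsD.
Qed.

Lemma norm1Z m n a (A : 'M[R[i]]_(m, n)) : norm1 (a *: A) = cabs a * norm1 A.
Proof.
rewrite /norm1 mulr_sumr; apply: eq_bigr => i _.
by rewrite mulr_sumr; apply: eq_bigr => j _; rewrite mxE cabsM.
Qed.

Lemma norm1_cV n (v : 'cV[R[i]]_n) : norm1 v = \sum_i cabs (v i 0).
Proof. by apply: eq_bigr => i _; rewrite big_ord1. Qed.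

Lemma enormC_ge0 n (v : 'cV[R[i]]_n) : 0 <= enormC v.
Proof. exact: sqrtr_ge0. Qed.

Lemma cabs_le_enormC n (v : 'cV[R[i]]_n) i : cabs (v i 0) <= enormC v.
Proof.
rewrite -(ger0_norm (cabs_ge0 _)) -sqrtr_sqr ler_wsqrtr//.
by rewrite (bigD1 i)//= lerDl sumr_ge0// => j _; exact: sqr_ge0.
Qed.

Lemma norm1_le_enormC n (v : 'cV[R[i]]_n) : norm1 v <= n%:R * enormC v.
Proof.
rewrite norm1_cV.
apply: le_trans (ler_sum _ (fun i _ => cabs_le_enormC v i)) _.
by rewrite sumr_const card_ord mulr_natl.
Qed.

Lemma enormC_le_norm1 n (v : 'cV[R[i]]_n) : enormC v <= norm1 v.
Proof.
rewrite -(ger0_norm (norm1_ge0 v)) -sqrtr_sqr ler_wsqrtr//.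
rewrite norm1_cV.
suff [] : 0 <= \sum_i cabs (v i 0) /\
  \sum_i cabs (v i 0) ^+ 2 <= (\sum_i cabs (v i 0)) ^+ 2 by [].
elim/big_ind2: _ => [|x1 x2 y1 y2 [x0 xx] [y0 yy]|i _]; rewrite ?expr0n//.
  split; rewrite ?addr_ge0// sqrrD (le_trans (lerD xx yy))//.
  by rewrite addrAC lerDl mulrn_wge0// mulr_ge0.
by split => //; exact: cabs_ge0.
Qed.

Lemma enormCZ n a (v : 'cV[R[i]]_n) : enormC (a *: v) = cabs a * enormC v.
Proof.
rewrite /enormC (eq_bigr (fun i => cabs a ^+ 2 * cabs (v i 0) ^+ 2)).
  by rewrite -mulr_sumr sqrtrM ?sqr_ge0// sqrtr_sqr ger0_norm ?cabs_ge0.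
by move=> i _; rewrite mxE cabsM exprMn.
Qed.

Lemma enormC0 n : enormC (0 : 'cV[R[i]]_n) = 0.
Proof. by rewrite -(scale0r 0) enormCZ cabs0 mul0r. Qed.

Lemma enormC_delta n (i : 'I_n) : enormC (delta_mx i 0 : 'cV[R[i]]_n) = 1.
Proof.
rewrite /enormC (bigD1 i)//= mxE !eqxx/= big1 ?addr0 => [|j ji].
  by rewrite /cabs normr1 expr1n sqrtr1.
by rewrite mxE (negbTE ji)/= cabs0 expr0n.
Qed.

Lemma enormCM_le n m (A : 'M[R[i]]_(m, n)) v :
  enormC (A *m v) <= norm1 A * (n%:R * enormC v).
Proof.
apply: le_trans (enormC_le_norm1 _) _; apply: le_trans (norm1M _ _) _.
by rewrite ler_wpM2l ?norm1_ge0// norm1_le_enormC.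
Qed.

Lemma enormCD_le n (u v : 'cV[R[i]]_n) :
  enormC (u + v) <= n%:R * (enormC u + enormC v).
Proof.
apply: le_trans (enormC_le_norm1 _) _; apply: le_trans (norm1D _ _) _.
by rewrite mulrDr lerD ?norm1_le_enormC.
Qed.

(** The supremum defining the operator norm is taken over a bounded set, so it is at
    least each of its members. *)
Lemma enormC_le_opnorm n (A : 'M[R[i]]_n) (z : 'cV[R[i]]_n) :
  enormC z = 1 -> enormC (A *m z) <= opnorm A.
Proof.
move=> z1; apply: sup_upper_bound; last by exists z.
split; first by exists (enormC (A *m z)), z.
exists (norm1 A * n%:R) => _ [w w1 <-]; rewrite (le_trans (enormCM_le _ _))//.
by rewrite w1 mulr1.
Qed.

End complex_norms.

(** On the subspace of vectors of finite length, a quasi-norm is bounded by the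
    Euclidean length: expand a vector along a maximal independent family of
    vectors of finite length. *)
Section finite_subspace.
Local Open Scope ereal_scope.
Context {R : realType} (n : nat) (K : R).
Variable M : 'cV[R[i]]_n -> \bar R.
Hypothesis K1 : (1 <= K)%R.
Hypothesis M_ge0 : forall v, 0 <= M v.
Hypothesis MZ : forall a v, M (a *: v) <= (cabs a)%:E * M v.
Hypothesis MD : forall u v, M (u + v) <= K%:E * (M u + M v).

Lemma quasi_norm_sum (I : Type) (s : seq I) (v : I -> 'cV[R[i]]_n) :
  M (\sum_(i <- s) v i) <= (K ^+ size s)%:E * \sum_(i <- s) M (v i).
Proof.
elim: s => [|i s IH].
  by rewrite !big_nil mule0 -(scale0r 0) (le_trans (MZ _ _))// cabs0 mul0e.
rewrite !big_cons /= exprS EFinM -muleA; apply: le_trans (MD _ _) _.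
apply: lee_wpmul2l; first by rewrite lee_fin (le_trans ler01).
have S0 : 0 <= \sum_(j <- s) M (v j) by exact: sume_ge0.
rewrite muleDr ?ge0_adde_def ?inE// leeD//.
by rewrite -[leLHS]mul1e lee_wpmul2r// lee_fin exprn_ege1.
Qed.

Lemma quasi_norm_bounded :
  exists2 C : R, (0 <= C)%R & forall v, M v < +oo -> M v <= (C * enormC v)%:E.
Proof.
pose P r := `[< exists m (B : 'M[R[i]]_(m, n)),
   (forall i, M (row i B)^T < +oo) /\ \rank B = r >].
have P0 : exists r, P r by exists 0%N; apply/asboolP; exists 0%N, 0%R; split => [[]//|]; rewrite mxrank0.
have Pn r : P r -> (r <= n)%N by move=> /asboolP[m [B [_ <-]]]; exact: rank_leq_col.
have [r /asboolP[m [B [MB rB]]] rmax] := ex_maxnP P0 Pn.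
pose D := pinvmx B.
pose N := size (index_enum ('I_m : finType)).
pose C := (K ^+ N * (norm1 D * n%:R) * \sum_(i < m) fine (M (row i B)^T))%R.
have S0 : (0 <= \sum_(i < m) fine (M (row i B)^T))%R.
  by apply: sumr_ge0 => i _; exact: fine_ge0.
have K0 : (0 <= K ^+ N)%R by rewrite exprn_ge0// (le_trans ler01).
exists C; first by rewrite !mulr_ge0 ?norm1_ge0.
move=> v Mv.
have vB : (v^T <= B)%MS.
  have BB' : (B <= col_mx B v^T)%MS by rewrite -addsmxE addsmxSl.
  suff : (col_mx B v^T <= B)%MS by apply: submx_trans; rewrite -addsmxE addsmxSr.
  rewrite -(mxrank_leqif_sup BB').2 eqn_leq (mxrank_leqif_sup BB').1 rB.
  apply: rmax; apply/asboolP; exists (m + 1)%N, (col_mx B v^T); split => // i.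
  rewrite -(fintype.splitK i); case: (fintype.split i) => j /=.
    by rewrite rowKu.
  by rewrite rowKd (ord1 j) row_id trmxK.
pose c := v^T *m D.
have vE : v = (\sum_(i < m) c 0 i *: (row i B)^T)%R.
  rewrite -[LHS]trmxK -(mulmxKpV vB) mulmx_sum_row raddf_sum/=.
  by apply: eq_bigr => i _; rewrite linearZ.
rewrite {1}vE; apply: le_trans (quasi_norm_sum _ _) _.
rewrite /C -!mulrA EFinM; apply: lee_wpmul2l; first by rewrite lee_fin.
rewrite mulrA [X in (_ <= (_ * X)%:E)]mulrC mulrA mulr_sumr -sumEFin.
apply: lee_sum => i _; apply: (le_trans (MZ _ _)).
have Mi : M (row i B)^T = (fine (M (row i B)^T))%:E.
  by rewrite fineK// ge0_fin_numE.
rewrite Mi -EFinM lee_fin ler_wpM2r ?fine_ge0//.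
apply: (le_trans (cabs_le_norm1 _ _ _)); apply: (le_trans (norm1M _ _)).
rewrite -mulrA mulrC ler_wpM2l ?norm1_ge0//.
rewrite (_ : norm1 v^T = norm1 v) ?norm1_le_enormC//.
rewrite /norm1 exchange_big; apply: eq_bigr => j _; apply: eq_bigr => k _.
by rewrite mxE.
Qed.

End finite_subspace.

(** Vectors whose coordinates, divided by [eta], have the same integer parts are close;
    the net takes one vector for each list of integer parts that occurs. *)
Lemma finite_net (R : realType) (T : Type) (I : finType) (F : set T)
    (c : T -> I -> R) (b eta : R) : 0 < eta ->
  (forall f, F f -> forall i, `|c f i| <= b) ->
  exists N : set T, [/\ finite_set N, N `<=` F &
    forall f, F f -> exists2 g, N g & forall i, `|c f i - c g i| <= eta].
Proof.
move=> eta0 cb.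
have [[f0 Ff0]|NF] := pselect (exists f, F f); last first.
  exists set0; split; [exact: finite_set0|exact: sub0set|].
  by move=> f Ff; exfalso; apply: NF; exists f.
pose L := Num.truncn ((b + b) / eta).
pose q f i := (c f i + b) / eta.
have q0 f i : F f -> 0 <= q f i.
  move=> Ff; rewrite divr_ge0 ?(ltW eta0)// -lerBlDr sub0r.
  by have := cb f Ff i; rewrite ler_norml => /andP[].
pose kap f : {ffun I -> 'I_L.+1} := [ffun i => inord (Num.truncn (q f i))].
have kapE f i : F f -> (kap f i : nat) = Num.truncn (q f i).
  move=> Ff; rewrite ffunE inordK// ltnS le_truncn// ler_pM2r ?invr_gt0//.
  by rewrite lerD2r (le_trans (ler_norm _))// cb.
have /choice[g hg] : forall k : {ffun I -> 'I_L.+1}, exists g, F g /\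
    forall f, F f -> kap f = k -> kap g = k.
  move=> k; have [[f [Ff fk]]|Nk] := pselect (exists f, F f /\ kap f = k).
    by exists f.
  by exists f0; split => // f Ff fk; exfalso; apply: Nk; exists f.
exists (range g); split.
- exact: finite_image.
- by move=> _ [k _ <-]; have [] := hg k.
- move=> f Ff; exists (g (kap f)); first by exists (kap f).
  move=> i; have [Fg /(_ f Ff erefl) kg] := hg (kap f).
  have := kapE f i Ff; have := kapE _ i Fg; rewrite kg => -> e.
  have /andP[f1 f2] := truncn_itv (q0 f i Ff).
  have /andP[g1 g2] := truncn_itv (q0 _ i Fg).
  rewrite -e in f1 f2.
  have -> : c f i - c (g (kap f)) i = (q f i - q (g (kap f)) i) * eta.
    by rewrite /q -mulrBl divfK ?gt_eqF// opprD addrACA subrr addr0.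
  rewrite normrM (gtr0_norm eta0) -[leRHS]mul1r ler_wpM2r ?(ltW eta0)//.
  rewrite ler_norml lerBrDr lerBlDr.
  rewrite -natr1 in f2; rewrite -natr1 in g2.
  apply/andP; split; last by rewrite (le_trans (ltW f2))// addrC lerD2l.
  by rewrite addrC lerBlDr (le_trans (ltW g2))// lerD2r.
Qed.

(** * Boxes and the norm of a nonnegative function *)

Section boxes.
Context {R : realType} (n : nat).
Implicit Types (a b x y : 'rV[R]_n).

Definition box a b : set 'rV[R]_n := [set x | forall i, a 0 i <= x 0 i < b 0 i].

Lemma measurable_box a b : measurable (box a b).
Proof.
rewrite (_ : box a b = \bigcap_(i in [set: 'I_n])
    ((fun x : 'rV[R]_n => x 0 i) @^-1` [set` `[a 0 i, b 0 i[])).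
  apply: fin_bigcap_measurable => // i _; rewrite -[X in measurable X]setTI.
  by apply: measurable_coord_rV => //; exact: measurable_itv.
apply/seteqP; split => x /= H i; first by move=> _; rewrite /= in_itv/=.
by have /= := H i I; rewrite in_itv.
Qed.

Lemma dyadic_cubeE (j : int) (k : 'rV[int]_n) : @dyadic_cube R n j k =
  box (\row_i (2 ^ (- j) * (k 0 i)%:~R)) (\row_i (2 ^ (- j) * ((k 0 i)%:~R + 1))).
Proof. by apply/seteqP; split => x /= H i; have := H i; rewrite !mxE. Qed.

Lemma measurable_dyadic_cube j k : measurable (@dyadic_cube R n j k).
Proof. by rewrite dyadic_cubeE; exact: measurable_box. Qed.

Lemma dyadic_step_gt0 (j : int) : 0 < 2 ^ (- j) :> R.
Proof. exact: exprz_gt0. Qed.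

Lemma borel_lebesgue_dyadic (j : int) (k : 'rV[int]_n) :
  borel_lebesgue n (@dyadic_cube R n j k) = ((2 ^ (- j)) ^+ n)%:E.
Proof.
rewrite dyadic_cubeE borel_lebesgue_box => [|i]; last first.
  by rewrite !mxE ler_wpM2l ?(ltW (dyadic_step_gt0 j))// lerDl.
congr (_%:E); rewrite (eq_bigr (fun=> 2 ^ (- j))) ?prodr_const ?card_ord//.
by move=> i _; rewrite !mxE -mulrBr addrAC subrr add0r mulr1.
Qed.

End boxes.

Section weighted_power.
Context {R : realType} (d : nat) (p : R).
Hypothesis p1 : 1 <= p.
Implicit Types (u v : 'cV[R[i]]_d).

Let p0 : 0 <= p. Proof. exact: le_trans p1. Qed.

Definition pw v : R := enormC v `^ p.

(** The constant of the quasi-triangle inequality for the [p]-th power of the length. *)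
Definition pwK : R := d%:R `^ p * 2 `^ p.

Lemma pw_ge0 v : 0 <= pw v. Proof. exact: powR_ge0. Qed.

Lemma pwK_ge0 : 0 <= pwK. Proof. by rewrite mulr_ge0 ?powR_ge0. Qed.

Lemma powRD_le (s a b : R) : 0 <= s -> 0 <= a -> 0 <= b ->
  (a + b) `^ s <= 2 `^ s * (a `^ s + b `^ s).
Proof.
move=> s0 a0 b0; rewrite -lee_fin.
by apply: (@poweRD_le R s a%:E b%:E); rewrite ?lee_fin.
Qed.

Lemma pwD u v : pw (u + v) <= pwK * (pw u + pw v).
Proof.
have uv0 : 0 <= enormC u + enormC v by rewrite addr_ge0 ?enormC_ge0.
apply: (@le_trans _ _ ((d%:R * (enormC u + enormC v)) `^ p)).
  by apply: ge0_ler_powR => //; rewrite ?nnegrE ?mulr_ge0 ?enormC_ge0// enormCD_le.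
rewrite powRM// /pwK -mulrA ler_wpM2l ?powR_ge0//.
by apply: powRD_le => //; exact: enormC_ge0.
Qed.

Lemma pwZ a v : pw (a *: v) = cabs a `^ p * pw v.
Proof. by rewrite /pw enormCZ powRM ?cabs_ge0 ?enormC_ge0. Qed.

Lemma pwN v : pw (- v) = pw v.
Proof. by rewrite -scaleN1r pwZ /cabs normrN normr1 powR1 mul1r. Qed.

Lemma pwB u v : pw (u - v) <= pwK * (pw u + pw v).
Proof. by rewrite -(pwN v) pwD. Qed.

End weighted_power.

Section norm_of_function.
Local Open Scope ereal_scope.
Context {R : realType} (n : nat).
Variables (p : R) (r : \bar R) (w : int * 'rV[int]_n -> \bar R).
Hypotheses (p1 : (1 <= p)%R) (pr : p%:E <= r) (w0 : forall jk, 0 < w jk).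
Local Notation X := 'rV[R]_n.
Local Notation mu := (borel_lebesgue n).
Implicit Types u v : X -> \bar R.

Let p0 : (0 < p)%R. Proof. exact: lt_le_trans p1. Qed.
Let r1 : 1 <= r. Proof. by rewrite (le_trans _ pr)// lee_fin. Qed.
Let r0 : 0 < r. Proof. exact: lt_le_trans r1. Qed.

Definition cube_integral u (jk : int * 'rV[int]_n) : \bar R :=
  \int[mu]_(x in dyadic_cube jk.1 jk.2) u x.

(** The Bourgain-Morrey norm as a function of [u = |W ^ (1/p) f| ^ p]; the weight of
    the cube, raised to the power [p], is kept inside the [p]-th root. *)
Definition fnorm u : \bar R :=
  lnorm r (fun jk => (w jk * cube_integral u jk) `^ p^-1).

Lemma cube_integral_ge0 u jk : (forall x, 0 <= u x) -> 0 <= cube_integral u jk.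
Proof. by move=> u0; exact: integral_ge0. Qed.

Lemma le_cube_integral u v jk : measurable_fun [set: X] u ->
  measurable_fun [set: X] v -> (forall x, 0 <= u x) -> (forall x, u x <= v x) ->
  cube_integral u jk <= cube_integral v jk.
Proof.
move=> mu_ mv u0 uv; apply: ge0_le_integral => //.
- exact: measurable_dyadic_cube.
- exact: measurable_funS mu_.
- exact: measurable_funS mv.
Qed.

Let iw0 jk u : (forall x, 0 <= u x) -> 0 <= w jk * cube_integral u jk.
Proof. by move=> u0; rewrite mule_ge0 ?cube_integral_ge0// ltW. Qed.

Lemma le_fnorm u v : measurable_fun [set: X] u ->
  measurable_fun [set: X] v -> (forall x, 0 <= u x) -> (forall x, u x <= v x) ->
  fnorm u <= fnorm v.
Proof.
move=> mu_ mv u0 uv; apply: le_lnorm => // jk; first exact: poweR_ge0.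
apply: le_poweR; rewrite ?invr_ge0 ?(ltW p0)//; first exact: iw0.
by apply: lee_wpmul2l; [exact: ltW|exact: le_cube_integral].
Qed.

Lemma fnormD u v : measurable_fun [set: X] u -> measurable_fun [set: X] v ->
  (forall x, 0 <= u x) -> (forall x, 0 <= v x) ->
  fnorm (fun x => u x + v x) <= 8%:E * (fnorm u + fnorm v).
Proof.
move=> mu_ mv u0 v0.
have f0 z : (forall x, 0 <= z x) -> 0 <= fnorm z.
  move=> z0; apply: le_trans (lnorm_ge (0%R, 0%R) r0 _) => [|i]; exact: poweR_ge0.
have s0 (z : X -> \bar R) jk : 0 <= (w jk * cube_integral z jk) `^ p^-1.
  exact: poweR_ge0.
apply: (@le_trans _ _ (lnorm r (fun jk => 2%:E *
   ((w jk * cube_integral u jk) `^ p^-1 + (w jk * cube_integral v jk) `^ p^-1)))).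
  apply: le_lnorm => // jk.
  rewrite {1}/cube_integral ge0_integralD//; last 3 first.
  - exact: measurable_dyadic_cube.
  - exact: measurable_funS mu_.
  - exact: measurable_funS mv.
  rewrite -!/(cube_integral _ _).
  rewrite ge0_muleDr ?cube_integral_ge0//.
  have ip : (0 <= p^-1)%R by rewrite invr_ge0 ltW.
  apply: (le_trans (poweRD_le ip (iw0 jk u0) (iw0 jk v0))).
  apply: lee_wpmul2r; first exact: adde_ge0.
  by rewrite lee_fin -[leRHS]powRr1// ler_powR ?ler1n// invf_le1.
apply: (le_trans (lnormZ r0 (ler0n R 2) _)); first by move=> jk; exact: adde_ge0.
rewrite (_ : 8%:E = 2%:E * 4%:E :> \bar R); last by rewrite -EFinM -natrM.
by rewrite -muleA lee_wpmul2l ?lee_fin//; apply: lnormD.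
Qed.

Lemma fnorm_ge0 u : 0 <= fnorm u.
Proof. by apply: le_trans (lnorm_ge (0%R, 0%R) r0 _) => [|i]; exact: poweR_ge0. Qed.

Lemma fnormZ u (c : R) : measurable_fun [set: X] u -> (forall x, 0 <= u x) ->
  (0 <= c)%R -> fnorm (fun x => c%:E * u x) <= (c `^ p^-1)%:E * fnorm u.
Proof.
move=> mu_ u0 c0; apply: le_trans (lnormZ r0 (powR_ge0 _ _) _); last first.
  by move=> jk; exact: poweR_ge0.
apply: le_lnorm => // jk; first exact: poweR_ge0.
rewrite {1}/cube_integral ge0_integralZl//; last 2 first.
- exact: measurable_dyadic_cube.
- exact: measurable_funS mu_.
rewrite -[X in w jk * (_ * X)]/(cube_integral u jk) muleCA.
by rewrite (poweRM _ _ (iw0 jk u0)) ?lee_fin// poweR_EFin.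
Qed.

(** A pointwise quasi-triangle inequality passes to the norm. *)
Lemma fnorm_le2 D u v (c : R) : measurable_fun [set: X] D ->
  measurable_fun [set: X] u -> measurable_fun [set: X] v ->
  (forall x, 0 <= D x) -> (forall x, 0 <= u x) -> (forall x, 0 <= v x) ->
  (0 <= c)%R -> (forall x, D x <= c%:E * (u x + v x)) ->
  fnorm D <= (c `^ p^-1 * 8)%:E * (fnorm u + fnorm v).
Proof.
move=> mD mu_ mv D0 u0 v0 c0 Duv.
have muv : measurable_fun [set: X] (fun x => u x + v x) by exact: emeasurable_funD.
have uv0 x : 0 <= u x + v x by exact: adde_ge0.
have E1 := le_fnorm mD (measurable_funeM c%:E muv) D0 Duv.
have E2 := fnormZ muv uv0 c0.
have E3 := fnormD mu_ mv u0 v0.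
apply: (le_trans E1); apply: (le_trans E2).
rewrite EFinM -muleA; apply: lee_wpmul2l => //.
by rewrite lee_fin powR_ge0.
Qed.

Lemma fnorm0 : fnorm (fun=> 0) = 0.
Proof.
apply/eqP; rewrite eq_le fnorm_ge0 andbT.
have := @fnormZ (fun=> 0) 0 (measurable_cst _) (fun=> lexx _) (lexx _).
by rewrite powR0 ?invr_eq0 ?gt_eqF// !mul0e.
Qed.

Lemma fnorm_sum (I : Type) (s : seq I) (v : I -> X -> \bar R) :
  (forall i, measurable_fun [set: X] (v i)) -> (forall i x, 0 <= v i x) ->
  fnorm (fun x => \sum_(i <- s) v i x) <=
  (8 ^+ size s)%:E * \sum_(i <- s) fnorm (v i).
Proof.
move=> mv v0; elim: s => [|i s IH].
  rewrite big_nil mule0; under eq_fun do rewrite big_nil.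
  by rewrite fnorm0.
rewrite big_cons; under eq_fun do rewrite big_cons.
apply: (le_trans (fnormD _ _ _ _)) => //.
- exact: emeasurable_sum.
- by move=> x; exact: sume_ge0.
rewrite /= exprS EFinM -muleA lee_wpmul2l ?lee_fin//.
have S0 : 0 <= \sum_(j <- s) fnorm (v j) by apply: sume_ge0 => j _; exact: fnorm_ge0.
rewrite muleDr ?ge0_adde_def ?inE ?fnorm_ge0// leeD//.
by rewrite -[leLHS]mul1e lee_wpmul2r ?fnorm_ge0// lee_fin exprn_ege1// ler1n.
Qed.

(** Each single term is bounded by the whole [l^r] norm. When the weight of the cube
    is infinite, a finite norm forces the integral to vanish. *)
Lemma cube_integral_bounded jk (e : R) : (0 <= e)%R -> exists2 C : R, (0 <= C)%R &
  forall u, (forall x, 0 <= u x) -> fnorm u <= e%:E -> cube_integral u jk <= C%:E.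
Proof.
move=> e0; have := w0 jk; case E : (w jk) => [s| |]//; last first.
  move=> _; exists 0%R => // u u0 ue; rewrite leNgt; apply/negP => Q0.
  have := le_trans (lnorm_ge jk r0 (fun i => poweR_ge0 _ _)) ue.
  by rewrite E gt0_mulye// poweRyr ?invr_eq0 ?gt_eqF.
rewrite lte_fin => s0; exists (e `^ p / s)%R => [|u u0 ue].
  by rewrite divr_ge0 ?powR_ge0 ?ltW.
rewrite mulrC EFinM lee_pdivlMl//.
rewrite -[leLHS](@poweRVK _ p) ?gt_eqF//; last first.
  by rewrite mule_ge0 ?lee_fin ?(ltW s0)// cube_integral_ge0.
rewrite -poweR_EFin; apply: le_poweR; rewrite ?(ltW p0) ?poweR_ge0//.
apply: le_trans ue; have := lnorm_ge jk r0
  (fun i => poweR_ge0 (w i * cube_integral u i) p^-1).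
by rewrite E.
Qed.

(** Tonelli's theorem turns the integral of the average over each cube into the
    average of the integrals, to which [lnorm_average] applies. *)
Lemma fnorm_average (Y : set X) (m : R) (u : X -> X -> \bar R) (e : \bar R) :
  measurable Y -> (0 < m)%R -> mu Y = m%:E -> 0 <= e ->
  measurable_fun [set: X * X] (fun z => u z.1 z.2) ->
  (forall x y, 0 <= u x y) ->
  (forall y, Y y -> fnorm (fun x => u x y) <= e) ->
  fnorm (fun x => average mu Y m (u x)) <= 2%:E * e.
Proof.
move=> mY m0 muY e0 mu2 u0 ue.
have mQ jk := @measurable_dyadic_cube R n jk.1 jk.2.
pose U jk (z : X * X) := u z.1 z.2 * (\1_(dyadic_cube jk.1 jk.2) z.1)%:E.
have mU jk : measurable_fun [set: X * X] (U jk).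
  apply: emeasurable_funM => //; apply/measurable_EFinP.
  by apply: (measurableT_comp (measurable_indic (mQ jk))).
have U0 jk z : 0 <= U jk z by rewrite mule_ge0// lee_fin.
have cE jk y : cube_integral (fun x => u x y) jk = \int[mu]_x U jk (x, y).
  rewrite /cube_integral integral_mkcond; apply: eq_integral => x _.
  by rewrite epatch_indic.
have mc jk : measurable_fun Y (fun y => cube_integral (fun x => u x y) jk).
  apply: measurable_funTS; under eq_fun do rewrite cE.
  exact: (measurable_fun_fubini_tonelli_G (m1 := mu) _ (mU jk) (U0 jk)).
have swap jk : cube_integral (fun x => average mu Y m (u x)) jk =
    average mu Y m (fun y => cube_integral (fun x => u x y) jk).
  pose V (z : X * X) := u z.1 z.2 * (\1_Y z.2)%:E.
  have mV : measurable_fun [set: X * X] V.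
    apply: emeasurable_funM => //; apply/measurable_EFinP.
    by apply: (measurableT_comp (measurable_indic mY)).
  have V0 z : 0 <= V z by rewrite mule_ge0// lee_fin.
  have VE x : average mu Y m (u x) = (m^-1)%:E * \int[mu]_y V (x, y).
    by congr (_ * _); rewrite integral_mkcond; apply: eq_integral => y _; rewrite epatch_indic.
  pose Z (z : X * X) := V z * (\1_(dyadic_cube jk.1 jk.2) z.1)%:E.
  have mZ : measurable_fun [set: X * X] Z.
    apply: emeasurable_funM => //; apply/measurable_EFinP.
    by apply: (measurableT_comp (measurable_indic (mQ jk))).
  have Z0 z : 0 <= Z z by rewrite mule_ge0// lee_fin.
  have mF : measurable_fun [set: X] (fun x => \int[mu]_y V (x, y)).
    exact: (measurable_fun_fubini_tonelli_F (m2 := mu) _ mV V0).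
  rewrite {1}/cube_integral; under eq_integral do rewrite VE.
  rewrite (ge0_integralZl mu (mQ jk) (measurable_funTS mF)); last 2 first.
  - by move=> x _; exact: integral_ge0.
  - by rewrite lee_fin invr_ge0 ltW.
  congr (_ * _); transitivity (\int[mu]_x \int[mu]_y Z (x, y)).
    rewrite integral_mkcond; apply: eq_integral => x _.
    rewrite epatch_indic muleC -ge0_integralZl//.
    - by apply: eq_integral => y _; rewrite muleC.
    - by apply: (measurableT_comp mV); exact: measurable_pair1.
    - by rewrite lee_fin.
  transitivity (\int[mu]_y \int[mu]_x Z (x, y)).
    exact: (fubini_tonelli (m1 := mu) (m2 := mu) _ mZ Z0).
  rewrite [RHS]integral_mkcond.
  apply: eq_integral => y _; rewrite epatch_indic cE muleC -ge0_integralZl//.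
  - by apply: eq_integral => x _; rewrite /Z /V /U/= muleAC muleC.
  - by apply: (measurableT_comp (mU jk)); exact: measurable_pair2.
  - by rewrite lee_fin.
rewrite /fnorm; under eq_fun do rewrite swap.
apply: le_trans; last first.
  apply: (@lnorm_average _ _ _ _ mu Y m
    (fun jk y => w jk * cube_integral (fun x => u x y) jk) p r e) => //.
  - by move=> jk; exact: measurable_funeM.
  - by move=> jk y _; rewrite iw0.
apply: le_lnorm => // jk; first exact: poweR_ge0.
rewrite /average muleCA ge0_integralZl// ?ltW//.
by move=> y _; rewrite cube_integral_ge0.
Qed.

End norm_of_function.

(** * Averages of vector-valued functions *)

Lemma sume_const (R : realType) k (x : \bar R) :
  (\sum_(i < k) x = k%:R%:E * x)%E.
Proof.
elim: k => [|k IH]; first by rewrite big_ord0 mul0e.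
by rewrite big_ord_recr/= IH -natr1 EFinD ge0_muleDl ?lee_fin// mul1e.
Qed.

Section complex_average.
Context {R : realType} {dT : measure_display} {T : measurableType dT}.
Variables (mu : {measure set T -> \bar R}) (Y : set T) (m : R).
Hypotheses (mY : measurable Y) (m0 : 0 < m) (muY : mu Y = m%:E).
Implicit Types f g : T -> R[i].

Definition integC g : Prop :=
  measC g /\ (\int[mu]_(x in Y) (cabs (g x))%:E < +oo)%E.

Lemma integC_le g (h : T -> \bar R) : measC g -> measurable_fun Y h ->
  (forall y, Y y -> ((cabs (g y))%:E <= h y)%E) ->
  (\int[mu]_(x in Y) h x < +oo)%E -> integC g.
Proof.
move=> mg mh gh hoo; split => //; apply: le_lt_trans hoo.
apply: ge0_le_integral => //; first by move=> x _; rewrite lee_fin cabs_ge0.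
by apply/measurable_EFinP; apply: measurable_funTS; exact: measurable_cabs.
Qed.

Lemma integC_cst c : integC (fun=> c).
Proof.
split; first exact: measC_cst.
by rewrite integral_cst// muY -EFinM ltry.
Qed.

Let mcabs g : measC g -> measurable_fun Y (fun x => (cabs (g x))%:E).
Proof.
by move=> mg; apply/measurable_EFinP; apply: measurable_funTS; exact: measurable_cabs.
Qed.

Lemma integCD f g : integC f -> integC g -> integC (fun x => f x + g x).
Proof.
move=> [mf f1] [mg g1].
apply: (@integC_le _ (fun x => (cabs (f x))%:E + (cabs (g x))%:E)%E).
- exact: measCD.
- by apply: emeasurable_funD; exact: mcabs.
- by move=> y _; rewrite -EFinD lee_fin cabsD.
- rewrite ge0_integralD//.
  + exact: lte_add_pinfty.
  + by move=> x _; rewrite lee_fin cabs_ge0.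
  + exact: mcabs.
  + by move=> x _; rewrite lee_fin cabs_ge0.
  + exact: mcabs.
Qed.

Lemma integCZ c g : integC g -> integC (fun x => c * g x).
Proof.
move=> [mg g1].
apply: (@integC_le _ (fun x => (cabs c)%:E * (cabs (g x))%:E)%E).
- by apply: measCM => //; exact: measC_cst.
- by apply: measurable_funeM; exact: mcabs.
- by move=> y _; rewrite -EFinM lee_fin cabsM.
- rewrite ge0_integralZl//.
  + by rewrite lte_mul_pinfty// lee_fin cabs_ge0.
  + exact: mcabs.
  + by move=> x _; rewrite lee_fin cabs_ge0.
  + by rewrite lee_fin cabs_ge0.
Qed.

Lemma integC_Re g : integC g -> mu.-integrable Y (EFin \o (fun x => complex.Re (g x))).
Proof.
move=> [mg g1]; apply/integrableP; split.
  by apply/measurable_EFinP; apply: measurable_funTS; exact: mg.1.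
apply: le_lt_trans g1; apply: ge0_le_integral => //.
- apply: measurableT_comp => //; apply/measurable_EFinP.
  by apply: measurable_funTS; exact: mg.1.
- exact: mcabs.
- by move=> x _; rewrite /= lee_fin Re_le_cabs.
Qed.

Lemma integC_Im g : integC g -> mu.-integrable Y (EFin \o (fun x => complex.Im (g x))).
Proof.
move=> [mg g1]; apply/integrableP; split.
  by apply/measurable_EFinP; apply: measurable_funTS; exact: mg.2.
apply: le_lt_trans g1; apply: ge0_le_integral => //.
- apply: measurableT_comp => //; apply/measurable_EFinP.
  by apply: measurable_funTS; exact: mg.2.
- exact: mcabs.
- by move=> x _; rewrite /= lee_fin Im_le_cabs.
Qed.

Definition caverage g : R[i] :=
  Complex (m^-1 * \int[mu]_(x in Y) complex.Re (g x))
          (m^-1 * \int[mu]_(x in Y) complex.Im (g x)).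

Lemma caverage_cst c : caverage (fun=> c) = c.
Proof.
rewrite /caverage !Rintegral_cst// muY/=.
by case: c => a b /=; rewrite ![m^-1 * _]mulrC !mulfK ?gt_eqF.
Qed.

Lemma caverageD f g : integC f -> integC g ->
  caverage (fun x => f x + g x) = caverage f + caverage g.
Proof.
move=> fi gi; rewrite /caverage.
under eq_Rintegral do rewrite raddfD.
rewrite RintegralD//; [|exact: integC_Re|exact: integC_Re].
under [X in Complex _ (_ * X)]eq_Rintegral do rewrite raddfD.
rewrite RintegralD//; [|exact: integC_Im|exact: integC_Im].
by rewrite !mulrDr.
Qed.

Lemma caverageZ c g : integC g -> caverage (fun x => c * g x) = c * caverage g.
Proof.
move=> gi; have [gr gim] := (integC_Re gi, integC_Im gi).
have Zr (a : R) h : mu.-integrable Y (EFin \o h) ->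
    mu.-integrable Y (EFin \o (fun x => a * h x)).
  by move=> /(integrableZl mY a).
case: c => a b; rewrite /caverage.
rewrite (@eq_Rintegral _ _ _ mu Y (fun x => a * complex.Re (g x) - b * complex.Im (g x)));
  last by move=> x _; case: (g x).
rewrite RintegralB ?RintegralZl//; [|exact: Zr|exact: Zr].
rewrite [X in Complex _ (_ * X)](@eq_Rintegral _ _ _ mu Y
  (fun x => a * complex.Im (g x) + b * complex.Re (g x)));
  last by move=> x _; case: (g x).
rewrite RintegralD ?RintegralZl//; [|exact: Zr|exact: Zr].
set x := \int[mu]_(x in Y) _; set y := \int[mu]_(x in Y) _.
apply/eqP; rewrite eq_complex/=; apply/andP; split; apply/eqP.
  by rewrite mulrBr; congr (_ - _); rewrite mulrCA.
by rewrite mulrDr; congr (_ + _); rewrite mulrCA.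
Qed.

Lemma integC_sum (I : Type) (s : seq I) (F : I -> T -> R[i]) :
  (forall i, integC (F i)) -> integC (fun x => \sum_(i <- s) F i x).
Proof.
move=> iF; elim: s => [|i s IH].
  by under eq_fun do rewrite big_nil; exact: integC_cst.
by under eq_fun do rewrite big_cons; exact: integCD.
Qed.

Lemma caverage_sum (I : Type) (s : seq I) (F : I -> T -> R[i]) :
  (forall i, integC (F i)) ->
  caverage (fun x => \sum_(i <- s) F i x) = \sum_(i <- s) caverage (F i).
Proof.
move=> iF; elim: s => [|i s IH].
  by rewrite big_nil -[RHS](caverage_cst 0); congr caverage; apply/funext => x; rewrite big_nil.
rewrite big_cons -IH -caverageD//; last exact: integC_sum.
by congr caverage; apply/funext => x; rewrite big_cons.
Qed.

Lemma cabs_caverage g : integC g ->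
  ((cabs (caverage g))%:E <= 2%:E * average mu Y m (fun x => (cabs (g x))%:E))%E.
Proof.
move=> gi; have mg := gi.1.
have key (h : T -> R) : mu.-integrable Y (EFin \o h) -> (forall x, `|h x| <= cabs (g x)) ->
   (`|(m^-1 * \int[mu]_(x in Y) h x)%R|%:E <= average mu Y m (fun x => (cabs (g x))%:E))%E.
  move=> hi hg; rewrite normrM gtr0_norm ?invr_gt0// EFinM.
  apply: lee_wpmul2l; first by rewrite lee_fin invr_ge0 ltW.
  rewrite EFin_normr_Rintegral//.
  have /integrableP[mh _] := hi.
  apply: (le_trans (le_abse_integral _ mY mh)); apply: ge0_le_integral => //.
  - exact: measurableT_comp.
  - exact: mcabs.
  - by move=> x _; rewrite /= lee_fin.
apply: (@le_trans _ _ ((`|complex.Re (caverage g)| + `|complex.Im (caverage g)|)%:E)).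
  by rewrite lee_fin cabs_le_ReIm.
rewrite EFinD mule_natl mule2n leeD//.
  by apply: key; [exact: integC_Re|move=> x; exact: Re_le_cabs].
by apply: key; [exact: integC_Im|move=> x; exact: Im_le_cabs].
Qed.

Definition vaverage d (f : T -> 'cV[R[i]]_d) : 'cV[R[i]]_d :=
  \col_i caverage (fun x => f x i 0).

(** By linearity [M *m (a - vaverage f)] is the average of [M *m (a - f z)]; bounding
    each of its coordinates by the average modulus costs the factor [2 d]. *)
Lemma enormC_sub_vaverage d (M : 'M[R[i]]_d) (a : 'cV[R[i]]_d)
    (f : T -> 'cV[R[i]]_d) : (forall i, integC (fun x => f x i 0)) ->
  ((enormC (M *m (a - vaverage f)))%:E <= (2 * d%:R)%:E *
     average mu Y m (fun z => (enormC (M *m (a - f z)))%:E))%E.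
Proof.
move=> fi; pose h (i : 'I_d) z := (M *m (a - f z)) i 0.
have hE i z : h i z = \sum_j M i j * (a j 0 + (-1) * f z j 0).
  by rewrite /h mxE; apply: eq_bigr => j _; rewrite !mxE mulN1r.
have gi i j : integC (fun z => M i j * (a j 0 + (-1) * f z j 0)).
  by apply: integCZ; apply: integCD; [exact: integC_cst|exact: integCZ].
have hi i : integC (h i).
  by rewrite (_ : h i = fun z => \sum_j M i j * (a j 0 + (-1) * f z j 0));
    [exact: integC_sum|apply/funext].
have cE i : (M *m (a - vaverage f)) i 0 = caverage (h i).
  rewrite (_ : h i = fun z => \sum_j M i j * (a j 0 + (-1) * f z j 0)); last exact/funext.
  rewrite caverage_sum// mxE; apply: eq_bigr => j _; rewrite caverageZ; last first.
    by apply: integCD; [exact: integC_cst|exact: integCZ].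
  by rewrite caverageD ?caverage_cst ?caverageZ ?mulN1r ?mxE//;
    [exact: integC_cst|exact: integCZ].
have mh : measM (fun z => M *m (a - f z)).
  by move=> i j; rewrite (ord1 j); exact: (hi i).1.
apply: (@le_trans _ _ (\sum_(i < d) 2%:E * average mu Y m
    (fun z => (enormC (M *m (a - f z)))%:E))%E); last first.
  by rewrite sume_const muleA -EFinM mulrC.
apply: (@le_trans _ _ (\sum_(i < d) (cabs ((M *m (a - vaverage f)) i 0))%:E)%E).
  by rewrite sumEFin lee_fin -norm1_cV enormC_le_norm1.
apply: lee_sum => i _; rewrite cE; apply: (le_trans (cabs_caverage (hi i))).
apply: lee_wpmul2l => //; apply: le_average => //.
- exact: mcabs (hi i).1.
- by apply/measurable_EFinP; apply: measurable_funTS; exact: measurable_enormC.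
- by move=> y _; rewrite lee_fin cabs_ge0.
- by move=> y _; rewrite lee_fin cabs_le_enormC.
Qed.

End complex_average.

(** * Oscillation over cells *)

Lemma measM_comp (R : realType) d1 d2 (T1 : measurableType d1)
    (T2 : measurableType d2) m n (A : T2 -> 'M[R[i]]_(m, n)) (phi : T1 -> T2) :
  measM A -> measurable_fun [set: T1] phi -> measM (fun x => A (phi x)).
Proof.
move=> mA mphi i j; have [mr mi] := mA i j.
by split; [exact: (measurableT_comp mr mphi)|exact: (measurableT_comp mi mphi)].
Qed.

Lemma measM_sub (R : realType) d (T : measurableType d) m n
    (A B : T -> 'M[R[i]]_(m, n)) :
  measM A -> measM B -> measM (fun x => A x - B x).
Proof.
by move=> mA mB i j; under eq_fun do rewrite !mxE; exact: measCB.
Qed.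

Lemma measM_cst (R : realType) d (T : measurableType d) m n (A : 'M[R[i]]_(m, n)) :
  measM (fun _ : T => A).
Proof. by move=> i j; exact: measC_cst. Qed.

Lemma measM_if (R : realType) d (T : measurableType d) m n (D : set T)
    (A B : T -> 'M[R[i]]_(m, n)) : measurable D -> measM A -> measM B ->
  measM (fun x => if x \in D then A x else B x).
Proof.
move=> mD mA mB i j.
rewrite (_ : (fun x => _) = fun x => if x \in D then A x i j else B x i j).
  exact: measC_if.
by apply/funext => x; case: ifP.
Qed.

Section core.
Context {R : realType} (n d : nat) (p : R) (V : 'rV[R]_n -> 'M[R[i]]_d).
Hypotheses (p1 : 1 <= p) (mV : measM V) (uV : forall x, V x \in unitmx).
Local Notation X := 'rV[R]_n.
Local Notation mu := (borel_lebesgue n).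
Implicit Types (f g : X -> 'cV[R[i]]_d).

Let p0 : 0 < p. Proof. exact: lt_le_trans p1. Qed.

Definition vpw f (x : X) : \bar R := (pw p (V x *m f x))%:E.

Lemma vpwE f x : vpw f x = (pw p (V x *m f x))%:E. Proof. by []. Qed.

Lemma measurable_pw d' (T : measurableType d') m (f : T -> 'cV[R[i]]_m) :
  measM f -> measurable_fun [set: T] (fun x => (pw p (f x))%:E).
Proof.
move=> mf; apply/measurable_EFinP.
by apply: (measurableT_comp (measurable_powR _)); exact: measurable_enormC.
Qed.

Lemma measurable_vpw f : measM f -> measurable_fun [set: X] (vpw f).
Proof. by move=> mf; apply: measurable_pw; exact: measM_mul. Qed.

Lemma vpw_ge0 f x : (0 <= vpw f x)%E.
Proof. by rewrite lee_fin pw_ge0. Qed.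

Lemma enormC_le_unit m (A : 'M[R[i]]_m) (v : 'cV[R[i]]_m) : A \in unitmx ->
  enormC v <= norm1 (invmx A) * (m%:R * enormC (A *m v)).
Proof. by move=> uA; rewrite -{1}(mulKmx uA v) enormCM_le. Qed.

Lemma norm1_invmx m (A : 'M[R[i]]_m) : A \in unitmx ->
  cabs (\det A) * norm1 (invmx A) = norm1 (\adj A).
Proof.
move=> uA; by rewrite -norm1Z /invmx uA scalerA divrr ?scale1r// -unitmxE.
Qed.

Lemma measurable_norm1 d' (T : measurableType d') m k (A : T -> 'M[R[i]]_(m, k)) :
  measM A -> measurable_fun [set: T] (fun x => norm1 (A x)).
Proof.
by move=> mA; apply: measurable_sum => i; apply: measurable_sum => j; exact: measurable_cabs.
Qed.

(** The weight cannot degenerate on a whole set of positive measure: on a part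
    of positive measure the inverses are bounded. *)
Lemma pw_lower (Q : set X) : measurable Q -> (0 < mu Q)%E -> (mu Q < +oo)%E ->
  exists2 a : R, 0 < a & forall v : 'cV[R[i]]_d,
    ((a * pw p v)%:E <= \int[mu]_(x in Q) vpw (fun=> v) x)%E.
Proof.
move=> mQ Q0 Qoo.
pose E (M : nat) := Q `&` [set x | norm1 (\adj (V x)) * d%:R <= M%:R * cabs (\det (V x))].
have mE M : measurable (E M).
  apply: measurableI => //; rewrite -[X in measurable X]setTI.
  apply: measurable_fun_le => //.
    apply: measurable_funM => //; apply: measurable_norm1; exact: measM_adj.
  by apply: measurable_funM => //; apply: measurable_cabs; exact: measM_det.
have EQ M : E M `<=` Q by move=> x [].
have [M EM0] : exists M, (0 < mu (E M))%E.
  apply: contrapT => /forallNP E0; move: Q0; rewrite (_ : Q = \bigcup_M E M).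
    rewrite null_bigcup ?ltxx// => k; apply/eqP; rewrite eq_le measure_ge0 andbT.
    by rewrite leNgt; apply/negP; exact: E0.
  apply/seteqP; split => [x Qx|x [M _ []//]].
  have c0 : 0 < cabs (\det (V x)).
    rewrite lt_neqAle cabs_ge0 andbT eq_sym; apply/eqP => /cabs_eq0/eqP.
    by apply/negP; rewrite -unitfE -unitmxE.
  exists (Num.truncn (norm1 (\adj (V x)) * d%:R / cabs (\det (V x)))).+1 => //.
  split => //=; rewrite -ler_pdivrMr// ltW// truncnS_gt//.
have MS0 : 0 < M.+1%:R :> R by [].
have bd x v : E M x -> enormC v <= M.+1%:R * enormC (V x *m v).
  move=> [_ /= Ex]; apply: (le_trans (enormC_le_unit v (uV x))).
  rewrite mulrA ler_wpM2r ?enormC_ge0//; apply: (@le_trans _ _ M%:R); last by rewrite ler_nat.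
  have c0 : 0 < cabs (\det (V x)).
    rewrite lt_neqAle cabs_ge0 andbT eq_sym; apply/eqP => /cabs_eq0/eqP.
    by apply/negP; rewrite -unitfE -unitmxE.
  by rewrite -(ler_pM2l c0) mulrA norm1_invmx// [leRHS]mulrC.
have Efin : mu (E M) = (fine (mu (E M)))%:E.
  rewrite fineK// ge0_fin_numE//; apply: le_lt_trans Qoo.
  by apply: le_measure; rewrite ?inE.
have fE0 : 0 < fine (mu (E M)) by rewrite -lte_fin -Efin.
exists (M.+1%:R `^ (- p) * fine (mu (E M))) => [|v].
  by rewrite mulr_gt0 ?powR_gt0.
have mv : measurable_fun [set: X] (vpw (fun=> v)).
  by apply: measurable_vpw; exact: measM_cst.
apply: (@le_trans _ _ (\int[mu]_(x in E M) vpw (fun=> v) x)%E); last first.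
  apply: ge0_subset_integral => //; first exact: measurable_funTS.
  by move=> x _; exact: vpw_ge0.
rewrite mulrAC EFinM -Efin -integral_cst//; apply: ge0_le_integral => //.
- by move=> x _; rewrite lee_fin mulr_ge0 ?powR_ge0.
- exact: measurable_funTS.
- move=> x Ex; rewrite /vpw /cst lee_fin /pw powRN mulrC ler_pdivrMr ?powR_gt0//.
  rewrite mulrC -powRM ?enormC_ge0//; apply: ge0_ler_powR.
  + exact: ltW.
  + by rewrite nnegrE enormC_ge0.
  + by rewrite nnegrE mulr_ge0 ?enormC_ge0.
  + exact: bd.
Qed.

Section cells.
Variable j : int.
Let delta : R := 2 ^ (- j).
Let delta0 : 0 < delta. Proof. exact: dyadic_step_gt0. Qed.
Definition cell (k : 'rV[int]_n) : set X := dyadic_cube j k.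
Definition cell_vol : R := (2 ^ (- j)) ^+ n.
(** All differences of two points in neighbouring cells lie in this box. *)
Definition shifts : set X := box (const_mx (- (2 * delta))) (const_mx (2 * delta)).
Definition shifts_vol : R := (4 * delta) ^+ n.

Lemma cell_vol_gt0 : 0 < cell_vol. Proof. exact: exprn_gt0. Qed.
Lemma shifts_vol_gt0 : 0 < shifts_vol.
Proof. by rewrite exprn_gt0// mulr_gt0. Qed.
Lemma measurable_cell k : measurable (cell k).
Proof. exact: measurable_dyadic_cube. Qed.
Lemma cellE k : mu (cell k) = cell_vol%:E.
Proof. exact: borel_lebesgue_dyadic. Qed.
Lemma measurable_shifts : measurable shifts.
Proof. exact: measurable_box. Qed.
Lemma shiftsE : mu shifts = shifts_vol%:E.
Proof.
rewrite /shifts borel_lebesgue_box => [|i]; last first.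
  by rewrite !mxE ge0_cp// mulr_ge0// ltW.
congr (_%:E); rewrite (eq_bigr (fun=> 4 * delta)) ?prodr_const ?card_ord//.
by move=> i _; rewrite !mxE opprK -mulrDl -natrD.
Qed.

Definition neighbours (k l : 'rV[int]_n) : Prop := forall i, `|l 0 i - k 0 i| <= 1.

Lemma neighbours_shifts k l x z : neighbours k l -> cell k x -> cell l z ->
  shifts (z - x).
Proof.
move=> kl kx lz i; rewrite !mxE.
have /andP[x1 x2] := kx i; have /andP[z1 z2] := lz i.
have := kl i; rewrite ler_norml => /andP[].
rewrite -!(ler_int R) !rmorphB/= rmorphN/= => a b.
rewrite -/delta in x1 x2 z1 z2.
have a' : - delta <= delta * (l 0 i)%:~R - delta * (k 0 i)%:~R.
  by rewrite -mulrBr -[X in X <= _]mulrN1 ler_pM2l.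
have b' : delta * (l 0 i)%:~R - delta * (k 0 i)%:~R <= delta.
  by rewrite -mulrBr -[X in _ <= X]mulr1 ler_pM2l.
rewrite !mulrDr !mulr1 in x2 z2.
by apply/andP; split; lra.
Qed.

(** The order of the sum [y + x] is the one produced by translating an integral by [x]. *)
Definition diffpw f (x y : X) : \bar R := (pw p (V x *m (f x - f (y + x))))%:E.

(** The mean oscillation of [f] at [x], measured by the weight at [x] only. This is the
    quantity that equicontinuity controls. *)
Definition osc f (x : X) : \bar R := average mu shifts shifts_vol (diffpw f x).

Lemma measurable_diffpw f : measM f ->
  measurable_fun [set: X * X] (fun z => diffpw f z.1 z.2).
Proof.
move=> mf; apply: measurable_pw; apply: measM_mul.
  by apply: (measM_comp mV); exact: measurable_fst.
apply: measM_sub; first by apply: (measM_comp mf); exact: measurable_fst.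
apply: (measM_comp mf (phi := fun z : X * X => z.2 + z.1)).
apply: measurable_fun_rVP => i; under eq_fun do rewrite mxE.
apply: measurable_funD.
  exact: (measurableT_comp (measurable_coord_rV i) measurable_snd).
exact: (measurableT_comp (measurable_coord_rV i) measurable_fst).
Qed.

Lemma diffpw_ge0 f x y : (0 <= diffpw f x y)%E.
Proof. by rewrite lee_fin pw_ge0. Qed.

Lemma osc_ge0 f x : (0 <= osc f x)%E.
Proof. by apply: average_ge0 => [|y _]; [exact: shifts_vol_gt0|exact: diffpw_ge0]. Qed.

Lemma measurable_osc f : measM f -> measurable_fun [set: X] (osc f).
Proof.
move=> mf; apply: measurable_funeM.
pose D (z : X * X) := (diffpw f z.1 z.2 * (\1_shifts z.2)%:E)%E.
have mD : measurable_fun [set: X * X] D.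
  apply: emeasurable_funM; first exact: measurable_diffpw.
  apply/measurable_EFinP; apply: (measurableT_comp (measurable_indic measurable_shifts)).
  exact: measurable_snd.
have D0 z : (0 <= D z)%E by rewrite mule_ge0 ?diffpw_ge0// lee_fin.
have := measurable_fun_fubini_tonelli_F (m2 := mu) _ mD D0.
congr measurable_fun; apply/funext => x; rewrite /fubini_F [RHS]integral_mkcond.
by apply: eq_integral => y _; rewrite epatch_indic.
Qed.

(** Substitute [z = y + x] and enlarge the domain of [y] to the box of shifts, whose
    volume is [4 ^ n] times that of a cell. *)
Lemma average_cell_le f k l x : measM f -> neighbours k l -> cell k x ->
  (average mu (cell l) cell_vol (fun z => (pw p (V x *m (f x - f z)))%:E) <=
   (4 ^+ n)%:E * osc f x)%E.
Proof.
move=> mf kl kx; pose G z := (pw p (V x *m (f x - f z)))%:E.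
have mG : measurable_fun [set: X] G.
  apply: measurable_pw; apply: measM_mul; first exact: measM_cst.
  by apply: measM_sub => //; exact: measM_cst.
have G0 z : (0 <= G z)%E by rewrite lee_fin pw_ge0.
have mGx : measurable_fun [set: X] (fun y => G (y + x)).
  by apply: (measurableT_comp mG); exact: measurable_shift.
rewrite /average -/G (integral_shift x (measurable_cell l) mG G0) muleA.
rewrite -EFinM (_ : 4 ^+ n * shifts_vol^-1 = cell_vol^-1); last first.
  rewrite /shifts_vol exprMn invfM mulrA divff ?mul1r//.
apply: lee_wpmul2l; first by rewrite lee_fin invr_ge0 ltW// cell_vol_gt0.
have mcx : measurable ((fun y : X => y + x) @^-1` cell l).
  by rewrite -[X in measurable X]setTI; apply: measurable_shift => //; exact: measurable_cell.
apply: (@ge0_subset_integral _ _ _ mu _ shifts mcx measurable_shifts (fun y => G (y + x)%R)).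
- exact: measurable_funTS.
- by move=> y _.
- by move=> y /= ly; have := neighbours_shifts kl kx ly; rewrite addrK.
Qed.

Lemma neighbours_refl k : neighbours k k.
Proof. by move=> i; rewrite subrr normr0. Qed.

(** At a point [x] of the cell where the oscillation is finite, [V x *m (f x - f z)] is
    [p]-integrable in [z]; as [V x] is invertible, so is [f]. Without this the means
    over the cells would not make sense, since the weight may be very small. *)
Lemma osc_integrable f l : measM f -> (\int[mu]_(x in cell l) osc f x < +oo)%E ->
  forall i, integC mu (cell l) (fun z => f z i 0).
Proof.
move=> mf oscoo i.
have [x lx xoo] : exists2 x, cell l x & (osc f x < +oo)%E.
  apply: contrapT => Nx; move: oscoo; rewrite (eq_integral (cst +oo%E)).
    rewrite integral_cst; last exact: measurable_cell.
    rewrite (_ : _ (cell l) = cell_vol%:E); last exact: cellE.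
    by rewrite gt0_mulye ?ltxx// lte_fin cell_vol_gt0.
  move=> x /set_mem lx; apply/eqP; rewrite -leye_eq leNgt; apply/negP => xoo.
  by apply: Nx; exists x.
pose G z := (pw p (V x *m (f x - f z)))%:E.
have G0 z : (0 <= G z)%E by rewrite lee_fin pw_ge0.
have mG : measurable_fun [set: X] G.
  apply: measurable_pw; apply: measM_mul; first exact: measM_cst.
  by apply: measM_sub => //; exact: measM_cst.
have Goo : (\int[mu]_(z in cell l) G z < +oo)%E.
  have -> : (\int[mu]_(z in cell l) G z = cell_vol%:E * average mu (cell l) cell_vol G)%E.
    by rewrite /average muleA -EFinM divff ?mul1e// gt_eqF// cell_vol_gt0.
  apply: lte_mul_pinfty; rewrite ?lee_fin ?(ltW cell_vol_gt0)//.
  apply: le_lt_trans (average_cell_le mf (@neighbours_refl l) lx) _.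
  by apply: lte_mul_pinfty; rewrite ?lee_fin.
pose c1 := cabs (f x i 0); pose c2 := norm1 (invmx (V x)) * d%:R.
have c20 : 0 <= c2 by rewrite mulr_ge0 ?norm1_ge0.
have c10 : 0 <= c1 by exact: cabs_ge0.
have mcG : measurable_fun (cell l) (fun z => c2%:E * G z)%E.
  by apply: measurable_funeM; exact: measurable_funTS.
apply: (@integC_le _ _ _ _ _ _ _ (fun z => (c1 + c2)%:E + c2%:E * G z)%E) => //.
- exact: measurable_cell.
- exact: emeasurable_funD.
- move=> z _; rewrite -EFinM -EFinD lee_fin.
  have -> : f z i 0 = f x i 0 + - ((f x - f z) i 0) by rewrite !mxE opprB addrC subrK.
  apply: (le_trans (cabsD _ _)); rewrite -addrA lerD2l.
  have -> : cabs (- (f x - f z) i 0) = cabs ((f x - f z) i 0) by rewrite /cabs normrN.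
  apply: (le_trans (cabs_le_enormC _ _)).
  apply: (le_trans (enormC_le_unit _ (uV x))).
  rewrite mulrA -/c2 -{2}[c2]mulr1 -mulrDr ler_wpM2l//.
  apply: (le_trans (le_young (enormC_ge0 _) p1 ltr01)).
  by rewrite powR1 mul1r.
- rewrite ge0_integralD//.
  + rewrite integral_cst; last exact: measurable_cell.
    rewrite (_ : _ (cell l) = cell_vol%:E); last exact: cellE.
    rewrite -EFinM lte_add_pinfty ?ltry//.
    rewrite ge0_integralZl//; first by apply: lte_mul_pinfty; rewrite ?lee_fin.
    * exact: measurable_cell.
    * exact: measurable_funTS.
  + exact: measurable_cell.
  + by move=> z _; rewrite lee_fin addr_ge0.
  + by move=> z _; rewrite mule_ge0.
Qed.

Definition cell_mean f l : 'cV[R[i]]_d := vaverage mu (cell l) cell_vol f.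

Definition oscK : R := (2 * d%:R) `^ p * 2 `^ p * 4 ^+ n.

Lemma oscK_ge0 : 0 <= oscK.
Proof. by rewrite !mulr_ge0 ?powR_ge0 ?exprn_ge0. Qed.

(** Replacing [f] by its mean over a neighbouring cell costs no more than the
    oscillation, with a constant that does not depend on the size of the cells. *)
Lemma vpw_sub_mean f k l x : measM f -> (\int[mu]_(x in cell l) osc f x < +oo)%E ->
  neighbours k l -> cell k x ->
  ((pw p (V x *m (f x - cell_mean f l)))%:E <= oscK%:E * osc f x)%E.
Proof.
move=> mf oscoo kl kx; have fi := osc_integrable mf oscoo.
have mcl := measurable_cell l.
pose h z := enormC (V x *m (f x - f z)).
have h0 z : 0 <= h z by exact: enormC_ge0.
have mM : measM (fun z => V x *m (f x - f z)).
  apply: measM_mul; first exact: measM_cst.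
  by apply: measM_sub => //; exact: measM_cst.
have mh : measurable_fun (cell l) (fun z => (h z)%:E).
  by apply/measurable_EFinP; apply: measurable_funTS; exact: measurable_enormC.
have av0 : (0 <= average mu (cell l) cell_vol (fun z => (h z)%:E))%E.
  by apply: average_ge0 => [|z _]; [exact: cell_vol_gt0|rewrite lee_fin].
have E1 := enormC_sub_vaverage mcl cell_vol_gt0 (cellE l) (V x) (f x) fi.
have E2 := average_poweR mcl cell_vol_gt0 (cellE l) mh p1
  (fun z _ => h0 z : (0 <= (h z)%:E)%E).
have E3 := average_cell_le mf kl kx.
apply: (@le_trans _ _ (((2 * d%:R)%:E * average mu (cell l) cell_vol (fun z => (h z)%:E)) `^ p)%E).
  rewrite /pw -poweR_EFin; apply: le_poweR; rewrite ?(ltW p0) ?lee_fin ?enormC_ge0//.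
rewrite poweRM ?lee_fin ?mulr_ge0// poweR_EFin /oscK -!mulrA EFinM -!muleA.
apply: lee_wpmul2l; first by rewrite lee_fin powR_ge0.
apply: (le_trans (le_poweR (ltW p0) av0 E2)).
have av1 : (0 <= average mu (cell l) cell_vol (fun z => (h z)%:E `^ p))%E.
  by apply: average_ge0 => [|z _]; [exact: cell_vol_gt0|exact: poweR_ge0].
rewrite poweRM ?poweR_ge0 ?lee_fin// poweR_EFin EFinM -muleA.
apply: lee_wpmul2l; first by rewrite lee_fin powR_ge0.
by rewrite poweRVK ?gt_eqF.
Qed.

End cells.
End core.

(** * Equicontinuous families *)

Section family.
Context {R : realType} (n d : nat) (i0 : 'I_n) (p : R) (r : \bar R).
Variables (w : int * 'rV[int]_n -> \bar R) (V : 'rV[R]_n -> 'M[R[i]]_d).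
Hypotheses (p1 : 1 <= p) (pr : (p%:E <= r)%E) (w0 : forall jk, (0 < w jk)%E).
Hypotheses (mV : measM V) (uV : forall x, V x \in unitmx).
Local Notation X := 'rV[R]_n.
Local Notation mu := (borel_lebesgue n).
Local Notation fn := (fnorm p r w).
Local Notation vpw := (vpw p V).
Local Notation diffpw := (diffpw p V).

Variables (j : int) (F : set (X -> 'cV[R[i]]_d)) (B : set X) (K : nat) (e : R).
Local Notation osc := (osc p V j).
Local Notation mean k f := (cell_mean j f k).
Hypotheses (e0 : 0 <= e) (mB : measurable B).
Hypothesis BK : forall x, B x -> forall i, `|x 0 i| < 2 ^ (- j) * K%:R.
Hypothesis Fm : forall f, F f -> measM f.
Hypothesis Ffin : forall f, F f -> (fn (vpw f) < +oo)%E.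
Hypothesis Fequi : forall f y, F f -> shifts j y ->
  (fn (fun x => diffpw f x y) <= e%:E)%E.
Hypothesis Fvan : forall f, F f ->
  (fn (fun x => vpw f x * (\1_(~` B) x)%:E) <= e%:E)%E.

Let p0 : 0 < p. Proof. exact: lt_le_trans p1. Qed.
Let delta0 : 0 < 2 ^ (- j) :> R. Proof. exact: dyadic_step_gt0. Qed.

Lemma fnorm_osc f : F f -> (fn (osc f) <= (2 * e)%:E)%E.
Proof.
move=> Ff; rewrite EFinM; apply: fnorm_average => //.
- exact: measurable_shifts.
- exact: shifts_vol_gt0.
- exact: shiftsE.
- by apply: measurable_diffpw => //; exact: Fm.
- by move=> x y; exact: diffpw_ge0.
- by move=> y; exact: Fequi.
Qed.

Lemma osc_cell_bounded k : exists2 C : R, 0 <= C &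
  forall f, F f -> (\int[mu]_(x in cell j k) osc f x <= C%:E)%E.
Proof.
have e20 : 0 <= 2 * e by rewrite mulr_ge0.
have [C C0 HC] := cube_integral_bounded p1 pr w0 (j, k) e20.
exists C => // f Ff; apply: (HC (osc f)); last exact: fnorm_osc.
by move=> x; exact: osc_ge0.
Qed.

Lemma osc_cell_lty f k : F f -> (\int[mu]_(x in cell j k) osc f x < +oo)%E.
Proof.
move=> Ff; have [C _ HC] := osc_cell_bounded k.
by apply: le_lt_trans (HC f Ff) _; exact: ltry.
Qed.

(** A bound on the weighted length of constant vectors over one cell is a bound on
    their Euclidean length, by [pw_lower]. *)
Lemma cell_const_bounded k (v : (X -> 'cV[R[i]]_d) -> 'cV[R[i]]_d) (C : R) :
  (forall f, F f -> (\int[mu]_(x in cell j k) vpw (fun=> v f) x <= C%:E)%E) ->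
  exists C' : R, forall f, F f -> enormC (v f) <= C'.
Proof.
move=> HC.
have [||a a0 Ha] := pw_lower p1 mV uV (measurable_cell (R := R) j k).
- by rewrite [X in (0 < X)%E](_ : _ = (cell_vol (R := R) n j)%:E) ?lte_fin ?cell_vol_gt0//; exact: cellE.
- by rewrite [X in (X < _)%E](_ : _ = (cell_vol (R := R) n j)%:E) ?ltry//; exact: cellE.
exists ((C / a) `^ p^-1) => f Ff.
have pwC : pw p (v f) <= C / a.
  by rewrite ler_pdivlMr// mulrC -lee_fin (le_trans (Ha _))// HC.
rewrite -[leLHS](@powRr1 R) ?enormC_ge0// -(@mulfV R p) ?gt_eqF// powRrM.
by apply: ge0_ler_powR; rewrite ?invr_ge0 ?(ltW p0) ?nnegrE ?powR_ge0//
  (le_trans (pw_ge0 p (v f))).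
Qed.

Lemma measurable_vpw_cst v : measurable_fun [set: X] (vpw (fun=> v)).
Proof. by apply: measurable_vpw => //; exact: measM_cst. Qed.

(** On the cell [k] the function is close both to its mean over [k] and to its mean
    over [l], so these means are close in the weighted sense on [k], which is a norm. *)
Lemma mean_chain k l : neighbours k l ->
  (exists C : R, forall f, F f -> enormC (mean l f) <= C) ->
  exists C : R, forall f, F f -> enormC (mean k f) <= C.
Proof.
move=> kl [Cl HCl]; have [Co Co0 HCo] := osc_cell_bounded k.
pose c := pwK d p * (oscK n d p + oscK n d p).
have c0 : 0 <= c by rewrite mulr_ge0 ?pwK_ge0// addr_ge0 ?oscK_ge0.
have [|C HC] := @cell_const_bounded k (fun f => mean l f - mean k f) (c * Co).
  move=> f Ff; have mf := Fm Ff.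
  apply: (@le_trans _ _ (\int[mu]_(x in cell j k) (c%:E * osc f x))%E).
    apply: ge0_le_integral => //.
    - exact: measurable_cell.
    - by move=> x _; exact: vpw_ge0.
    - by apply: measurable_funTS; exact: measurable_vpw_cst.
    - by apply: measurable_funeM; apply: measurable_funTS; exact: measurable_osc.
    move=> x kx.
    have Ek := vpw_sub_mean p1 uV mf (osc_cell_lty k Ff) (@neighbours_refl n k) kx.
    have El := vpw_sub_mean p1 uV mf (osc_cell_lty l Ff) kl kx.
    have := pwB p1 (V x *m (f x - mean k f)) (V x *m (f x - mean l f)).
    rewrite -mulmxBr (_ : f x - mean k f - (f x - mean l f) = mean l f - mean k f);
      last by rewrite opprB addrC addrA subrK.
    rewrite -lee_fin => H.
    move: (osc f x) Ek El => o Ek El.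
    apply: (le_trans H); rewrite /c !(EFinM (pwK d p)) -muleA.
    apply: lee_wpmul2l; first by rewrite lee_fin pwK_ge0.
    rewrite (EFinD (oscK n d p)) ge0_muleDl ?lee_fin ?oscK_ge0//.
    exact: leeD Ek El.
  rewrite ge0_integralZl//.
  - by rewrite (EFinM c) lee_wpmul2l// HCo.
  - exact: measurable_cell.
  - by apply: measurable_funTS; exact: measurable_osc.
  - by move=> x _; exact: osc_ge0.
exists (d%:R * (C + Cl)) => f Ff.
rewrite (_ : mean k f = - (mean l f - mean k f) + mean l f); last first.
  by rewrite opprB subrK.
apply: (le_trans (enormCD_le _ _)); rewrite ler_wpM2l// lerD ?HCl//.
by rewrite -scaleN1r enormCZ /cabs normrN normr1 mul1r HC.
Qed.

Lemma vpw_mean_le f k x : F f -> cell j k x ->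
  (vpw (fun=> mean k f) x <= (pwK d p)%:E * (vpw f x + (oscK n d p)%:E * osc f x))%E.
Proof.
move=> Ff kx.
have Ek := vpw_sub_mean p1 uV (Fm Ff) (osc_cell_lty k Ff) (@neighbours_refl n k) kx.
have := pwB p1 (V x *m f x) (V x *m (f x - mean k f)).
rewrite -mulmxBr opprB addrC subrK -lee_fin => H.
move: ((oscK n d p)%:E * osc f x)%E Ek => o Ek.
apply: (le_trans H); rewrite (EFinM (pwK d p)); apply: lee_wpmul2l.
  by rewrite lee_fin pwK_ge0.
by rewrite (EFinD (pw p _)); apply: leeD; [exact: lexx|exact: Ek].
Qed.

(** Such cells do not meet [B], so there [f] itself is small. *)
Lemma mean_far (k : 'rV[int]_n) : K%:Z <= k 0 i0 ->
  exists C : R, forall f, F f -> enormC (mean k f) <= C.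
Proof.
move=> Kk; have [Co Co0 HCo] := osc_cell_bounded k.
have [Cv Cv0 HCv] := cube_integral_bounded p1 pr w0 (j, k) e0.
have NB x : cell j k x -> (\1_(~` B) x = 1 :> R).
  move=> kx; rewrite indicE mem_set// => Bx.
  have := BK Bx i0; rewrite ltNge => /negP; apply.
  apply: le_trans (ler_norm _); have /andP[+ _] := kx i0.
  apply: le_trans; rewrite ler_pM2l//.
  by rewrite -[K%:R]/(K%:Z%:~R) ler_int.
apply: (@cell_const_bounded k (fun f => mean k f) (pwK d p * (Cv + oscK n d p * Co))).
move=> f Ff; have mf := Fm Ff.
have mu1 : measurable_fun [set: X] (fun x => vpw f x * (\1_(~` B) x)%:E)%E.
  apply: emeasurable_funM; first exact: measurable_vpw.
  by apply/measurable_EFinP; apply: measurable_indic; exact: measurableC.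
have u10 x : (0 <= vpw f x * (\1_(~` B) x)%:E)%E by rewrite mule_ge0 ?vpw_ge0// lee_fin.
have mo : measurable_fun [set: X] (osc f) by exact: measurable_osc.
have o0 x : (0 <= (oscK n d p)%:E * osc f x)%E.
  by rewrite mule_ge0 ?osc_ge0// lee_fin oscK_ge0.
apply: (@le_trans _ _ (\int[mu]_(x in cell j k) ((pwK d p)%:E *
    (vpw f x * (\1_(~` B) x)%:E + (oscK n d p)%:E * osc f x)))%E).
  apply: ge0_le_integral => //.
  - exact: measurable_cell.
  - by move=> x _; exact: vpw_ge0.
  - by apply: measurable_funTS; exact: measurable_vpw_cst.
  - apply: measurable_funTS; apply: measurable_funeM; apply: emeasurable_funD => //.
    exact: measurable_funeM.
  by move=> x kx; rewrite NB// mule1; exact: vpw_mean_le.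
rewrite ge0_integralZl//; last 4 first.
- exact: measurable_cell.
- apply: measurable_funTS; apply: emeasurable_funD => //.
  exact: measurable_funeM.
- by move=> x _; exact: adde_ge0.
- by rewrite lee_fin pwK_ge0.
rewrite (EFinM (pwK d p)); apply: lee_wpmul2l; first by rewrite lee_fin pwK_ge0.
rewrite ge0_integralD//; last 3 first.
- exact: measurable_cell.
- exact: measurable_funTS.
- by apply: measurable_funTS; exact: measurable_funeM.
rewrite (EFinD Cv); apply: leeD; first exact: (HCv _ u10 (Fvan Ff)).
rewrite ge0_integralZl//.
- rewrite (EFinM (oscK n d p)); apply: lee_wpmul2l; last exact: HCo.
  by rewrite lee_fin oscK_ge0.
- exact: measurable_cell.
- exact: measurable_funTS.
- by move=> x _; exact: osc_ge0.
- by rewrite lee_fin oscK_ge0.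
Qed.

(** Far away the means are controlled by the smallness at infinity, and each
    step towards the origin changes them by a bounded amount. *)
Lemma mean_bounded (k : 'rV[int]_n) : exists C : R, forall f, F f -> enormC (mean k f) <= C.
Proof.
suff H (s : nat) : forall k : 'rV[int]_n, K%:Z <= k 0 i0 + s%:Z ->
    exists C : R, forall f, F f -> enormC (mean k f) <= C.
  have Hk : K%:Z <= k 0 i0 + (`|(K%:Z - k 0 i0)%R|%N)%:Z by rewrite -lerBlDl abszE ler_norm.
  exact: (H _ k Hk).
elim: s => [|s IH] {}k Hk; first by apply: mean_far; rewrite addr0 in Hk.
pose l := k + delta_mx 0 i0.
apply: (@mean_chain k l) => [i|]; last first.
  by apply: IH; rewrite !mxE !eqxx/= -addrA -intS.
rewrite !mxE/= addrAC subrr add0r.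
by case: (i == i0).
Qed.

(** This may be infinite: constant functions on a cell need not have finite norm. *)
Definition cellnorm k (v : 'cV[R[i]]_d) : \bar R :=
  fn (fun x => vpw (fun=> v) x * (\1_(cell j k) x)%:E)%E.

Let mcut k v : measurable_fun [set: X] (fun x => vpw (fun=> v) x * (\1_(cell j k) x)%:E)%E.
Proof.
apply: emeasurable_funM; first exact: measurable_vpw_cst.
by apply/measurable_EFinP; apply: measurable_indic; exact: measurable_cell.
Qed.

Let cut_ge0 k v x : (0 <= vpw (fun=> v) x * (\1_(cell j k) x)%:E)%E.
Proof. by apply: mule_ge0; [exact: vpw_ge0|rewrite lee_fin]. Qed.

Let cellK : R := 1 + pwK d p `^ p^-1 * 8.

Let pwK8_ge0 : 0 <= pwK d p `^ p^-1 * 8.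
Proof. by rewrite mulr_ge0 ?powR_ge0. Qed.

Lemma vpw_cstD u v x :
  (vpw (fun=> (u + v)%R) x <= (pwK d p)%:E * (vpw (fun=> u) x + vpw (fun=> v) x))%E.
Proof. by rewrite !vpwE -EFinD -EFinM lee_fin mulmxDr; exact: pwD. Qed.

Lemma cellnormZ k a v : (cellnorm k (a *: v) <= (cabs a)%:E * cellnorm k v)%E.
Proof.
have ca0 : 0 <= cabs a `^ p by exact: powR_ge0.
have E : (cabs a `^ p) `^ p^-1 = cabs a.
  by rewrite -powRrM mulfV ?gt_eqF// powRr1 ?cabs_ge0.
have FE : (fun x => (cabs a `^ p)%:E * (vpw (fun=> v) x * (\1_(cell j k) x)%:E))%E =
    (fun x => vpw (fun=> (a *: v)%R) x * (\1_(cell j k) x)%:E)%E.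
  apply/funext => x; rewrite muleA; congr (_ * _)%E.
  by rewrite !vpwE -EFinM -pwZ -scalemxAr.
have := fnormZ p1 pr w0 (mcut k v) (cut_ge0 k v) ca0.
by rewrite FE E.
Qed.

Lemma cellnormD k u v :
  (cellnorm k (u + v) <= cellK%:E * (cellnorm k u + cellnorm k v))%E.
Proof.
have N0 z : (0 <= cellnorm k z)%E by exact: (fnorm_ge0 w p1 pr).
have Duv x : (vpw (fun=> (u + v)%R) x * (\1_(cell j k) x)%:E <= (pwK d p)%:E *
   (vpw (fun=> u) x * (\1_(cell j k) x)%:E + vpw (fun=> v) x * (\1_(cell j k) x)%:E))%E.
  rewrite -ge0_muleDl ?vpw_ge0// muleA; apply: lee_wpmul2r; first by rewrite lee_fin.
  exact: vpw_cstD.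
have H := fnorm_le2 p1 pr w0 (mcut k _) (mcut k u) (mcut k v) (cut_ge0 k _)
  (cut_ge0 k u) (cut_ge0 k v) (pwK_ge0 d p) Duv.
apply: (le_trans H); apply: lee_wpmul2r; first exact: adde_ge0 (N0 u) (N0 v).
by rewrite lee_fin lerDr.
Qed.

Let mvpw f : F f -> measurable_fun [set: X] (vpw f).
Proof. by move=> Ff; apply: measurable_vpw => //; exact: Fm. Qed.

Let mosc f : F f -> measurable_fun [set: X] (osc f).
Proof. by move=> Ff; apply: measurable_osc => //; exact: Fm. Qed.

Let oscKZ_ge0 f x : (0 <= (oscK n d p)%:E * osc f x)%E.
Proof. by apply: mule_ge0; [rewrite lee_fin oscK_ge0|exact: osc_ge0]. Qed.

(** On the cell, the mean of [f] is dominated by [f] and its oscillation, both of finite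
    norm. Hence the means of the family stay in the subspace on which [cellnorm] is
    finite. *)
Lemma cellnorm_mean_lty f k : F f -> (cellnorm k (mean k f) < +oo)%E.
Proof.
move=> Ff.
have mo' : measurable_fun [set: X] (fun x => (oscK n d p)%:E * osc f x)%E.
  by apply: measurable_funeM; exact: mosc.
have Dle x : (vpw (fun=> mean k f) x * (\1_(cell j k) x)%:E <= (pwK d p)%:E *
    (vpw f x + (oscK n d p)%:E * osc f x))%E.
  rewrite indicE; have [kx|kx] := boolP (x \in cell j k).
    by rewrite mule1; apply: vpw_mean_le => //; exact/set_mem.
  rewrite mule0; apply: mule_ge0; first by rewrite lee_fin pwK_ge0.
  by apply: adde_ge0; [exact: vpw_ge0|exact: oscKZ_ge0].
have H := fnorm_le2 p1 pr w0 (mcut k _) (mvpw Ff) mo' (cut_ge0 k _)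
  (fun x => vpw_ge0 p V f x) (oscKZ_ge0 f) (pwK_ge0 d p) Dle.
apply: (le_lt_trans H); apply: lte_mul_pinfty => //.
apply: lte_add_pinfty; first exact: Ffin.
have H2 := fnormZ p1 pr w0 (mosc Ff) (osc_ge0 p V j f) (oscK_ge0 n d p).
apply: (le_lt_trans H2); apply: lte_mul_pinfty => //.
  by rewrite lee_fin powR_ge0.
by apply: (le_lt_trans (fnorm_osc Ff)); exact: ltry.
Qed.

Lemma cellnorm_sub_bounded k : exists2 C : R, 0 <= C &
  forall f g, F f -> F g ->
    (cellnorm k (mean k f - mean k g) <= (C * enormC (mean k f - mean k g))%:E)%E.
Proof.
have K1 : 1 <= cellK by rewrite lerDl.
have N0 z : (0 <= cellnorm k z)%E by exact: (fnorm_ge0 w p1 pr).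
have [C C0 HC] := quasi_norm_bounded K1 N0 (cellnormZ k) (cellnormD k).
exists C => // f g Ff Fg; apply: HC.
rewrite -scaleN1r; apply: (le_lt_trans (cellnormD _ _ _)).
apply: lte_mul_pinfty; rewrite ?lee_fin ?(le_trans ler01)//.
apply: lte_add_pinfty; first exact: cellnorm_mean_lty.
apply: (le_lt_trans (cellnormZ _ _ _)); apply: lte_mul_pinfty => //.
  by rewrite lee_fin cabs_ge0.
exact: cellnorm_mean_lty.
Qed.

Definition netK : R := pwK d p + pwK d p * (pwK d p * oscK n d p).

Lemma netK_ge0 : 0 <= netK.
Proof. by rewrite addr_ge0 ?mulr_ge0 ?pwK_ge0 ?oscK_ge0. Qed.

Lemma netK_bound (a o1 o2 t : \bar R) :
  (0 <= a)%E -> (0 <= o1)%E -> (0 <= o2)%E -> (0 <= t)%E ->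
  ((pwK d p)%:E * ((pwK d p)%:E * ((oscK n d p)%:E * o1 + (oscK n d p)%:E * o2) + t)
   <= netK%:E * ((a + (o1 + o2)) + t))%E.
Proof.
move=> a0 o10 o20 t0; rewrite /netK.
move: (pwK d p) (oscK n d p) (pwK_ge0 d p) (oscK_ge0 n d p) => k o k0 o0.
have o120 : (0 <= o1 + o2)%E by exact: adde_ge0.
have ko0 : (0 <= k%:E * (o%:E * (o1 + o2)))%E by rewrite !mule_ge0 ?lee_fin.
rewrite -ge0_muleDr// (ge0_muleDr _ ko0 t0).
rewrite !muleA -!EFinM EFinD ge0_muleDl ?lee_fin ?mulr_ge0// addeC !mulrA.
apply: leeD; apply: lee_wpmul2l; rewrite ?lee_fin ?mulr_ge0//.
  by rewrite leeDr// adde_ge0.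
by rewrite -addeA addeCA leeDl// adde_ge0.
Qed.

(** The cells that can meet [B], indexed by a finite type so that the differences of
    the means over them form one finite sum. *)
Definition near_cell (s : {ffun 'I_n -> 'I_(K + K).+1}) : 'rV[int]_n :=
  \row_i ((s i : nat)%:Z - K%:Z).

Lemma near_cell_cover x : B x -> exists s, cell j (near_cell s) x.
Proof.
move=> Bx; pose q i := Num.floor (x 0 i / 2 ^ (- j)).
have qx i : (q i)%:~R <= x 0 i / 2 ^ (- j) < (q i)%:~R + 1.
  by have := floor_itv (x 0 i / 2 ^ (- j)); rewrite intrD.
have xK i : `|x 0 i / 2 ^ (- j)| < K%:R.
  rewrite normrM normfV [`|2 ^ (- j)|]gtr0_norm// ltr_pdivrMr// mulrC.
  exact: BK.
have qK i : - K%:Z <= q i <= K%:Z.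
  have := xK i; rewrite ltr_norml => /andP[a b]; have /andP[c d'] := qx i.
  apply/andP; split.
    rewrite -ltzD1 -(ltr_int R) rmorphD/= rmorphN/=.
    exact: lt_trans a d'.
  rewrite -(ler_int R); apply: ltW; exact: le_lt_trans c b.
exists [ffun i => inord `|(q i + K%:Z)%R|%N] => i.
have q0 : 0 <= q i + K%:Z by rewrite -lerBlDr sub0r; have /andP[] := qK i.
rewrite /near_cell mxE ffunE inordK; last first.
  rewrite ltnS -lez_nat gez0_abs// PoszD lerD2r.
  by have /andP[] := qK i.
by rewrite gez0_abs// addrK mulrC -ler_pdivlMr// [_ * (_ + 1)]mulrC -ltr_pdivrMr.
Qed.

Let S := {ffun 'I_n -> 'I_(K + K).+1}.

Let far f x : \bar R := (vpw f x * (\1_(~` B) x)%:E)%E.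

Let step f g (s : S) x : \bar R :=
  (vpw (fun=> mean (near_cell s) f - mean (near_cell s) g)%R x
   * (\1_(cell j (near_cell s)) x)%:E)%E.

Let far_ge0 f x : (0 <= far f x)%E.
Proof. by apply: mule_ge0; [exact: vpw_ge0|rewrite lee_fin]. Qed.

Let mfar f : F f -> measurable_fun [set: X] (far f).
Proof.
move=> Ff; apply: emeasurable_funM; first exact: mvpw.
by apply/measurable_EFinP; apply: measurable_indic; exact: measurableC.
Qed.

(** Outside [B] the two functions are small. In a cell that meets [B] they are replaced
    by their means, at the cost of their oscillations, and only the difference of the
    means remains. *)
Lemma vpw_sub_le f g x : F f -> F g ->
  (vpw (fun x => f x - g x)%R x <= netK%:E *
    (((far f x + far g x) + (osc f x + osc g x)) + \sum_(s : S) step f g s x))%E.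
Proof.
move=> Ff Fg.
have K0 := pwK_ge0 d p; have O0 := oscK_ge0 n d p.
have KO0 : 0 <= pwK d p * (pwK d p * oscK n d p) by rewrite !mulr_ge0.
have S0 : (0 <= \sum_(s : S) step f g s x)%E by apply: sume_ge0 => s _; exact: cut_ge0.
have [Bx|NBx] := pselect (B x); last first.
  have farE h : far h x = vpw h x by rewrite /far indicE mem_set// mule1.
  apply: (@le_trans _ _ ((pwK d p)%:E * (vpw f x + vpw g x))%E).
    rewrite !vpwE -EFinD -EFinM lee_fin mulmxBr; exact: pwB.
  rewrite !farE; apply: lee_pmul.
  - by rewrite lee_fin.
  - by apply: adde_ge0; exact: vpw_ge0.
  - by rewrite lee_fin lerDl.
  - rewrite -addeA leeDl//; apply: adde_ge0 => //.
    by apply: adde_ge0; exact: osc_ge0.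
have [s sx] := near_cell_cover Bx; set k := near_cell s in sx.
have Ef := vpw_sub_mean p1 uV (Fm Ff) (osc_cell_lty k Ff) (@neighbours_refl n k) sx.
have Eg := vpw_sub_mean p1 uV (Fm Fg) (osc_cell_lty k Fg) (@neighbours_refl n k) sx.
have stepE : step f g s x = vpw (fun=> (mean k f - mean k g)%R) x.
  by rewrite /step indicE mem_set// mule1.
have Sle : (step f g s x <= \sum_(s : S) step f g s x)%E.
  rewrite (bigD1 s)//= leeDl//; apply: sume_ge0 => s' _; exact: cut_ge0.
rewrite stepE in Sle.
have E1 := pwB p1 (V x *m (f x - mean k f)) (V x *m (g x - mean k g)).
have E2 := pwD p1 (V x *m (f x - mean k f) - V x *m (g x - mean k g))
  (V x *m (mean k f - mean k g)).
have VE : V x *m (f x - mean k f) - V x *m (g x - mean k g) +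
    V x *m (mean k f - mean k g) = V x *m (f x - g x).
  rewrite -mulmxBr -mulmxDr; congr (_ *m _).
  by rewrite opprB -addrA [X in _ + X]addrC !addrA !subrK.
rewrite VE in E2.
have far0 : (0 <= far f x + far g x)%E by apply: adde_ge0; exact: far_ge0.
move: (far f x + far g x)%E far0 => a a0.
have of0 := osc_ge0 p V j f x; have og0 := osc_ge0 p V j g x.
move: (osc f x) (osc g x) of0 og0 Ef Eg => o1 o2 o10 o20 Ef Eg.
move: (\sum_(s : S) step f g s x)%E S0 Sle => T T0 Tle.
apply: (@le_trans _ _ ((pwK d p)%:E * ((pwK d p)%:E *
    ((oscK n d p)%:E * o1 + (oscK n d p)%:E * o2) + T))%E).
  rewrite vpwE; apply: (@le_trans _ _ ((pwK d p * (pw p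
    (V x *m (f x - mean k f) - V x *m (g x - mean k g)) +
    pw p (V x *m (mean k f - mean k g))))%:E)); first by rewrite lee_fin; exact: E2.
  rewrite (EFinM (pwK d p)) (EFinD (pw p _)); apply: lee_wpmul2l; first by rewrite lee_fin.
  apply: leeD; last exact: Tle.
  apply: (@le_trans _ _ ((pwK d p * (pw p (V x *m (f x - mean k f)) +
    pw p (V x *m (g x - mean k g))))%:E)); first by rewrite lee_fin; exact: E1.
  rewrite (EFinM (pwK d p)) (EFinD (pw p _)); apply: lee_wpmul2l; first by rewrite lee_fin.
  exact: leeD Ef Eg.
exact: netK_bound.
Qed.

(** [385 = 384 + 1]: the two far parts and the two oscillations contribute [384 * e], see
    [fnorm_rest], and the differences of the means contribute [e]. *)
Definition famK : R := netK `^ p^-1 * 8 * 385.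

Lemma famK_ge0 : 0 <= famK.
Proof.
apply: mulr_ge0; last exact: ler0n.
by apply: mulr_ge0; [exact: powR_ge0|exact: ler0n].
Qed.

Let fnorm_rest f g : F f -> F g ->
  (fn (fun x => (far f x + far g x) + (osc f x + osc g x)) <= (384 * e)%:E)%E.
Proof.
move=> Ff Fg.
have E1 := fnormD p1 pr w0 (mfar Ff) (mfar Fg) (far_ge0 f) (far_ge0 g).
have E2 := fnormD p1 pr w0 (mosc Ff) (mosc Fg) (osc_ge0 p V j f) (osc_ge0 p V j g).
have m1 : measurable_fun [set: X] (fun x => far f x + far g x)%E.
  by apply: emeasurable_funD; exact: mfar.
have m2 : measurable_fun [set: X] (fun x => osc f x + osc g x)%E.
  by apply: emeasurable_funD; exact: mosc.
have g1 x : (0 <= far f x + far g x)%E by apply: adde_ge0; exact: far_ge0.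
have g2 x : (0 <= osc f x + osc g x)%E by apply: adde_ge0; exact: osc_ge0.
have E3 := fnormD p1 pr w0 m1 m2 g1 g2.
apply: (le_trans E3).
have H1 : (fn (fun x => far f x + far g x) <= (16 * e)%:E)%E.
  apply: (le_trans E1); rewrite (_ : 16 * e = 8 * (e + e)); last lra.
  rewrite (EFinM 8); apply: lee_wpmul2l => //.
  by rewrite EFinD; apply: leeD; exact: Fvan.
have H2 : (fn (fun x => osc f x + osc g x) <= (32 * e)%:E)%E.
  apply: (le_trans E2); rewrite (_ : 32 * e = 8 * (2 * e + 2 * e)); last lra.
  rewrite (EFinM 8); apply: lee_wpmul2l => //.
  by rewrite (EFinD (2 * e)); apply: leeD; exact: fnorm_osc.
rewrite (_ : 384 * e = 8 * (16 * e + 32 * e)); last lra.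
rewrite (EFinM 8); apply: lee_wpmul2l => //.
by rewrite (EFinD (16 * e)); exact: leeD H1 H2.
Qed.

Let enormC_coord (z : 'cV[R[i]]_d) (eta : R) :
  (forall i, `|complex.Re (z i 0)| <= eta /\ `|complex.Im (z i 0)| <= eta) ->
  enormC z <= d%:R * (2 * eta).
Proof.
move=> H; apply: (le_trans (enormC_le_norm1 z)); rewrite norm1_cV.
apply: (@le_trans _ _ (\sum_(i < d) (2 * eta))).
  apply: ler_sum => i _; apply: (le_trans (cabs_le_ReIm _)).
  by have [a b] := H i; rewrite mulr_natl mulr2n lerD.
by rewrite sumr_const card_ord [leRHS]mulr_natl.
Qed.

(** The grid for the coordinates of the means is chosen after the number of cells and
    the constants of [cellnorm_sub_bounded], so these constants do not appear in the
    final estimate; [famK] depends on [n], [d] and [p] only. *)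
Lemma family_net : 0 < e -> exists N : set (X -> 'cV[R[i]]_d),
  [/\ finite_set N, N `<=` F & forall f, F f -> exists2 g, N g &
    (fn (vpw (fun x => f x - g x)%R) <= (famK * e)%:E)%E].
Proof.
move=> e_gt0.
have [b Hb] := choice (fun s : S => mean_bounded (near_cell s)).
have /choice[C HC] : forall s : S, exists C : R, 0 <= C /\ forall f g, F f -> F g ->
    (cellnorm (near_cell s) (mean (near_cell s) f - mean (near_cell s) g)
     <= (C * enormC (mean (near_cell s) f - mean (near_cell s) g))%:E)%E.
  by move=> s; have [C C0 HC] := cellnorm_sub_bounded (near_cell s); exists C.
pose M : R := 8 ^+ size (index_enum (S : finType)).
have M0 : 0 <= M by rewrite exprn_ge0.
pose D : R := M * (\sum_s (C s * (d%:R * 2))).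
have D0 : 0 <= D.
  by rewrite mulr_ge0//; apply: sumr_ge0 => s _; rewrite mulr_ge0//; have [] := HC s.
pose eta := e / (D + 1).
have D1 : 0 < D + 1 by rewrite ltr_wpDl.
have eta0 : 0 < eta by rewrite divr_gt0.
pose c (f : X -> 'cV[R[i]]_d) (t : S * 'I_d * bool) : R :=
  let z := mean (near_cell t.1.1) f t.1.2 0 in
  if t.2 then complex.Re z else complex.Im z.
have cb f t : F f -> `|c f t| <= \sum_s `|b s|.
  move=> Ff; have h : enormC (mean (near_cell t.1.1) f) <= \sum_s `|b s|.
    apply: (le_trans (Hb t.1.1 f Ff)); apply: (le_trans (ler_norm _)).
    by rewrite (bigD1 t.1.1)//= lerDl sumr_ge0.
  apply: le_trans h; apply: le_trans (cabs_le_enormC _ t.1.2).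
  by rewrite /c; case: t.2; [exact: Re_le_cabs|exact: Im_le_cabs].
have [N [finN NF HN]] := finite_net eta0 (fun f Ff t => cb f t Ff).
exists N; split => // f Ff; have [g Ng cfg] := HN f Ff; exists g => //.
have Fg := NF g Ng.
have steps : (fn (fun x => \sum_(s : S) step f g s x) <= e%:E)%E.
  have E1 := @fnorm_sum R n p r w p1 pr w0 S (index_enum (S : finType)) (step f g)
    (fun s => mcut (near_cell s) _) (fun s x => cut_ge0 (near_cell s) _ x).
  apply: (le_trans E1).
  apply: (@le_trans _ _ (M * (\sum_s (C s * (d%:R * 2))) * eta)%:E); last first.
    by rewrite lee_fin -/D /eta mulrCA ger_pMr// ler_pdivrMr// mul1r lerDl.
  rewrite -mulrA (EFinM M); apply: lee_wpmul2l; first by rewrite lee_fin.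
  rewrite mulr_suml -sumEFin; apply: lee_sum => s _.
  have [C0 HCs] := HC s; apply: (le_trans (HCs f g Ff Fg)).
  rewrite lee_fin -mulrA ler_wpM2l// -mulrA; apply: enormC_coord => i; split.
    by have := cfg (s, i, true); rewrite /c/= !mxE !raddfB.
  by have := cfg (s, i, false); rewrite /c/= !mxE !raddfB.
have mfg : measM (fun x => f x - g x) by apply: measM_sub; exact: Fm.
have mst : measurable_fun [set: X] (fun x => \sum_(s : S) step f g s x)%E.
  by apply: emeasurable_sum => s; exact: mcut.
have st0 x : (0 <= \sum_(s : S) step f g s x)%E.
  by apply: sume_ge0 => s _; exact: cut_ge0.
have mrest : measurable_fun [set: X]
    (fun x => (far f x + far g x) + (osc f x + osc g x))%E.
  by apply: emeasurable_funD; apply: emeasurable_funD;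
    [exact: mfar|exact: mfar|exact: mosc|exact: mosc].
have rest0 x : (0 <= (far f x + far g x) + (osc f x + osc g x))%E.
  by apply: adde_ge0; apply: adde_ge0;
    [exact: far_ge0|exact: far_ge0|exact: osc_ge0|exact: osc_ge0].
have E := fnorm_le2 p1 pr w0 (measurable_vpw p mV mfg) mrest mst
  (fun x => vpw_ge0 p V _ x) rest0 st0 netK_ge0 (fun x => vpw_sub_le x Ff Fg).
apply: (le_trans E); rewrite /famK -mulrA (EFinM (netK `^ p^-1 * 8)).
apply: lee_wpmul2l; first by rewrite lee_fin; apply: mulr_ge0; [exact: powR_ge0|exact: ler0n].
rewrite (_ : 385 * e = 384 * e + e); last lra.
rewrite (EFinD (384 * e)); exact: leeD (fnorm_rest Ff Fg) steps.
Qed.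

End family.

(** * From Lebesgue measurable to Borel functions *)

Section nonmeasurable.
Local Open Scope ereal_scope.
Context {R : realType} {d : measure_display} {T : measurableType d}.
Variable mu : {measure set T -> \bar R}.

(** The integral of a nonnegative function is a supremum over the simple functions
    below it, hence monotone without any measurability; this is used for the operator
    norm of the weight. *)
Lemma ge0_le_integral_nonmeasurable (D : set T) (f g : T -> \bar R) :
  (forall x, 0 <= f x) -> (forall x, f x <= g x) ->
  \int[mu]_(x in D) f x <= \int[mu]_(x in D) g x.
Proof.
move=> f0 fg; have g0 x : 0 <= g x by exact: le_trans (fg x).
rewrite !ge0_integralE//; apply: ge_ereal_sup => _ [h hf <-].
apply: ereal_sup_ubound; exists h => // x; apply: (le_trans (hf x)).
by rewrite !patchE; case: ifP.
Qed.

End nonmeasurable.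

Section nnsup_theory.
Local Open Scope ereal_scope.
Context {R : realType}.

Lemma nnsup_ub (A : set (\bar R)) x : A x -> x <= nnsup A.
Proof. by move=> Ax; apply: ereal_sup_ubound; right. Qed.

Lemma cvg0_lt (T : Type) (G : set_system T) {FG : Filter G} (h : T -> \bar R)
    (e : R) : (0 < e)%R -> h x @[x --> G] --> 0 -> \forall x \near G, h x < e%:E.
Proof.
move=> e0 hG; have N : nbhs (0 : \bar R) [set y | y < e%:E].
  by apply: open_nbhs_nbhs; split; [exact: open_ereal_lt_ereal|rewrite /= lte_fin].
exact: (hG _ N).
Qed.

End nnsup_theory.

Section euclidean_norm.
Context {R : realType} (n : nat).
Implicit Types x : 'rV[R]_n.

Lemma le_enormR x i : `|x 0 i| <= enormR x.
Proof.
rewrite -sqrtr_sqr ler_wsqrtr// (bigD1 i)//= lerDl sumr_ge0// => k _.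
exact: sqr_ge0.
Qed.

Lemma enormR_le x (c : R) : 0 <= c -> (forall i, `|x 0 i| <= c) ->
  enormR x <= n%:R * c.
Proof.
move=> c0 xc; rewrite -(@ger0_norm _ (n%:R * c)) ?mulr_ge0// -sqrtr_sqr ler_wsqrtr//.
apply: (@le_trans _ _ (\sum_(i < n) c ^+ 2)).
  by apply: ler_sum => i _; rewrite -real_normK ?num_real// lerXn2r ?nnegrE.
rewrite sumr_const card_ord exprMn -[leLHS]mulr_natl ler_wpM2r ?sqr_ge0//.
by rewrite -natrX ler_nat; case: n => [|m]//; rewrite leq_pmulr.
Qed.

Lemma measurable_eballR (rho : R) : measurable (@eballR R n rho).
Proof.
have m : measurable_fun [set: 'rV[R]_n] (@enormR R n).
  apply: (measurableT_comp measurable_sqrt); apply: measurable_sum => i.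
  by apply: measurable_funX; exact: measurable_coord_rV.
have := m measurableT _ (measurable_itv `]-oo, rho[); rewrite setTI.
by congr (measurable _); apply/seteqP; split => x /=; rewrite in_itv.
Qed.

Lemma exists_dyadic_lt (b : R) : 0 < b -> exists j : int, (2 : R) ^ (- j) < b.
Proof.
move=> b0; pose m := (Num.truncn b^-1).+1.
exists m%:Z; rewrite -exprnN invf_plt ?posrE ?exprn_gt0//.
apply: (@lt_trans _ _ m%:R); first exact: truncnS_gt.
by rewrite -natrX ltr_nat ltn_expl.
Qed.

End euclidean_norm.

Section borel_reduction.
Context {R : realType} (n d : nat) (hd : (0 < d)%N).
Variables (p t : R) (r : \bar R) (W : 'rV[R]_n -> 'M[R[i]]_d).
Hypotheses (p1 : 1 <= p) (hW : matrix_weight W).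
Local Notation X := 'rV[R]_n.
Local Notation mu := (borel_lebesgue n).
Local Notation cX := (lebesgue_space R n).
Implicit Types f g : X -> 'cV[R[i]]_d.

Let p0 : 0 < p. Proof. exact: lt_le_trans p1. Qed.

(** On the exceptional null set both matrices are replaced by the identity, so that they
    become invertible everywhere. *)
Lemma borel_weight : exists (N : set X) (V W0 : X -> 'M[R[i]]_d),
  [/\ measurable N, mu N = 0%E,
    measM V /\ measM W0,
    forall x, V x \in unitmx /\ W0 x \in unitmx &
    forall x, ~ N x -> V x = mxpowR (W x) p^-1 /\ W0 x = W x].
Proof.
have [psd aeu lint] := hW.
have mW : @measM R _ cX _ _ W by move=> i j; have [] := lint i j.
have hermW x : W x \is hermsymmx by have [] := psd x.
have mA := measM_mxpowR (p^-1) mW hermW.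
have [N1 [mN1 N10 H1]] := borel_representativeM (mu := mu) mA.
have [N2 [mN2 N20 H2]] := borel_representativeM (mu := mu) mW.
have [N3 [mN3 N30 H3]] := borel_null_cover (mu := mu) aeu.
pose N := N1 `|` N2 `|` N3.
have mN : measurable N by apply: measurableU => //; exact: measurableU.
have N0 : mu N = 0%E.
  by rewrite !measureU0//; exact: measurableU.
exists N, (fun x => if x \in N then 1%:M else mxpowR (W x) p^-1),
  (fun x => if x \in N then 1%:M else W x); split => //.
- by split; [apply: H1|apply: H2] => // x Nx; left; [left|right].
- move=> x; case: ifPn => [|/negP xN]; first by rewrite unitmx1.
  have uW : W x \in unitmx.
    by apply: contrapT => nu; apply: xN; apply/mem_set; right; apply: H3.
  by split => //; exact: mxpowR_unitmx.
- by move=> x Nx; rewrite memNset.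
Qed.

(** The operator norm is at least the length of the first column, which is positive
    almost everywhere because the weight is invertible almost everywhere. *)
Lemma weight_of_gt0 (Q : set X) : measurable Q -> (0 < mu Q)%E -> (mu Q < +oo)%E ->
  (0 < weight_of W Q)%E.
Proof.
move=> mQ Q0 Qoo; have [N [V [W0 [mN N0 [_ mW0] uV HN]]]] := borel_weight.
pose v : 'cV[R[i]]_d := delta_mx (Ordinal hd) 0.
have v1 : enormC v = 1 by exact: enormC_delta.
have [a a0 Ha] := pw_lower (lexx 1) mW0 (fun x => (uV x).2) mQ Q0 Qoo.
have pwv : pw 1 v = 1 by rewrite /pw v1 powR1.
apply: (@lt_le_trans _ _ (\int[mu]_(x in Q) vpw 1 W0 (fun=> v) x)%E).
  by apply: lt_le_trans (Ha v); rewrite pwv mulr1 lte_fin.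
rewrite -(@integral_completed _ _ _ mu Q N
  (fun x => (enormC (W x *m v))%:E) (vpw 1 W0 (fun=> v)) mQ mN N0).
- apply: ge0_le_integral_nonmeasurable => x; first by rewrite lee_fin enormC_ge0.
  by rewrite lee_fin; exact: enormC_le_opnorm.
- by apply: measurable_vpw => //; exact: measM_cst.
- by move=> x; exact: vpw_ge0.
- by move=> x; rewrite lee_fin enormC_ge0.
- by move=> x Nx; rewrite vpwE /pw powRr1 ?enormC_ge0// (HN x Nx).2.
Qed.

Definition cube_weight (jk : int * 'rV[int]_n) : \bar R :=
  ((weight_of W (dyadic_cube jk.1 jk.2) `^ (t^-1 - p^-1)) `^ p)%E.

Lemma cube_weight_gt0 jk : (0 < cube_weight jk)%E.
Proof.
apply: poweR_gt0; apply: poweR_gt0; apply: weight_of_gt0.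
- exact: measurable_dyadic_cube.
- rewrite [X in (0 < X)%E](_ : _ = ((2 ^ (- jk.1)) ^+ n)%:E); last exact: borel_lebesgue_dyadic.
  by rewrite lte_fin exprn_gt0// dyadic_step_gt0.
- rewrite [X in (X < _)%E](_ : _ = ((2 ^ (- jk.1)) ^+ n)%:E); last exact: borel_lebesgue_dyadic.
  exact: ltry.
Qed.

(** Changing the weight and the function on a null set does not affect the integrals
    over the cubes. *)
Lemma BM_norm_borel (N : set X) V f f0 : measM V -> measM f0 ->
  measurable N -> mu N = 0%E ->
  (forall x, ~ N x -> V x *m f0 x = mxpowR (W x) p^-1 *m f x) ->
  BM_norm W p t r f = fnorm p r cube_weight (vpw p V f0).
Proof.
move=> mV mf0 mN N0 H; rewrite /BM_norm /fnorm; congr lnorm; apply/funext => jk.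
have I0 : (0 <= cube_integral (vpw p V f0) jk)%E.
  by apply: integral_ge0 => x _; exact: vpw_ge0.
have IE : weighted_integral W p f (dyadic_cube jk.1 jk.2) =
    cube_integral (vpw p V f0) jk.
  have h0 x : (0 <= (enormC (mxpowR (W x) p^-1 *m f x) `^ p)%:E)%E.
    by rewrite lee_fin powR_ge0.
  have hg x : ~ N x -> (enormC (mxpowR (W x) p^-1 *m f x) `^ p)%:E = vpw p V f0 x.
    by move=> Nx; rewrite vpwE H.
  exact: (integral_completed (measurable_dyadic_cube jk.1 jk.2) mN N0
    (measurable_vpw p mV mf0) (vpw_ge0 p V f0) h0 hg).
by rewrite /= IE poweRM ?poweR_ge0// /cube_weight poweRKV ?gt_eqF ?poweR_ge0.
Qed.

End borel_reduction.

Theorem theorem3p2 (R : realType) (n d : nat) (hn : (0 < n)%N) (hd : (0 < d)%N)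
  (p t : R) (r : \bar R)
  (hptr : [/\ 1 <= p, p < t, (t%:E < r)%E & (r < +oo)%E] \/
          [/\ 1 <= p, p <= t & r = +oo%E])
  (W : 'rV[R]_n -> 'M[R[i]]_d) (hW : matrix_weight W)
  (F : set ('rV[R]_n -> 'cV[R[i]]_d)) (hF : F `<=` BM_space W p t r)
  (vanish : vanishes_at_infinity W p t r F)
  (equicont : BM_equicontinuous W p t r F) :
  BM_totally_bounded W p t r F.
Proof.
have p1 : 1 <= p by case: hptr => -[].
have pr : (p%:E <= r)%E.
  case: hptr => [[_ pt tr _]|[_ _ ->]]; last exact: leey.
  by apply: ltW; apply: lt_trans tr; rewrite lte_fin.
move=> eps eps0.
have K0 := famK_ge0 (R := R) n d p.
pose e := eps / (famK n d p + 1).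
have K1 : 0 < famK n d p + 1 by rewrite ltr_wpDl.
have e0 : 0 < e by rewrite divr_gt0.
have Ke : famK n d p * e < eps.
  by rewrite /e mulrCA gtr_pMr// ltr_pdivrMr// mul1r ltrDl.
have [N [V [W0 [mN N0 [mV _] uV HN]]]] := borel_weight p hW.
have BM := BM_norm_borel t r p1 (W := W).
have /choice[rep Hrep] : forall f : 'rV[R]_n -> 'cV[R[i]]_d,
    exists gM : ('rV[R]_n -> 'cV[R[i]]_d) * set 'rV[R]_n,
    Lp_loc W p f -> [/\ measM gM.1, measurable gM.2, borel_lebesgue n gM.2 = 0%E &
      forall x, ~ gM.2 x -> gM.1 x = f x].
  move=> f; have [[mf _]|nf] := pselect (Lp_loc W p f); last by exists (f, set0).
  have mf' : @measM R _ (lebesgue_space R n) _ _ f.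
    by move=> i k; rewrite (ord1 k); exact: mf.
  have [M [mM M0 HM]] := borel_representativeM (mu := borel_lebesgue n) mf'.
  exists ((fun x => if x \in M then 0 else f x), M) => _; split => //=.
    exact: HM.
  by move=> x Mx; rewrite memNset.
have FLp f : F f -> Lp_loc W p f by move=> /hF[].
have [b [b0 Hb]] : exists b : R, 0 < b /\
  (nnsup [set nnsup [set BM_norm W p t r (fun x => f x - translate y f x)%R
                   | y in eballR b] | f in F] < e%:E)%E.
  have [b [b0 Hb]] := filter_ex (filterI (nbhs_right_gt (0 : R)) (cvg0_lt e0 equicont)).
  by exists b.
have [rho Hrho] := filter_ex (cvg0_lt e0 vanish).
have [j jb] : exists j : int, (2 : R) ^ (- j) < b / (2 * n%:R + 1).
  by apply: exists_dyadic_lt; rewrite divr_gt0// ltr_wpDl.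
have delta0 := dyadic_step_gt0 (R := R) j.
pose K := (Num.truncn (`|rho| / 2 ^ (- j))).+1.
pose F0 := [set (rep f).1 | f in F].
have F0m f : F0 f -> measM f.
  by move=> [g Fg <-]; have [] := Hrep g (FLp g Fg).
have := @family_net R n d (Ordinal hn) p r (cube_weight p t W) V p1 pr
  (cube_weight_gt0 hd p t hW) mV (fun x => (uV x).1) j F0 (eballR rho) K e (ltW e0)
  (measurable_eballR rho).
have RepP f : F f -> [/\ measM (rep f).1, measurable (rep f).2,
    borel_lebesgue n (rep f).2 = 0%E & forall x, ~ (rep f).2 x -> (rep f).1 x = f x].
  by move=> /FLp; exact: Hrep.
have null2 (A B : set 'rV[R]_n) : measurable A -> borel_lebesgue n A = 0%E -> measurable B ->
    borel_lebesgue n B = 0%E -> measurable (A `|` B) /\ borel_lebesgue n (A `|` B) = 0%E.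
  by move=> mA A0 mB B0; split; [exact: measurableU|rewrite measureU0].
case.
- move=> x xrho i; apply: (le_lt_trans (le_enormR _ _)); apply: (lt_le_trans xrho).
  rewrite (le_trans (ler_norm _))// mulrC -ler_pdivrMr// ltW// /K.
  exact: truncnS_gt.
- exact: F0m.
- move=> _ [f Ff <-]; have [mf mM M0 HM] := RepP f Ff.
  have [mNM NM0] := null2 _ _ mN N0 mM M0.
  have E : BM_norm W p t r f = fnorm p r (cube_weight p t W) (vpw p V (rep f).1).
    apply: (BM _ _ _ _ mV mf mNM NM0) => x /not_orP[Nx Mx].
    by rewrite (HN x Nx).1 (HM _ Mx).
  by rewrite -E; have [_] := hF _ Ff.
- move=> _ y [f Ff <-] sy; have [mf mM M0 HM] := RepP f Ff.
  have mS : measurable ((fun x => x + y) @^-1` (rep f).2).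
    by rewrite -[X in measurable X]setTI; apply: measurable_shift.
  have S0 : borel_lebesgue n ((fun x => x + y) @^-1` (rep f).2) = 0%E.
    by rewrite borel_lebesgue_shift.
  have [mNM NM0] := null2 _ _ mN N0 mM M0.
  have [mA A0] := null2 _ _ mNM NM0 mS S0.
  have mg : measM (fun x => (rep f).1 x - (rep f).1 (x + y)).
    by apply: measM_sub => //; apply: (measM_comp mf); exact: measurable_shift.
  have E : fnorm p r (cube_weight p t W) (fun x => diffpw p V (rep f).1 x y) =
      BM_norm W p t r (fun x => f x - translate (- y) f x).
    have -> : (fun x => diffpw p V (rep f).1 x y) =
        vpw p V (fun x => (rep f).1 x - (rep f).1 (x + y)).
      by apply/funext => x; rewrite vpwE /diffpw [y + x]addrC.
    apply/esym; apply: (BM _ _ _ _ mV mg mA A0) => x /not_orP[/not_orP[Nx Mx] Sx].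
    by rewrite (HN x Nx).1 (HM _ Mx) (HM _ Sx) /translate opprK.
  rewrite E; apply: (le_trans _ (ltW Hb)).
  apply: (@le_trans _ _ (nnsup [set BM_norm W p t r (fun x => f x - translate y f x)%R
                   | y in eballR b])); last by apply: nnsup_ub; exists f.
  apply: nnsup_ub; exists (- y) => //=.
  apply: (le_lt_trans (enormR_le (c := 2 * 2 ^ (- j)) _ _)).
  + by rewrite mulr_ge0 ?ltW.
  + by move=> i; have := sy i; rewrite !mxE normrN ler_norml => /andP[-> /ltW].
  + move: jb; rewrite ltr_pdivlMr; last by rewrite ltr_wpDl.
    by apply: le_lt_trans; lra.
- move=> _ [f Ff <-]; have [mf mM M0 HM] := RepP f Ff.
  have [mNM NM0] := null2 _ _ mN N0 mM M0.
  have mg : measM (cutoff (~` eballR rho) (rep f).1).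
    rewrite (_ : cutoff _ _ = fun x => if x \in ~` eballR rho then (rep f).1 x else 0).
      apply: measM_if; [|exact: mf|exact: measM_cst].
      by apply: measurableC; exact: measurable_eballR.
    by apply/funext => x; rewrite /cutoff indicE; case: ifP; rewrite ?scale1r ?scale0r.
  have E : fnorm p r (cube_weight p t W)
      (fun x => vpw p V (rep f).1 x * (\1_(~` eballR rho) x)%:E)%E =
      BM_norm W p t r (cutoff (~` eballR rho) f).
    have -> : (fun x => vpw p V (rep f).1 x * (\1_(~` eballR rho) x)%:E)%E =
        vpw p V (cutoff (~` eballR rho) (rep f).1).
      apply/funext => x; rewrite !vpwE /cutoff !indicE.
      case: (x \in ~` eballR rho); first by rewrite scale1r mule1.
      by rewrite scale0r mulmx0 mule0 /pw enormC0 powR0// gt_eqF// (lt_le_trans ltr01).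
    apply/esym; apply: (BM _ _ _ _ mV mg mNM NM0) => x /not_orP[Nx Mx].
    by rewrite (HN x Nx).1 /cutoff (HM _ Mx).
  by rewrite E; apply: (le_trans _ (ltW Hrho)); apply: nnsup_ub; exists f.
- by [].
move=> N1 [finN1 N1F HN1].
have /choice[sec Hsec] : forall g, exists f, N1 g -> F f /\ (rep f).1 = g.
  move=> g; have [/N1F[f Ff fg]|Ng] := pselect (N1 g); first by exists f.
  by exists g.
exists (sec @` N1); split.
- exact: finite_image.
- by move=> _ [g Ng <-]; apply: hF; have [] := Hsec g Ng.
- move=> f Ff; have [g Ng gf] := HN1 (rep f).1 (ex_intro2 _ _ f Ff erefl).
  exists (sec g); first by exists g.
  have [Fg rg] := Hsec g Ng; rewrite -rg in gf.
  have [mf mM M0 HM] := RepP f Ff; have [mg mM' M0' HM'] := RepP _ Fg.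
  have [mNM NM0] := null2 _ _ mN N0 mM M0.
  have [mA A0] := null2 _ _ mNM NM0 mM' M0'.
  have mfg : measM (fun x => (rep f).1 x - (rep (sec g)).1 x) by exact: measM_sub.
  have E : BM_norm W p t r (fun x => f x - sec g x) =
      fnorm p r (cube_weight p t W) (vpw p V (fun x => (rep f).1 x - (rep (sec g)).1 x)).
    apply: (BM _ _ _ _ mV mfg mA A0) => x /not_orP[/not_orP[Nx Mx] Mx'].
    by rewrite (HN x Nx).1 (HM _ Mx) (HM' _ Mx').
  by rewrite E; apply: (le_lt_trans gf); rewrite lte_fin.
Qed.
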